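(* For $p\in[-1,1]$ let $\alpha=1$ if $p\in(-1,1)$ and $\alpha=1/2$ if $p=1$. Then as $N\to\infty$, $$\frac{1}{N^\alpha}\widehat D_{1,1}^{(N,1)}(\sqrt Np+\chi)\to\begin{cases}\rho_{\mathrm b}(p),&p\in(-1,1),\\ \rho_{\mathrm e}(\chi),&p=1,\end{cases}$$ uniformly for $\chi$ in compact subsets of $\mathbb{R}$, where $\rho_{\mathrm b}(p)=\frac23(1-p^2)$ and $$\rho_{\mathrm e}(\chi)=\frac{\sqrt2}{3\sqrt\pi}\frac{e^{-4\chi^2}+\sqrt{2\pi}\chi e^{-2\chi^2}\operatorname{erfc}(\sqrt2\chi)-4\sqrt\pi\chi\operatorname{erfc}(2\chi)}{\sqrt2\operatorname{erfc}(2\chi)-e^{-2\chi^2}\operatorname{erfc}(\sqrt2\chi)}.$$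
   Context: $dA(z)=d^2z/\pi$; $Z_N^{(\mathrm g)}=N!\prod_{k=0}^{N-1}\frac{(2k+1)!}{2^{2k+1}}$. For $a\in\mathbb{R}$ let $\omega^{(\mathrm{over})}(z)=|z-a|^2(1+|z-a|^2)e^{-2|z|^2}$ and $Z_{N-1}^{(\mathrm{over})}(a)=\int_{\mathbb{C}^{N-1}}\prod_{j<k}|w_j-w_k|^2|w_j-\overline w_k|^2\prod_{j}|w_j-\overline w_j|^2\omega^{(\mathrm{over})}(w_j)dA(w_j)$. The Gaussian (symplectic Ginibre) skew-kernel is $\varkappa_N^{(\mathrm g)}(z,w)=\sqrt2\sum_{k=0}^{N-1}\sum_{\ell=0}^k\Big(\frac{(\sqrt2z)^{2k+1}}{(2k+1)!!}\frac{(\sqrt2w)^{2\ell}}{(2\ell)!!}-\frac{(\sqrt2w)^{2k+1}}{(2k+1)!!}\frac{(\sqrt2z)^{2\ell}}{(2\ell)!!}\Big)$ and $\widehat\varkappa_N^{(\mathrm g)}(x,a)=e^{-2xa}\varkappa_N^{(\mathrm g)}(x,a)$. For $a\in\mathbb{R}$, the conditional mean diagonal overlap of the symplectic Ginibre ensemble (mean diagonal eigenvector overlap density divided by the eigenvalue density, extended continuously to the real axis) is $$\widehat D_{1,1}^{(N,1)}(a)=\frac{NZ_{N-1}^{(\mathrm{over})}(a)}{Z_N^{(\mathrm g)}}\cdot\frac{e^{-2a^2}}{\partial_x\widehat\varkappa_N^{(\mathrm g)}(x,a)\big|_{x=a}}.$$ *)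

(* Defs.v *)
From HB Require Import structures.
From mathcomp Require Import all_boot all_order all_algebra.
From mathcomp Require Import all_classical all_reals all_analysis.
Set Implicit Arguments. Unset Strict Implicit. Unset Printing Implicit Defensive.
Import Order.TTheory GRing.Theory Num.Theory.
Import numFieldNormedType.Exports.
Local Open Scope classical_set_scope.
Local Open Scope ring_scope.

Fixpoint dfact (n : nat) : nat :=
  match n with
  | 0 => 1
  | 1 => 1
  | m.+2 => m.+2 * dfact m
  end%N.

Section Defs.
Variable R : realType.

Definition sqrt2 : R := Num.sqrt 2.

(* Gaussian symplectic Ginibre skew-kernel kappa_N^(g)(z,w), for real z,w *)
Definition kappa_g (N : nat) (z w : R) : R :=
  sqrt2 * \sum_(k < N) \sum_(l < k.+1)
    ( (sqrt2 * z) ^+ (2 * k + 1) / (dfact (2 * k + 1))%:R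
        * ((sqrt2 * w) ^+ (2 * l) / (dfact (2 * l))%:R)
    - (sqrt2 * w) ^+ (2 * k + 1) / (dfact (2 * k + 1))%:R
        * ((sqrt2 * z) ^+ (2 * l) / (dfact (2 * l))%:R)).

Definition kappa_hat (N : nat) (x a : R) : R := expR (- (2 * x * a)) * kappa_g N x a.

Definition Zg (N : nat) : R :=
  (N`!)%:R * \prod_(k < N) (((2 * k + 1)`!)%:R / 2 ^+ (2 * k + 1)).

(* omega^(over)(z) for z = x + i y *)
Definition omega_over (a x y : R) : R :=
  ((x - a) ^+ 2 + y ^+ 2) * (1 + ((x - a) ^+ 2 + y ^+ 2)) * expR (- (2 * (x ^+ 2 + y ^+ 2))).

(* integrand of Z^(over), the points w_j = x_j + i y_j given as (x_j, y_j);
   |w_j-w_k|^2 = (x_j-x_k)^2+(y_j-y_k)^2, |w_j-conj w_k|^2 = (x_j-x_k)^2+(y_j+y_k)^2,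
   |w_j - conj w_j|^2 = 4 y_j^2 *)
Definition over_integrand (a : R) (s : seq (R * R)) : R :=
  let n := size s in
  let X j := (nth (0, 0) s j).1 in
  let Y j := (nth (0, 0) s j).2 in
  (\prod_(j < n) \prod_(k < n | (j < k)%N)
      (((X j - X k) ^+ 2 + (Y j - Y k) ^+ 2) * ((X j - X k) ^+ 2 + (Y j + Y k) ^+ 2)))
  * \prod_(j < n) (4 * Y j ^+ 2 * omega_over a (X j) (Y j)).

(* iterated Lebesgue integral over (R^2)^n (integrand nonnegative) *)
Fixpoint iint (n : nat) (f : seq (R * R) -> \bar R) : \bar R :=
  match n with
  | 0 => f [::]
  | n'.+1 => (\int[@lebesgue_measure R]_x
               \int[@lebesgue_measure R]_y iint n' (fun s => f ((x : R, y : R) :: s)))%E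
  end.

(* Z_n^(over)(a), with dA(z) = d^2 z / pi *)
Definition Z_over (n : nat) (a : R) : R :=
  pi ^- n * fine (iint n (fun s => (over_integrand a s)%:E)).

Definition Dhat (N : nat) (a : R) : R :=
  N%:R * Z_over N.-1 a / Zg N
  * (expR (- (2 * a ^+ 2)) / derive1 (fun x => kappa_hat N x a) a).

Definition erfc (x : R) : R :=
  2 / Num.sqrt pi * fine (\int[@lebesgue_measure R]_(t in `[x, +oo[) (expR (- t ^+ 2))%:E)%E.

Definition rho_b (p : R) : R := 2 / 3 * (1 - p ^+ 2).

Definition rho_e (chi : R) : R :=
  sqrt2 / (3 * Num.sqrt pi) *
  ((expR (- (4 * chi ^+ 2)) + Num.sqrt (2 * pi) * chi * expR (- (2 * chi ^+ 2)) * erfc (sqrt2 * chi)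
     - 4 * Num.sqrt pi * chi * erfc (2 * chi))
   / (sqrt2 * erfc (2 * chi) - expR (- (2 * chi ^+ 2)) * erfc (sqrt2 * chi))).

End Defs.

(* Main.v *)
Require Import Defs.
From HB Require Import structures.
From mathcomp Require Import all_boot all_order all_algebra.
From mathcomp Require Import all_classical all_reals all_analysis.
From mathcomp Require Import all_fingroup measurable_realfun complex ring lra zify.
Import Order.TTheory GRing.Theory Num.Theory.
Import numFieldNormedType.Exports.
Local Open Scope classical_set_scope.
Local Open Scope ring_scope.
Set Implicit Arguments. Unset Strict Implicit. Unset Printing Implicit Defensive.

(** For finite N everything is explicit. The factor |z - a|^2 of the weight enters the
    product of differences as one more point a, so the partition function becomes, after
    antisymmetrisation, a Pfaffian of the skew form of the weight
    (1 + |z - a|^2) e^{-2|z|^2} bordered by one row. That form has only two bands in the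
    monomial basis, so its skew-orthogonal polynomials satisfy a two-term recursion, which
    is solved by truncated exponentials. This gives Dhat N a as a ratio of expressions in
    the distribution functions of Poisson variables with means a^2 and 2a^2. In the bulk
    these are controlled by Chebyshev's inequality; at the edge they converge to erfc,
    because the derivative of y |-> P(Poisson((sqrt N + y)^2) < N) converges to a Gaussian
    up to a constant, and the constant is forced by the total mass. *)

(** * Gaussian moments and iterated integrals *)

(** The weight (1 + |z - a|^2) e^{-2|z|^2} is not radial, but z^j conj(z)^k are orthogonal for
    e^{-2|z|^2} and (z - conj z)(1 + |z - a|^2) has few monomials, so only neighbouring degrees
    interact. The skew norms form a continued fraction; as ratios of consecutive solutions of a
    linear recursion ([presum]) their product telescopes, and what remains cancels the denominator
    of the top polynomial at a. Integrals stay out of the algebra: moments are a linear functional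
    on bivariate polynomials, and the integrand is a finite sum of products over the points, so
    neither polar coordinates nor Fubini enter. The exponents come from N - s with s = a^2: of order
    N in the bulk, but of order sqrt N at s = (sqrt N + chi)^2. At the edge all three terms of the
    numerator then have the same order, and the limit denominator has to be proved positive. The
    factorial constants there are expressed through the peaks of two Poisson densities, at N and at
    2N, so one normalisation argument replaces both Stirling and Wallis asymptotics. *)

Section GaussMoments.
Variable R : realType.
Notation mu := (@lebesgue_measure R).
Implicit Types (f F : R -> R) (i j n : nat) (x y : R).

Lemma derivative_continuous f (df : R -> R) :
  (forall x, is_derive x 1 f (df x)) -> continuous f.
Proof.
move=> fE x; apply/differentiable_continuous/derivable1_diffP.
by have [] := fE x.
Qed.

Lemma integral_derivative f F a b :
  a < b -> continuous f -> (forall x, is_derive x 1 F (f x)) ->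
  (\int[mu]_(x in `[a, b]) (f x)%:E = (F b - F a)%:E)%E.
Proof.
move=> ab cf dF; have cF := derivative_continuous dF.
rewrite (continuous_FTC2 (F := F)) ?EFinB//.
- exact: continuous_subspaceT.
- split => [x _||]; first by have [] := dF x.
  + exact/cvg_at_right_filter/cF.
  + exact/cvg_at_left_filter/cF.
- by move=> x _; rewrite derive1E; have [_ ->] := dF x.
Qed.

(** Dominated convergence on [-n, n], with |f| as the bound, reduces the line to the fundamental
    theorem, so only limits of [F] along the integers matter. It supplies integration by parts for
    the moments. *)
Lemma integralT_derivative f F :
  continuous f -> mu.-integrable setT (EFin \o f) ->
  (forall x, is_derive x 1 F (f x)) ->
  F n%:R @[n --> \oo] --> 0 -> F (- n%:R) @[n --> \oo] --> 0 ->
  (\int[mu]_x (f x)%:E = 0)%E.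
Proof.
move=> cf fi dF Fy FNy.
pose f_ (n : nat) : R -> \bar R := EFin \o (f \_ `[- n%:R, n%:R]).
have /measurable_int mf := fi.
have /cvg_lim <- // : (\int[mu]_x f_ n x)%E @[n --> \oo] --> (\int[mu]_x (f x)%:E)%E.
  apply: (@dominated_cvg _ _ _ mu setT _ f_ _ (abse \o (EFin \o f))) => //.
  - move=> n; apply/measurable_EFinP.
    apply/(measurable_restrictT _ (measurable_itv _)).
    by apply/measurable_funTS/measurable_EFinP.
  - move=> x _; apply: cvg_near_cst; near=> n.
    rewrite /f_ /= patchE mem_set//= in_itv/= -ler_norml.
    by near: n; exact: nbhs_infty_ger.
  - exact: integrable_abse.
  - move=> n x _; rewrite /f_ /= patchE; case: ifP => //= _.
    by rewrite normr0 lee_fin.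
apply/cvg_lim => //.
have h : (F n%:R - F (- n%:R)) @[n --> \oo] --> (0 - 0 : R) by exact: cvgB.
rewrite subr0 in h.
have h' : (F n%:R - F (- n%:R))%:E @[n --> \oo] --> (0 : R)%:E.
  by apply: cvg_EFin; [exact: nearW|exact: h].
apply: cvg_trans h'.
apply: near_eq_cvg; near=> n.
rewrite /f_ -restrict_EFin -integral_mkcond integral_derivative//.
have : (0 < n)%N by near: n; exact: nbhs_infty_gt.
by rewrite -(ltr_nat R) => n0; lra.
Unshelve. all: by end_near. Qed.

Lemma is_derive_cstfun (c : R) x : is_derive x 1 (fun=> c) (0 : R).
Proof. exact: is_derive_cst. Qed.

Lemma is_derive_mulfun f g x (a b : R) : is_derive x 1 f a -> is_derive x 1 g b ->
  is_derive x 1 (fun y => f y * g y) (a * g x + f x * b).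
Proof.
by move=> fa gb; apply: is_derive_eq (is_deriveM fa gb) _; rewrite /GRing.scale/=; ring.
Qed.

Lemma is_derive_powfun f x (a : R) n : is_derive x 1 f a ->
  is_derive x 1 (fun y => f y ^+ n) (n%:R * f x ^+ n.-1 * a).
Proof.
move=> fa; have -> : (fun y => f y ^+ n) = f ^+ n by apply/funext => y; rewrite fctE.
exact: is_deriveX.
Qed.

Lemma is_derive_expfun f x (a : R) : is_derive x 1 f a ->
  is_derive x 1 (fun y => expR (f y)) (a * expR (f x)).
Proof. by move=> fa; apply: is_derive_eq (is_derive1_comp _ fa) _ => //; rewrite mulrC. Qed.

Lemma is_derive_eqfun f g x (a b : R) : f =1 g -> a = b ->
  is_derive x 1 f a -> is_derive x 1 g b.
Proof. by move=> /funext -> ->. Qed.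

(** One coordinate of the Gaussian factor e^{-2|z|^2}. *)
Definition gauss2 x : R := expR (- (2 * x ^+ 2)).

Lemma continuous_gauss2 : continuous gauss2.
Proof.
apply: (@derivative_continuous _ (fun x => (- (4 * x)) * gauss2 x)) => x.
rewrite /gauss2; apply: trigger_derive; rewrite /GRing.scale/=; ring.
Qed.

(** Half of the exponent absorbs the monomial: e^t >= 1 + t^i / i! at t = x^2 bounds x^(2i) by a
    multiple of e^(x^2), and the other half remains as the integrable [gauss_fun]. *)
Lemma monomial_gauss2_le i x :
  `|x ^+ i * gauss2 x| <= (1 + i`!%:R) * gauss_fun x.
Proof.
rewrite /gauss2 /gauss_fun normrM (ger0_norm (expR_ge0 _)).
have -> : expR (- (2 * x ^+ 2)) = expR (- x ^+ 2) * expR (- x ^+ 2).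
  by rewrite -expRD; congr expR; ring.
rewrite mulrA; apply: ler_wpM2r; first exact: expR_ge0.
rewrite expRN ler_pdivrMr ?expR_gt0// normrX.
case: i => [|i].
  rewrite expr0 fact0; have := @expR_ge1Dx R (x ^+ 2).
  by have := sqr_ge0 x; lra.
have x2 := sqr_ge0 x.
have /= := expR_ge1Dxn i x2.
set E := expR _ => EE; have i1 : 1 <= i.+1`!%:R :> R by rewrite ler1n fact_gt0.
have xi : `|x| ^+ i.+1 <= 1 + (x ^+ 2) ^+ i.+1.
  rewrite -(real_normK (num_real x)).
  have := normr_ge0 x; rewrite -exprM mulnC exprM.
  move: (`|x| ^+ i.+1) => t _; nra.
apply: le_trans xi _.
have : (x ^+ 2) ^+ i.+1 <= i.+1`!%:R * (E - 1).
  by rewrite -ler_pdivrMl ?(lt_le_trans _ i1)// mulrC; lra.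
have E1 : 1 <= E by apply: le_trans (expR_ge1Dx _); rewrite lerDl.
by move=> h; lra.
Qed.

Lemma integrable_monomial_gauss2 i :
  mu.-integrable [set: R] (fun x => (x ^+ i * gauss2 x)%:E).
Proof.
have gi : mu.-integrable [set: R] (fun x => ((1 + i`!%:R) * gauss_fun x)%:E).
  by under eq_fun do rewrite EFinM; apply: integrableZl => //; exact: integrableT_gauss.
apply: le_integrable gi => //.
- apply/measurable_EFinP; apply: continuous_measurable_fun => x.
  by apply: cvgM; [exact: exprn_continuous|exact: continuous_gauss2].
- move=> x _; rewrite !abse_EFin lee_fin (le_trans (monomial_gauss2_le i x))//.
  exact: ler_norm.
Qed.

Lemma monomial_gauss2_cvg0 i (u : nat -> R) : (forall n, `|u n| = n%:R) ->
  (u n ^+ i * gauss2 (u n)) @[n --> \oo] --> 0.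
Proof.
move=> un; apply: norm_cvg0.
have h : (1 + i`!%:R) * expR (- n%:R) @[n --> \oo] --> (1 + i`!%:R) * (0 : R).
  by apply: cvgM; [exact: cvg_cst|exact: cvgn_expR].
rewrite mulr0 in h.
apply: (squeeze_cvgr _ (cvg_cst (0 : R)) h); apply: nearW => n; rewrite normr_ge0/=.
apply: le_trans (monomial_gauss2_le i (u n)) _.
rewrite ler_wpM2l ?addr_ge0// /gauss_fun ler_expR lerN2.
rewrite -(real_normK (num_real (u n))) un -natrX ler_nat.
by case: n => // n; rewrite -{1}(expn1 n.+1) leq_pexp2l.
Qed.

Definition gmom i : R := \int[mu]_x (x ^+ i * gauss2 x).

Lemma gmomE i : (\int[mu]_x (x ^+ i * gauss2 x)%:E = (gmom i)%:E)%E.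
Proof.
rewrite /gmom /Rintegral fineK//.
exact: integrable_fin_num (integrable_monomial_gauss2 i).
Qed.

(** Integration by parts on x^i e^{-2x^2}. At i = 0 the vanishing coefficient makes the value of
    [i.-1] harmless and gives the zero first moment. *)
Lemma gmom_rec i : 4 * gmom i.+1 = i%:R * gmom i.-1.
Proof.
pose F x := x ^+ i * gauss2 x.
pose f x := i%:R * (x ^+ i.-1 * gauss2 x) - 4 * (x ^+ i.+1 * gauss2 x).
have dF x : is_derive x 1 F (f x).
  have dg : is_derive x 1 (fun y => - (2 * y ^+ 2)) (- (4 * x)).
    by apply: trigger_derive; rewrite /GRing.scale/=; ring.
  apply: is_derive_eqfun (is_derive_mulfun
    (is_derive_powfun i (is_derive_id x 1)) (is_derive_expfun dg)) => //.
  by rewrite /f /gauss2 (exprS x i) /=; ring.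
have i1 := integrable_monomial_gauss2 i.-1; have i2 := integrable_monomial_gauss2 i.+1.
have fi : mu.-integrable [set: R] (EFin \o f).
  have -> : EFin \o f = ((fun x => i%:R%:E * (x ^+ i.-1 * gauss2 x)%:E) \-
     (fun x => 4%:E * (x ^+ i.+1 * gauss2 x)%:E))%E.
    by apply/funext => x; rewrite /= /f EFinB !EFinM.
  by apply: integrableB => //; exact: integrableZl.
have cf : continuous f.
  move=> x; apply: cvgB; (apply: cvgM; [exact: cvg_cst|apply: cvgM]);
    solve [exact: exprn_continuous|exact: continuous_gauss2].
have := integralT_derivative cf fi dF.
rewrite /F => /(_ (monomial_gauss2_cvg0 _ _) (monomial_gauss2_cvg0 _ _)) h.
have {h} : (\int[mu]_x (f x)%:E = 0)%E.
  by apply: h => n; rewrite ?normrN normr_nat.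
rewrite /f; under eq_integral do rewrite EFinB !EFinM.
rewrite integralB//; [|exact: integrableZl..].
rewrite !integralZl//.
under eq_integral do rewrite -EFinM; rewrite gmomE.
under eq_integral do rewrite -EFinM; rewrite gmomE.
by rewrite -!EFinM -EFinB => -[] /eqP; rewrite subr_eq0 => /eqP.
Qed.

(** The square suffices, since a planar moment contains two one-dimensional masses. Standard
    deviation 1/2 is the one whose density is proportional to e^{-2x^2}. *)
Lemma gmom0 : gmom 0 ^+ 2 = pi / 2.
Proof.
have h2 : (2^-1 : R) != 0 by rewrite gt_eqF.
have : (\int[mu]_x (normal_pdf 0 (2^-1 : R) x)%:E = 1)%E by exact: integral_normal_pdf.
have E x : normal_pdf 0 (2^-1) x = normal_peak (2^-1) * (x ^+ 0 * gauss2 x).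
  rewrite normal_pdfE//= /normal_fun /gauss2 expr0 mul1r. congr (_ * expR _).
  by field.
under eq_integral do rewrite E EFinM.
rewrite integralZl//; last exact: integrable_monomial_gauss2.
rewrite gmomE -EFinM => -[] /(congr1 (fun t => t ^+ 2)).
have p0 := pi_gt0 R.
rewrite exprMn expr1n /normal_peak exprVn sqr_sqrtr; last first.
  by rewrite mulrn_wge0// mulr_ge0 ?pi_ge0.
move: (@pi R) p0 => P p0 H.
have <- : (2^-1 ^+ 2 * P *+ 2) * ((2^-1 ^+ 2 * P *+ 2)^-1 * gmom 0 ^+ 2) = gmom 0 ^+ 2.
  by field; rewrite gt_eqF.
by rewrite H; field.
Qed.

(** Integrability of both stages travels with the value, so that linear combinations can be
    integrated in the nested order of [iint] without exchanging integrals. *)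
Definition iterated_integral (h : R -> R -> R) (v : R) :=
  [/\ forall x, mu.-integrable [set: R] (fun y => (h x y)%:E),
      mu.-integrable [set: R] (fun x => \int[mu]_y (h x y)%:E)%E &
      (\int[mu]_x \int[mu]_y (h x y)%:E = v%:E)%E].

Lemma iterated_integral_monomial i j :
  iterated_integral (fun x y => x ^+ i * y ^+ j * (gauss2 x * gauss2 y)) (gmom i * gmom j).
Proof.
have E x : (fun y => (x ^+ i * y ^+ j * (gauss2 x * gauss2 y))%:E) =
    (fun y => (x ^+ i * gauss2 x)%:E * (y ^+ j * gauss2 y)%:E)%E.
  by apply/funext => y; rewrite -EFinM; congr EFin; ring.
have E2 x : (\int[mu]_y (x ^+ i * y ^+ j * (gauss2 x * gauss2 y))%:E =
    (gmom j)%:E * (x ^+ i * gauss2 x)%:E)%E.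
  rewrite E integralZl//; last exact: integrable_monomial_gauss2.
  by rewrite gmomE muleC.
split.
- by move=> x; rewrite E; apply: integrableZl => //; exact: integrable_monomial_gauss2.
- by under eq_fun do rewrite E2; apply: integrableZl => //; exact: integrable_monomial_gauss2.
- under eq_integral do rewrite E2.
  rewrite integralZl//; last exact: integrable_monomial_gauss2.
  by rewrite gmomE -EFinM mulrC.
Qed.

Lemma iterated_integral_ext h g v w : (forall x y, h x y = g x y) -> v = w ->
  iterated_integral h v -> iterated_integral g w.
Proof.
move=> hg ->; have -> // : h = g.
by apply/funext => x; apply/funext => y.
Qed.

Lemma iterated_integral0 : iterated_integral (fun _ _ => 0) 0.
Proof.
split; last by under eq_integral do rewrite integral0; rewrite integral0.
  by move=> _; exact: integrable0.
by under eq_fun do rewrite integral0; exact: integrable0.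
Qed.

Lemma iterated_integralZ c h v :
  iterated_integral h v -> iterated_integral (fun x y => c * h x y) (c * v).
Proof.
move=> [hi hii hv].
have E x : (\int[mu]_y (c * h x y)%:E = c%:E * \int[mu]_y (h x y)%:E)%E.
  by under eq_integral do rewrite EFinM; rewrite integralZl.
split.
- by move=> x; under eq_fun do rewrite EFinM; exact: integrableZl.
- by under eq_fun do rewrite E; exact: integrableZl.
- by under eq_integral do rewrite E; rewrite integralZl// hv EFinM.
Qed.

Lemma iterated_integralD h g v w : iterated_integral h v -> iterated_integral g w ->
  iterated_integral (fun x y => h x y + g x y) (v + w).
Proof.
move=> [hi hii hv] [gi gii gw].
have E x : (\int[mu]_y (h x y + g x y)%:E =
    \int[mu]_y (h x y)%:E + \int[mu]_y (g x y)%:E)%E.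
  by under eq_integral do rewrite EFinD; rewrite integralD.
split.
- by move=> x; under eq_fun do rewrite EFinD; exact: integrableD.
- by under eq_fun do rewrite E; exact: integrableD.
- by under eq_integral do rewrite E; rewrite integralD// hv gw EFinD.
Qed.

Lemma iterated_integral_sum (I : Type) (r : seq I) (P : pred I) (h : I -> R -> R -> R) (v : I -> R) :
  (forall t, P t -> iterated_integral (h t) (v t)) ->
  iterated_integral (fun x y => \sum_(t <- r | P t) h t x y) (\sum_(t <- r | P t) v t).
Proof.
move=> hv; elim: r => [|t r ih].
  by apply: iterated_integral_ext iterated_integral0 => [x y|]; rewrite big_nil.
apply: (@iterated_integral_ext
  (fun x y => (if P t then h t x y else 0) + \sum_(t <- r | P t) h t x y)
  _ ((if P t then v t else 0) + \sum_(t <- r | P t) v t)) => [x y||].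
- by rewrite big_cons; case: ifP => //; rewrite add0r.
- by rewrite big_cons; case: ifP => //; rewrite add0r.
- apply: iterated_integralD ih; case: ifP => [/hv //|_]; exact: iterated_integral0.
Qed.

Lemma eq_iint n (f g : seq (R * R) -> \bar R) :
  (forall s, size s = n -> f s = g s) -> iint n f = iint n g.
Proof.
elim: n f g => [|n ih] f g fg /=; first exact: fg.
apply: eq_integral => x _; apply: eq_integral => y _.
by apply: ih => s sn; apply: fg; rewrite /= sn.
Qed.

(** The coefficients [c] are arbitrary because, with the first point held fixed, its factor joins
    the coefficient: the sum of products keeps its shape at every stage of the induction. *)
Lemma iint_sum_prod (I : Type) (r : seq I) n (c : I -> R)
    (h : I -> nat -> R -> R -> R) (v : I -> nat -> R) :
  (forall t j, iterated_integral (h t j) (v t j)) ->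
  iint n (fun s => (\sum_(t <- r) c t *
     \prod_(j < n) h t j (nth (0, 0) s j).1 (nth (0, 0) s j).2)%:E) =
  (\sum_(t <- r) c t * \prod_(j < n) v t j)%:E.
Proof.
elim: n c h v => [|n ih] c h v hv.
  by rewrite /=; congr EFin; apply: eq_bigr => t _; rewrite !big_ord0.
have E x y : iint n (fun s => (\sum_(t <- r) c t *
     \prod_(j < n.+1) h t j (nth (0, 0) ((x, y) :: s) j).1 (nth (0, 0) ((x, y) :: s) j).2)%:E)
   = (\sum_(t <- r) c t * (\prod_(j < n) v t j.+1) * h t 0%N x y)%:E.
  pose c' t := c t * h t 0%N x y; pose h' t j := h t j.+1; pose v' t j := v t j.+1.
  transitivity ((\sum_(t <- r) c' t * \prod_(j < n) v' t j)%:E).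
    rewrite -(ih c' h' v' (fun t j => hv t j.+1)).
    congr iint; apply/funext => s; congr EFin; apply: eq_bigr => t _.
    by rewrite big_ord_recl/= mulrA.
  by congr EFin; apply: eq_bigr => t _; rewrite /c' mulrAC.
rewrite /=; under eq_integral do under eq_integral do rewrite E.
have [_ _ ->] := iterated_integral_sum r (P := predT) (fun t _ =>
  iterated_integralZ (c t * (\prod_(j < n) v t j.+1)) (hv t 0%N)).
by congr EFin; apply: eq_bigr => t _; rewrite big_ord_recl/= -mulrA [in LHS](mulrC _ (v t 0%N)).
Qed.

End GaussMoments.

(** * The skew form of the overlap weight *)

Section BivariateMoments.
Variables (K : numFieldType) (iota : K) (m : nat -> K).
Hypothesis iota2 : iota ^+ 2 = -1.
Hypothesis m_rec : forall i, 4 * m i.+1 = i%:R * m i.-1.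
Implicit Types (p q : {poly K}) (P Q : {poly {poly K}}).

Definition moment1 p : K := \sum_(i < size p) p`_i * m i.

Lemma moment1_widen n p : (size p <= n)%N -> moment1 p = \sum_(i < n) p`_i * m i.
Proof.
move=> pn; rewrite /moment1 (big_ord_widen n (fun i => p`_i * m i) pn) big_mkcond.
apply: eq_bigr => i _; case: ltnP => // pi.
by rewrite nth_default ?mul0r.
Qed.

Lemma moment1_is_scalar : scalar moment1.
Proof.
move=> c p q; pose n := maxn (size p) (size q).
rewrite !(@moment1_widen n) ?leq_maxl ?leq_maxr//; last first.
  by rewrite (leq_trans (size_polyD _ _))// geq_max leq_maxr (leq_trans (size_scale_leq _ _)) ?leq_maxl.
rewrite mulr_sumr -big_split/=; apply: eq_bigr => i _.
by rewrite coefD coefZ mulrDl mulrA.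
Qed.

HB.instance Definition _ := GRing.isSemilinear.Build K {poly K} K _ moment1
  (GRing.semilinear_linear moment1_is_scalar).

Lemma moment1Xn n : moment1 'X^n = m n.
Proof.
rewrite /moment1 size_polyXn big_ord_recr/= coefXn eqxx mul1r big1 ?add0r// => i _.
by rewrite coefXn ltn_eqF ?mul0r.
Qed.

Lemma moment1X p : 4 * moment1 ('X * p) = moment1 p^`().
Proof.
rewrite -(coefK p) poly_def ['X * _]mulr_sumr (raddf_sum (@deriv K)) !(raddf_sum moment1) mulr_sumr.
apply: eq_bigr => i _.
rewrite /= -scalerAr derivZ !linearZ/= -exprS derivXn raddfMn/= !moment1Xn.
by rewrite mulrCA m_rec mulr_natl.
Qed.

(* [P] stands for a polynomial in [x] (outer variable) and [y] (inner variable). *)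
Definition moment2 P : K := moment1 (map_poly moment1 P).

Lemma moment2_is_scalar (c : K) P Q :
  moment2 (c%:P%:P * P + Q) = c * moment2 P + moment2 Q.
Proof.
rewrite /moment2 -linearP/=; congr moment1; apply/polyP => i.
by rewrite coefD coefZ !coef_map/= coefD coefCM mul_polyC linearP.
Qed.

Lemma moment2D P Q : moment2 (P + Q) = moment2 P + moment2 Q.
Proof. by have := moment2_is_scalar 1 P Q; rewrite !mul1r. Qed.

Lemma moment2Z (c : K) P : moment2 (c%:P%:P * P) = c * moment2 P.
Proof.
have := moment2_is_scalar c P 0.
by rewrite !addr0 => ->; rewrite /moment2 map_poly0 raddf0 addr0.
Qed.

Lemma moment2B P Q : moment2 (P - Q) = moment2 P - moment2 Q.
Proof.
by rewrite addrC -mulN1r -!polyCN moment2_is_scalar mulN1r addrC.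
Qed.

Lemma moment2X P : 4 * moment2 ('X * P) = moment2 P^`().
Proof.
rewrite /moment2.
have -> : map_poly moment1 ('X * P) = 'X * map_poly moment1 P.
  by apply/polyP => i; rewrite coef_map/= !coefXM; case: eqP => _; rewrite ?raddf0// coef_map.
rewrite moment1X; congr moment1; apply/polyP => i.
by rewrite coef_map/= !coef_deriv coef_map raddfMn.
Qed.

Definition deriv_inner P := map_poly (@deriv K) P.

Lemma moment2Y P : 4 * moment2 ('X%:P * P) = moment2 (deriv_inner P).
Proof.
rewrite /moment2 -linearZ/=; congr moment1; apply/polyP => i.
by rewrite coefZ /deriv_inner !coef_map/= coefCM moment1X.
Qed.

Lemma deriv_innerM P Q :
  deriv_inner (P * Q) = deriv_inner P * Q + P * deriv_inner Q.
Proof.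
apply/polyP => i; rewrite /deriv_inner coef_map/= coefD !coefM raddf_sum/= -big_split/=.
by apply: eq_bigr => j _; rewrite derivM !coef_map.
Qed.

Definition zpoly : {poly {poly K}} := 'X + iota%:P%:P * 'X%:P.
Definition wpoly : {poly {poly K}} := 'X - iota%:P%:P * 'X%:P.

Notation Z := zpoly.
Notation W := wpoly.
(* Twice the Wirtinger derivatives. *)
Let dbar P := P^`() + iota%:P%:P * deriv_inner P.
Let del P := P^`() - iota%:P%:P * deriv_inner P.

Let moment2_Z P : 4 * moment2 (Z * P) = moment2 (dbar P).
Proof.
have -> : Z * P = iota%:P%:P * ('X%:P * P) + 'X * P by rewrite /zpoly; ring.
rewrite moment2D moment2Z mulrDr.
by rewrite (mulrCA 4) moment2X moment2Y /dbar moment2D moment2Z addrC.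
Qed.

Let moment2_W P : 4 * moment2 (W * P) = moment2 (del P).
Proof.
have -> : W * P = 'X * P - iota%:P%:P * ('X%:P * P) by rewrite /wpoly; ring.
by rewrite moment2B moment2Z mulrBr (mulrCA 4) moment2X moment2Y /del moment2B moment2Z.
Qed.

Let dbarM P Q : dbar (P * Q) = dbar P * Q + P * dbar Q.
Proof. by rewrite /dbar derivM deriv_innerM; ring. Qed.

Let delM P Q : del (P * Q) = del P * Q + P * del Q.
Proof. by rewrite /del derivM deriv_innerM; ring. Qed.

Let deriv_innerX : deriv_inner 'X = 0.
Proof.
by apply/polyP => i; rewrite /deriv_inner coef_map/= coefX coef0; case: eqP; rewrite ?derivC// raddf0.
Qed.

Let deriv_innerC p : deriv_inner p%:P = p^`()%:P.
Proof.
by apply/polyP => i; rewrite /deriv_inner coef_map/= !coefC; case: eqP; rewrite ?raddf0.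
Qed.

Let deriv_innerZ : deriv_inner Z = iota%:P%:P.
Proof.
rewrite /deriv_inner /zpoly raddfD/= -/(deriv_inner _) -/(deriv_inner _).
by rewrite deriv_innerX deriv_innerM !deriv_innerC derivX derivC mul0r !add0r mulr1.
Qed.

Let deriv_innerW : deriv_inner W = - iota%:P%:P.
Proof.
rewrite /deriv_inner /wpoly raddfB/= -/(deriv_inner _) -/(deriv_inner _).
by rewrite deriv_innerX deriv_innerM !deriv_innerC derivX derivC mul0r !add0r mulr1.
Qed.

Let derivZ1 : Z^`() = 1. Proof. by rewrite /zpoly derivD derivX derivM !derivC mul0r mulr0 !addr0. Qed.
Let derivW1 : W^`() = 1. Proof. by rewrite /wpoly derivB derivX derivM !derivC mul0r mulr0 addr0 subr0. Qed.

Let iotaP : iota%:P%:P * iota%:P%:P = -1 :> {poly {poly K}}.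
Proof. by rewrite -!polyCM -expr2 iota2 !polyCN. Qed.

Let dbarZ : dbar Z = 0. Proof. by rewrite /dbar derivZ1 deriv_innerZ iotaP subrr. Qed.
Let dbarW : dbar W = 2%:R. Proof. by rewrite /dbar derivW1 deriv_innerW mulrN iotaP opprK. Qed.
Let delW : del W = 0. Proof. by rewrite /del derivW1 deriv_innerW mulrN iotaP opprK subrr. Qed.

Let dbarZn n : dbar (Z ^+ n) = 0.
Proof.
elim: n => [|n ih].
  by rewrite expr0 /dbar derivC -[1]/(1%:P) deriv_innerC derivC mulr0 addr0.
by rewrite exprS dbarM dbarZ ih mul0r mulr0 addr0.
Qed.

Let delWn n : del (W ^+ n) = 0.
Proof.
elim: n => [|n ih].
  by rewrite expr0 /del derivC -[1]/(1%:P) deriv_innerC derivC mulr0 subr0.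
by rewrite exprS delM delW ih mul0r mulr0 addr0.
Qed.

Let dbarWn n : dbar (W ^+ n) = (2 * n%:R)%:P%:P * W ^+ n.-1.
Proof.
have E k : (2 * k%:R)%:P%:P = 2 * k%:R :> {poly {poly K}}.
  by rewrite !rmorphM/= !rmorph_nat.
rewrite E; elim: n => [|n ih]; first by rewrite expr0 (dbarZn 0) mulr0 mul0r.
rewrite exprS dbarM dbarW ih; case: n {ih} => [|n]; first by rewrite /= !expr0; ring.
by rewrite /= -(natr1 n.+1) exprS; ring.
Qed.

(** By parts, multiplication by z becomes a quarter of [dbar], which kills powers of z and lowers
    powers of the conjugate, so each step removes one factor of each kind. An unbalanced monomial
    ends at a positive power of z or of w alone, whose moment is zero. *)
Lemma moment2_ZW (j k : nat) : 2 ^+ j * moment2 (Z ^+ j * W ^+ k) =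
  (j == k)%:R * j`!%:R * m 0 ^+ 2.
Proof.
have two : (2 : K) != 0 by rewrite pnatr_eq0.
elim: j k => [|p ih] [|q].
- rewrite !expr0 !mul1r /moment2 -[1%R]/(1%:P) map_polyC/= -[1%R]/('X^0) moment1Xn.
  by rewrite -[(m 0)%:P]mulr1 mul_polyC linearZ/= -[1%R]/('X^0) moment1Xn.
- rewrite !expr0 !mul1r (exprS W) (_ : moment2 _ = 0) ?mulr0 ?mul0r//.
  apply: (mulfI (x := 4)); first by rewrite pnatr_eq0.
  by rewrite moment2_W delWn mulr0 /moment2 map_poly0 raddf0.
- rewrite (expr0 W) mulr1 (exprS Z) (_ : moment2 _ = 0) ?mulr0 ?mul0r//.
  apply: (mulfI (x := 4)); first by rewrite pnatr_eq0.
  by rewrite moment2_Z dbarZn mulr0 /moment2 map_poly0 raddf0.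
- rewrite eqSS; apply: (mulfI two); rewrite (exprS Z) -[Z * _ * _]mulrA (exprS 2 p).
  have -> t : 2 * (2 * 2 ^+ p * t) = 2 ^+ p * (4 * t) :> K by ring.
  rewrite moment2_Z dbarM dbarZn mul0r add0r dbarWn mulrCA moment2Z mulrCA ih/=.
  by case: eqP => [->|_]; rewrite ?mul0r ?mulr0// factS natrM; ring.
Qed.

End BivariateMoments.

(** * Planar moments of the overlap weight *)

Section SkewForm.
Variable R : realType.
Notation C := R[i].
Implicit Types (a x y : R) (p q : {poly R}).

Definition cgmom (k : nat) : C := (@gmom R k)%:C%C.

Lemma cgmom_rec k : 4 * cgmom k.+1 = k%:R * cgmom k.-1.
Proof.
have := congr1 (real_complex R) (gmom_rec R k).
by rewrite !rmorphM/= !rmorph_nat.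
Qed.

Let ii : C := 'i%C.
Notation Z := (zpoly ii).
Notation W := (wpoly ii).

Definition bieval (P : {poly {poly C}}) x y : C := P.[x%:C%C%:P].[y%:C%C].

Lemma ReD (u v : C) : complex.Re (u + v) = complex.Re u + complex.Re v.
Proof. by case: u; case: v. Qed.

Lemma ReMr (u : C) x : complex.Re (u * x%:C%C) = complex.Re u * x.
Proof. by case: u => u1 u2 /=; rewrite mulr0 subr0. Qed.

Lemma Re_sum (I : Type) (r : seq I) (P : pred I) (F : I -> C) :
  complex.Re (\sum_(t <- r | P t) F t) = \sum_(t <- r | P t) complex.Re (F t).
Proof. exact: (big_morph _ ReD (erefl _)). Qed.

(** Monomial by monomial, this is where the algebraic functional becomes an actual integral; the
    real part is taken because the iterated integrals are real. *)
Lemma bieval_integral P :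
  iterated_integral (fun x y => complex.Re (bieval P x y) * (gauss2 x * gauss2 y))
    (complex.Re (moment2 cgmom P)).
Proof.
pose f (i j : nat) x y : R := complex.Re P`_i`_j * (x ^+ i * y ^+ j * (gauss2 x * gauss2 y)).
apply: (iterated_integral_ext (h := fun x y => \sum_(i < size P) \sum_(j < size P`_i) f i j x y)
  (v := \sum_(i < size P) \sum_(j < size P`_i) complex.Re P`_i`_j * (gmom R i * gmom R j))) => [x y||].
- rewrite /bieval (horner_coef P) horner_sum Re_sum mulr_suml; apply: eq_bigr => i _.
  rewrite hornerM -polyC_exp hornerC -rmorphXn/= ReMr horner_coef Re_sum !mulr_suml.
  by apply: eq_bigr => j _; rewrite -rmorphXn/= ReMr /f; ring.
- rewrite /moment2 (@moment1_widen _ _ (size P)) ?size_poly// Re_sum.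
  apply: eq_bigr => i _; rewrite coef_map/= ReMr /moment1 Re_sum mulr_suml.
  by apply: eq_bigr => j _; rewrite ReMr; ring.
- apply: iterated_integral_sum => i _; apply: iterated_integral_sum => j _.
  by apply: iterated_integralZ; exact: iterated_integral_monomial.
Qed.

(** The integral of |z|^(2k) e^{-2|z|^2} against dA, whose factor 1/pi is included. *)
Definition disk_moment (k : nat) : R := k`!%:R / 2 ^+ k.+1.

Lemma moment2_ZWE j k : moment2 cgmom (Z ^+ j * W ^+ k) =
  ((j == k)%:R * (pi * disk_moment j))%:C%C.
Proof.
have two : (2 : C) ^+ j != 0 by rewrite expf_neq0// pnatr_eq0.
apply: (mulfI two); rewrite moment2_ZW ?sqr_i//; last exact: cgmom_rec.
rewrite /cgmom -rmorphXn/= gmom0 -!(rmorph_nat (real_complex R)) -rmorphXn -!rmorphM/=.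
congr (_ %:C)%C; rewrite /disk_moment exprS.
have : (2 : R) ^+ j != 0 by rewrite expf_neq0// pnatr_eq0.
move: (@pi R) (2 ^+ j) => P t t0.
by field.
Qed.

(** With w = conj z, (z - w)(1 + |z - a|^2) = (1 + a^2)(z - w) + z w (z - w) - a (z^2 - w^2). By
    orthogonality of the monomials only |j - k| = 1 and |j - k| = 2 survive; these are the two
    bands. *)
Definition half_skew a (j k : nat) : R :=
  (j.+1 == k)%:R * (2 * ((1 + a ^+ 2) * disk_moment j.+1 + disk_moment j.+2))
  - (j.+2 == k)%:R * (2 * a * disk_moment j.+2).

Definition skew_entry a j k : R := half_skew a j k - half_skew a k j.

Definition pre_weight a : {poly {poly C}} :=
  1 + (Z - a%:C%C%:P%:P) * (W - a%:C%C%:P%:P).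

Lemma moment2_skew a j k :
  moment2 cgmom ((Z ^+ j * W ^+ k - Z ^+ k * W ^+ j) * ((Z - W) * pre_weight a))
  = (pi * skew_entry a j k)%:C%C.
Proof.
pose A : {poly {poly C}} := a%:C%C%:P%:P.
pose U j k : {poly {poly C}} := ((1 + a ^+ 2)%:C%C)%:P%:P * (Z ^+ j.+1 * W ^+ k) + Z ^+ j.+2 * W ^+ k.+1
  - A * (Z ^+ j.+2 * W ^+ k).
pose V j k : {poly {poly C}} := ((1 + a ^+ 2)%:C%C)%:P%:P * (Z ^+ j * W ^+ k.+1) + Z ^+ j.+1 * W ^+ k.+2
  - A * (Z ^+ j * W ^+ k.+2).
have EA : ((1 + a ^+ 2)%:C%C)%:P%:P = 1 + A ^+ 2 :> {poly {poly C}}.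
  by rewrite /A -!rmorphXn/= rmorphD rmorph1 !polyCD.
have -> : (Z ^+ j * W ^+ k - Z ^+ k * W ^+ j) * ((Z - W) * pre_weight a) =
   (U j k - V j k) - (U k j - V k j).
  rewrite /U /V EA /pre_weight -/A !exprS.
  by move: (Z) (W) (Z ^+ j) (W ^+ j) (Z ^+ k) (W ^+ k) (A) => z w zj wj zk wk b; ring.
have sym (b c : nat) : (b == c)%:R * (pi * disk_moment b) = (c == b)%:R * (pi * disk_moment c).
  by rewrite eq_sym; case: eqP => [->//|_]; rewrite !mul0r.
rewrite /U /V !(moment2B, moment2D, moment2Z, moment2_ZWE).
rewrite -!(rmorphM (real_complex R)) -!(rmorphD (real_complex R)) -!(rmorphB (real_complex R)).
congr (_ %:C)%C.
rewrite /skew_entry /half_skew.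
rewrite (sym j k.+1) (sym j.+1 k.+2) (sym j k.+2) (sym k j.+1) (sym k.+1 j.+2) (sym k j.+2) !eqSS.
by move: (@pi R) => P; ring.
Qed.

(** The form is read off coefficients below [M], which must therefore bound the sizes of both
    polynomials; the factor pi stays outside. *)
Definition skew_form M a p q : R :=
  \sum_(j < M) \sum_(k < M) p`_j * q`_k * skew_entry a j k.

Definition cpoly p : {poly C} := map_poly (real_complex R) p.

Lemma horner_cpoly M p (z : C) : (size p <= M)%N ->
  (cpoly p).[z] = \sum_(j < M) (p`_j)%:C%C * z ^+ j.
Proof.
move=> pM; rewrite (@horner_coef_wide _ M) ?size_map_poly//.
by apply: eq_bigr => j _; rewrite coef_map.
Qed.

Lemma bieval_zpoly x y : bieval Z x y = (x +i* y)%C.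
Proof.
rewrite /bieval /zpoly !hornerE /=.
by apply/eqP; rewrite eq_complex /=; apply/andP; split; apply/eqP; ring.
Qed.

Lemma bieval_wpoly x y : bieval W x y = (x -i* y)%C.
Proof.
rewrite /bieval /wpoly !hornerE /=.
by apply/eqP; rewrite eq_complex /=; apply/andP; split; apply/eqP; ring.
Qed.

(* Abstracting the two coordinates keeps unification from unfolding them. *)
Lemma skew_form_integral_coord (z w : {poly {poly C}}) M a p q :
  (forall x y, bieval z x y = (x +i* y)%C) ->
  (forall x y, bieval w x y = (x -i* y)%C) ->
  (forall j k, moment2 cgmom ((z ^+ j * w ^+ k - z ^+ k * w ^+ j) *
      ((z - w) * (1 + (z - a%:C%C%:P%:P) * (w - a%:C%C%:P%:P))))
    = (pi * skew_entry a j k)%:C%C) ->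
  (size p <= M)%N -> (size q <= M)%N ->
  iterated_integral (fun x y =>
    complex.Re (((cpoly p).[(x +i* y)%C] * (cpoly q).[(x -i* y)%C]
      - (cpoly q).[(x +i* y)%C] * (cpoly p).[(x -i* y)%C])
     * ((x +i* y)%C - (x -i* y)%C))
     * ((1 + ((x - a) ^+ 2 + y ^+ 2)) * (gauss2 x * gauss2 y)))
   (pi * skew_form M a p q).
Proof.
move=> zE wE TE pM qM.
pose lift p (Y : {poly {poly C}}) := \sum_(j < M) (p`_j)%:C%C%:P%:P * Y ^+ j.
have bM P Q x y : bieval (P * Q) x y = bieval P x y * bieval Q x y by rewrite /bieval !hornerM.
have bD P Q x y : bieval (P + Q) x y = bieval P x y + bieval Q x y by rewrite /bieval !hornerD.
have bB P Q x y : bieval (P - Q) x y = bieval P x y - bieval Q x y by rewrite /bieval !hornerE.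
have bC c x y : bieval c%:P%:P x y = c by rewrite /bieval !hornerC.
have bX P n x y : bieval (P ^+ n) x y = bieval P x y ^+ n by rewrite /bieval !horner_exp.
have blift (r : {poly R}) Y x y : (size r <= M)%N ->
    bieval (lift r Y) x y = (cpoly r).[bieval Y x y].
  move=> rM; rewrite (horner_cpoly _ rM) /bieval !horner_sum; apply: eq_bigr => j _.
  by rewrite -!/(bieval _ _ _) bM bC bX.
pose v := 1 + (z - a%:C%C%:P%:P) * (w - a%:C%C%:P%:P).
have vE x y : bieval v x y = (1 + ((x - a) ^+ 2 + y ^+ 2))%:C%C.
  have b1 : bieval 1 x y = 1%:C%C by have := bC 1 x y; rewrite !polyC1.
  rewrite /v (bD 1) b1 bM (bB z) (bB w) zE wE (bC a%:C%C).
  have -> : (x +i* y)%C - a%:C%C = ((x - a) +i* y)%C.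
    by apply/eqP; rewrite eq_complex /=; apply/andP; split; apply/eqP; ring.
  have -> : (x -i* y)%C - a%:C%C = ((x - a) -i* y)%C.
    by apply/eqP; rewrite eq_complex /=; apply/andP; split; apply/eqP; ring.
  by apply/eqP; rewrite eq_complex /=; apply/andP; split; apply/eqP; ring.
rewrite -/v in TE; clearbody v.
pose P := (lift p z * lift q w - lift q z * lift p w) * ((z - w) * v).
apply: iterated_integral_ext (bieval_integral P) => [x y|].
  rewrite /P 2!bM bB !bM bB !blift// zE wE vE.
  by rewrite (mulrA _ _ (_%:C%C)) ReMr -mulrA.
pose T := (z - w) * v.
have -> : P = \sum_(j < M) \sum_(k < M) (p`_j * q`_k)%:C%C%:P%:P *
    ((z ^+ j * w ^+ k - z ^+ k * w ^+ j) * T).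
  rewrite /P -/T; move: (T) => U.
  rewrite mulrBl (mulrC (lift q z)) /lift !big_distrlr/= mulr_suml.
  rewrite mulr_suml -sumrB; apply: eq_bigr => j _.
  rewrite !mulr_suml -sumrB; apply: eq_bigr => k _.
  rewrite rmorphM !polyCM/=.
  move: (z ^+ j) (w ^+ j) (z ^+ k) (w ^+ k) (_%:P%:P) (_%:P%:P) => zj wj zk wk c d.
  by ring.
have m2_sum (I : Type) (r : seq I) (F : I -> {poly {poly C}}) :
    moment2 cgmom (\sum_(t <- r) F t) = \sum_(t <- r) moment2 cgmom (F t).
  by rewrite (big_morph _ (moment2D cgmom) (_ : _ = 0))// /moment2 map_poly0 raddf0.
rewrite m2_sum Re_sum /skew_form mulr_sumr; apply: eq_bigr => j _.
rewrite m2_sum Re_sum mulr_sumr; apply: eq_bigr => k _.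
by rewrite moment2Z /T TE -rmorphM/= mulrCA.
Qed.

Lemma skew_form_integral M a p q : (size p <= M)%N -> (size q <= M)%N ->
  iterated_integral (fun x y =>
    complex.Re (((cpoly p).[(x +i* y)%C] * (cpoly q).[(x -i* y)%C]
      - (cpoly q).[(x +i* y)%C] * (cpoly p).[(x -i* y)%C])
     * ((x +i* y)%C - (x -i* y)%C))
     * ((1 + ((x - a) ^+ 2 + y ^+ 2)) * (gauss2 x * gauss2 y)))
   (pi * skew_form M a p q).
Proof.
exact: skew_form_integral_coord bieval_zpoly bieval_wpoly (@moment2_skew a).
Qed.

End SkewForm.

(** * Bordered Pfaffians *)

Section AlternatingSum.
Variables (K : comPzRingType) (n : nat).
Notation T := 'I_(1 + (n + n)).
Implicit Types (g : T -> K) (h : 'I_n -> T -> T -> K) (j k : 'I_n).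

(* Index [0] is the extra point [a]; [lpoint j] and [rpoint j] are [w_j] and its conjugate. *)
Definition lpoint j : T := rshift 1 (lshift n j).
Definition rpoint j : T := rshift 1 (rshift n j).

(** For a skew [h] not depending on [j] this is, up to sign, 2^n n! times the Pfaffian of [h]
    bordered by [g]. The dependence on [j] lets each pair carry its own point before integration. *)
Definition altsum g h : K :=
  \sum_(s : {perm T}) (-1) ^+ s * (g (s ord0) * \prod_j h j (s (lpoint j)) (s (rpoint j))).

Lemma lpoint_inj : injective lpoint.
Proof. by move=> j k /rshift_inj/lshift_inj. Qed.

Lemma rpoint_inj : injective rpoint.
Proof. by move=> j k /rshift_inj/rshift_inj. Qed.

Lemma lrpoint_eqF j k : (lpoint j == rpoint k) = false.
Proof. by rewrite (inj_eq (@rshift_inj _ _)) eq_lrshift. Qed.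

Lemma eq_altsum g g' h h' : g =1 g' -> (forall j x y, h j x y = h' j x y) ->
  altsum g h = altsum g' h'.
Proof.
by move=> gg hh; apply: eq_bigr => s _; rewrite gg (eq_bigr _ (fun j _ => hh j _ _)).
Qed.

Lemma altsum_antisym1 j0 g h :
  altsum g (fun j x y => if j == j0 then h j x y - h j y x else h j x y) =
  2 * altsum g h.
Proof.
pose F (s : {perm T}) := \prod_(j | j != j0) h j (s (lpoint j)) (s (rpoint j)).
pose t : {perm T} := tperm (lpoint j0) (rpoint j0).
have E1 : altsum g h = \sum_(s : {perm T}) (-1) ^+ s *
    (g (s ord0) * (h j0 (s (lpoint j0)) (s (rpoint j0)) * F s)).
  by apply: eq_bigr => s _; rewrite (bigD1 j0).
have E2 : altsum g h = - \sum_(s : {perm T}) (-1) ^+ s *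
    (g (s ord0) * (h j0 (s (rpoint j0)) (s (lpoint j0)) * F s)).
  rewrite E1 (reindex_inj (mulgI t)) -sumrN; apply: eq_bigr => s _ /=.
  rewrite odd_permM odd_tperm lrpoint_eqF/= signrN mulNr; congr (- (_ * (_ * (_ * _)))).
  - by rewrite permM tpermD.
  - by rewrite !permM tpermL tpermR.
  - apply: eq_bigr => j; rewrite eq_sym => jj0; rewrite !permM.
    have d1 : lpoint j0 != lpoint j by rewrite (inj_eq lpoint_inj).
    have d2 : rpoint j0 != rpoint j by rewrite (inj_eq rpoint_inj).
    have d3 : rpoint j0 != lpoint j by rewrite eq_sym lrpoint_eqF.
    by rewrite !tpermD// lrpoint_eqF.
rewrite mulr_natl mulr2n {1}E1 E2 -sumrB; apply: eq_bigr => s _.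
rewrite (bigD1 j0)//= eqxx (eq_bigr (fun j => h j (s (lpoint j)) (s (rpoint j)))); last first.
  by move=> j /negbTE ->.
by rewrite -/(F s) mulrBl !mulrBr.
Qed.

(* Swapping the two arguments of one factor is a transposition of the permutation. *)
Lemma altsum_antisym g h :
  altsum g (fun j x y => h j x y - h j y x) = 2 ^+ n * altsum g h.
Proof.
suff H m : (m <= n)%N -> altsum g (fun j x y => if (j < m)%N then h j x y - h j y x else h j x y) =
    2 ^+ m * altsum g h.
  by rewrite -H//; apply: eq_altsum => // j x y; rewrite ltn_ord.
elim: m => [|m ih] mn; first by rewrite mul1r; apply: eq_altsum.
rewrite exprS -mulrA -ih ?(ltnW mn)// -(altsum_antisym1 (Ordinal mn)).
apply: eq_altsum => // j x y; rewrite -val_eqE/= ltnS leq_eqVlt.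
by case: eqP => [->|//]; rewrite ltnn.
Qed.

Lemma det_altsum (A : 'M[K]_(1 + (n + n))) :
  \det A = altsum (fun x => A x ord0) (fun j x y => A x (lpoint j) * A y (rpoint j)).
Proof.
rewrite -det_tr; apply: eq_bigr => s _; congr (_ * _).
rewrite big_split_ord big_ord1 big_split_ord/= mxE; congr (A _ _ * _).
  by congr (fun_of_perm s _); apply: val_inj.
  by apply: val_inj.
by rewrite -big_split; apply: eq_bigr => j _; rewrite !mxE.
Qed.

Let selmx (f : {ffun 'I_n -> 'I_n}) : 'M[K]_n := \matrix_(x, j) (x == f j)%:R.

(** Once every pair [j] is assigned a block [f j], the sum is the determinant of a block triangular
    matrix in which the same selection matrix occurs twice; the square removes the sign of [f]. *)
Let altsum_select g (f : {ffun 'I_n -> 'I_n}) :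
  altsum g (fun j x y => (x == lpoint (f j))%:R * (y == rpoint (f j))%:R) =
  g ord0 * \det (selmx f) ^+ 2.
Proof.
pose D : 'M[K]_(n + n) := block_mx (selmx f) 0 0 (selmx f).
pose A : 'M[K]_(1 + (n + n)) :=
  block_mx (g ord0)%:M 0 (\col_i g (rshift 1 i)) D.
have -> : g ord0 * \det (selmx f) ^+ 2 = \det A.
  by rewrite det_lblock det_scalar1 det_ublock.
rewrite det_altsum; apply: eq_altsum => [x|j x y].
  rewrite /A -(splitK x); case: (fintype.split x) => i /=.
    have -> : (ord0 : 'I_(1 + (n + n))) = lshift (n + n) ord0 by apply: val_inj.
    by rewrite block_mxEul mxE !ord1 eqxx mulr1n.
  have -> : (ord0 : 'I_(1 + (n + n))) = lshift (n + n) ord0 by apply: val_inj.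
  by rewrite block_mxEdl mxE.
have El z k : A z (lpoint k) = (z == lpoint (f k))%:R.
  rewrite /A -(splitK z); case: (fintype.split z) => i /=.
    by rewrite block_mxEur mxE /lpoint eq_lrshift.
  rewrite block_mxEdr (inj_eq (@rshift_inj _ _)) -(splitK i); case: (fintype.split i) => i' /=.
    by rewrite block_mxEul mxE (inj_eq (@lshift_inj _ _)).
  by rewrite block_mxEdl mxE eq_rlshift.
have Er z k : A z (rpoint k) = (z == rpoint (f k))%:R.
  rewrite /A -(splitK z); case: (fintype.split z) => i /=.
    by rewrite block_mxEur mxE /rpoint eq_lrshift.
  rewrite block_mxEdr (inj_eq (@rshift_inj _ _)) -(splitK i); case: (fintype.split i) => i' /=.
    by rewrite block_mxEur mxE eq_lrshift.
  by rewrite block_mxEdr mxE (inj_eq (@rshift_inj _ _)).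
by rewrite El Er.
Qed.

(** [selmx f] has determinant 0 unless [f] is a permutation, and then its square is 1; each of the
    n! permutations gives the same product. *)
Let sum_det_selmx (r : 'I_n -> K) :
  \sum_(f : {ffun 'I_n -> 'I_n}) (\prod_j r (f j)) * \det (selmx f) ^+ 2 =
  n`!%:R * \prod_k r k.
Proof.
have E (f : {ffun 'I_n -> 'I_n}) : \det (selmx f) =
    \sum_(s : 'S_n) (-1) ^+ s * (f == finfun s)%:R.
  rewrite -det_tr; apply: eq_bigr => s _; congr (_ * _).
  rewrite (eq_bigr (fun j => (s j == f j)%:R)) => [|j _]; last by rewrite !mxE.
  case: eqP => [->|fs]; first by rewrite big1// => j _; rewrite ffunE eqxx.
  have /existsP [j /negbTE jF] : [exists j, s j != f j].
    rewrite -negb_forall; apply/negP => /forallP H; apply: fs; apply/ffunP => j.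
    by rewrite ffunE (eqP (H j)).
  by rewrite (bigD1 j)//= jF mul0r.
have Es (s : 'S_n) : \det (selmx (finfun s)) = (-1) ^+ s.
  rewrite -det_perm -det_tr; congr (\det _); apply/matrixP => i j.
  by rewrite !mxE ffunE eq_sym.
under [LHS]eq_bigr => f _ do rewrite expr2 {2}E !mulr_sumr.
rewrite exchange_big/= (eq_bigr (fun => \prod_k r k)) => [|s _].
  by rewrite sumr_const card_Sn mulr_natl.
rewrite (bigD1 (finfun s))//= eqxx mulr1 Es -expr2 sqrr_sign mulr1.
rewrite [X in _ + X]big1 ?addr0 => [|f /negbTE fs].
  by under eq_bigr do rewrite ffunE; rewrite [RHS](reindex_inj (@perm_inj _ s)).
by rewrite eq_sym in fs; rewrite eq_sym fs !mulr0.
Qed.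

(** Expanding the product of sums chooses a block for every pair, and antisymmetrising each pair
    costs a factor 2. For a form in this normal form only the product of the [r k] and the border
    entry remain. *)
Lemma altsum_block g (H : T -> T -> K) (r : 'I_n -> K) :
  (forall x y, H x y = \sum_k r k * ((x == lpoint k)%:R * (y == rpoint k)%:R
      - (y == lpoint k)%:R * (x == rpoint k)%:R)) ->
  altsum g (fun _ => H) = 2 ^+ n * (n`!%:R * (g ord0 * \prod_k r k)).
Proof.
move=> HE.
transitivity (\sum_(f : {ffun 'I_n -> 'I_n}) (\prod_j r (f j)) *
   altsum g (fun j x y => (x == lpoint (f j))%:R * (y == rpoint (f j))%:R
      - (y == lpoint (f j))%:R * (x == rpoint (f j))%:R)).
  under [RHS]eq_bigr do rewrite mulr_sumr.
  rewrite exchange_big; apply: eq_bigr => s _ /=.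
  under eq_bigr do rewrite HE.
  rewrite bigA_distr_bigA/= !mulr_sumr; apply: eq_bigr => f _.
  by rewrite big_split/= [g _ * _]mulrCA [LHS]mulrCA.
rewrite [n`!%:R * _]mulrCA -sum_det_selmx !mulr_sumr; apply: eq_bigr => f _.
rewrite (altsum_antisym g (fun j x y => (x == lpoint (f j))%:R * (y == rpoint (f j))%:R)).
by rewrite altsum_select [LHS]mulrCA [X in _ * X]mulrCA.
Qed.

End AlternatingSum.

(** * Vandermonde product on conjugate pairs and one extra point *)

Section VandermondePairs.
Variables (K : comNzRingType) (n : nat).
Notation T := 'I_(1 + (n + n)).

Definition pair_vec (a : K) (w wb : 'I_n -> K) (x : T) : K :=
  match fintype.split x with
  | inl _ => a
  | inr y => match fintype.split y with inl j => w j | inr j => wb j end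
  end.

Lemma pair_vec0 a w wb (i : 'I_1) : pair_vec a w wb (lshift (n + n) i) = a.
Proof. by rewrite /pair_vec (unsplitK (inl i)). Qed.

Lemma pair_vecl a w wb j : pair_vec a w wb (lpoint j) = w j.
Proof. by rewrite /pair_vec (unsplitK (inr (lshift n j))) (unsplitK (inl j)). Qed.

Lemma pair_vecr a w wb j : pair_vec a w wb (rpoint j) = wb j.
Proof. by rewrite /pair_vec (unsplitK (inr (rshift n j))) (unsplitK (inr j)). Qed.

Lemma prod_offdiag (F : 'I_n -> 'I_n -> K) :
  \prod_j \prod_k F j k =
  \prod_j F j j * \prod_(j < n) \prod_(k < n | (j < k)%N) (F j k * F k j).
Proof.
have E (j : 'I_n) : \prod_k F j k =
    F j j * (\prod_(k < n | (j < k)%N) F j k * \prod_(k < n | (k < j)%N) F j k).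
  rewrite (bigD1 j)//=; congr (_ * _); rewrite (bigID (fun k : 'I_n => (j < k)%N))/=.
  by congr (_ * _); apply: eq_bigl => k; rewrite -val_eqE/=; lia.
rewrite (eq_bigr _ (fun j _ => E j)) !big_split/=; congr (_ * _).
under [RHS]eq_bigr do rewrite big_split.
rewrite big_split/=; congr (_ * _).
by rewrite (exchange_big_dep predT).
Qed.

Lemma vandermonde_pairs a w wb :
  \prod_(x < 1 + (n + n)) \prod_(y < 1 + (n + n) | (x < y)%N)
    (pair_vec a w wb y - pair_vec a w wb x) =
  \prod_j ((w j - a) * (wb j - a)) * \prod_j (wb j - w j) *
  \prod_(j < n) \prod_(k < n | (j < k)%N)
    ((w k - w j) * (wb k - wb j) * ((wb k - w j) * (wb j - w k))).
Proof.
rewrite big_split_ord big_ord1 big_split_ord/=.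
set A := \prod_(y < _ | _) _; set B := \prod_(j < n) _; set C := \prod_(j < n) _.
have -> : A = \prod_j ((w j - a) * (wb j - a)).
  rewrite /A big_mkcond big_split_ord big_ord1/= mul1r big_split_ord big_split/=.
  by congr (_ * _); apply: eq_bigr => j _; rewrite pair_vec0 ?pair_vecl ?pair_vecr.
(* Every left index precedes every right index, so the mixed differences run over all pairs (j, k),
   including j = k. *)
have -> : B = \prod_(j < n) \prod_(k < n | (j < k)%N) (w k - w j) * \prod_j \prod_k (wb k - w j).
  rewrite /B -big_split; apply: eq_bigr => j _ /=.
  rewrite big_mkcond big_split_ord big_ord1/= mul1r big_split_ord/=; congr (_ * _).
    rewrite [RHS]big_mkcond; apply: eq_bigr => k _ /=.
    by rewrite -!/(lpoint _) !pair_vecl !add1n ltnS.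
  apply: eq_bigr => k _; rewrite -!/(lpoint _) -!/(rpoint _) pair_vecl pair_vecr ifT//.
  by have := ltn_ord j; lia.
have -> : C = \prod_(j < n) \prod_(k < n | (j < k)%N) (wb k - wb j).
  rewrite /C; apply: eq_bigr => j _ /=.
  rewrite big_mkcond big_split_ord big_ord1/= mul1r big_split_ord/= big1 ?mul1r => [|k _].
    rewrite [RHS]big_mkcond; apply: eq_bigr => k _ /=.
    by rewrite -!/(rpoint _) !pair_vecr !add1n ltnS ltn_add2l.
  by rewrite ifF//; have := ltn_ord k; lia.
rewrite prod_offdiag; under [X in _ = _ * _ * X]eq_bigr do rewrite big_split big_split/=.
rewrite !big_split/=; ring.
Qed.

(** The change of basis from monomials to monic polynomials is triangular with unit diagonal. *)
Lemma det_monic_vandermonde m (q : nat -> {poly K}) (v : 'I_m -> K) :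
  (forall i, size (q i) = i.+1 /\ q i \is monic) ->
  \det (\matrix_(i < m, j < m) (q i).[v j]) =
  \prod_(i < m) \prod_(j < m | (i < j)%N) (v j - v i).
Proof.
move=> qm; pose Q : 'M[K]_m := \matrix_(i, k) (q i)`_k.
have -> : \matrix_(i < m, j < m) (q i).[v j] = Q *m Vandermonde m (\row_j v j).
  apply/matrixP => i j; rewrite !mxE (@horner_coef_wide _ m); last by rewrite (qm i).1.
  by apply: eq_bigr => k _; rewrite !mxE.
rewrite det_mulmx det_Vandermonde det_trig.
  rewrite big1 ?mul1r => [|i _].
    by apply: eq_bigr => i _; apply: eq_bigr => j _; rewrite !mxE.
  rewrite mxE; have [si /monicP mi] := qm i.
  by rewrite -[RHS]mi lead_coefE si.
apply/is_trig_mxP => i j ij; rewrite mxE nth_default//.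
by rewrite (qm i).1.
Qed.

(** Pair [j] receives the consecutive degrees 2j and 2j + 1, those of skew-orthogonal partners, and
    the border index the unpaired top degree 2n. [inord] is faithful because every value is at most
    2n. *)
Definition degree_of (x : T) : T := inord
  (match fintype.split x with
   | inl _ => n + n
   | inr y => match fintype.split y with inl j => 2 * j | inr j => (2 * j).+1 end
   end)%N.

Lemma degree_of0 (i : 'I_1) : degree_of (lshift (n + n) i) = (n + n)%N :> nat.
Proof. by rewrite /degree_of (unsplitK (inl i)) inordK. Qed.

Lemma degree_ofl j : degree_of (lpoint j) = (2 * j)%N :> nat.
Proof.
rewrite /degree_of (unsplitK (inr (lshift n j))) (unsplitK (inl j)) inordK//.
by have := ltn_ord j; lia.
Qed.

Lemma degree_ofr j : degree_of (rpoint j) = (2 * j).+1 :> nat.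
Proof.
rewrite /degree_of (unsplitK (inr (rshift n j))) (unsplitK (inr j)) inordK//.
by have := ltn_ord j; lia.
Qed.

Variant point_spec : T -> Type :=
| Point0 (i : 'I_1) : point_spec (lshift (n + n) i)
| PointL j : point_spec (lpoint j)
| PointR j : point_spec (rpoint j).

Lemma pointP x : point_spec x.
Proof.
rewrite -(splitK x); case: (fintype.split x) => i /=; first exact: Point0.
by rewrite -(splitK i); case: (fintype.split i) => j /=; constructor.
Qed.

Lemma degree_of_inj : injective degree_of.
Proof.
move=> x y /(congr1 val)/=.
case: (pointP x) => i; case: (pointP y) => j;
  rewrite ?(degree_of0, degree_ofl, degree_ofr);
  have := ltn_ord i; have := ltn_ord j => jn i_n E; try (exfalso; lia).
- by rewrite !ord1.
- by congr lpoint; apply: val_inj => /=; lia.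
- by congr rpoint; apply: val_inj => /=; lia.
Qed.

Lemma det_degree (q : nat -> {poly K}) (v : T -> K) :
  (forall i, size (q i) = i.+1 /\ q i \is monic) ->
  \det (\matrix_(x < 1 + (n + n), y < 1 + (n + n)) (q (degree_of x)).[v y]) =
  (-1) ^+ (perm degree_of_inj) *
  \prod_(x < 1 + (n + n)) \prod_(y < 1 + (n + n) | (x < y)%N) (v y - v x).
Proof.
move=> qm; rewrite -(det_monic_vandermonde v qm) -det_perm -det_mulmx -row_permE.
by congr (\det _); apply/matrixP => x y; rewrite !mxE permE.
Qed.

End VandermondePairs.

(** * The partition function as an alternating sum *)

Section OverlapPartitionFunction.
Variable R : realType.
Notation C := R[i].
Implicit Types (a x y : R) (p q : {poly R}).

Definition skew_density a p q x y : R :=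
  complex.Re (((cpoly p).[(x +i* y)%C] * (cpoly q).[(x -i* y)%C]
      - (cpoly q).[(x +i* y)%C] * (cpoly p).[(x -i* y)%C])
     * ((x +i* y)%C - (x -i* y)%C))
     * ((1 + ((x - a) ^+ 2 + y ^+ 2)) * (gauss2 x * gauss2 y)).

Lemma conj_cpoly p (z : C) : ((cpoly p).[z])^*%C = (cpoly p).[z^*%C].
Proof.
rewrite -(horner_map conjc)/=; congr horner; apply/polyP => i.
by rewrite !coef_map/= oppr0.
Qed.

(** Conjugation exchanges z and conj z and changes the sign of both antisymmetric factors, so their
    product is real and passing to the real part loses nothing. *)
Lemma skew_density_complex a p q x y :
  (skew_density a p q x y)%:C%C =
  ((cpoly p).[(x +i* y)%C] * (cpoly q).[(x -i* y)%C]
      - (cpoly q).[(x +i* y)%C] * (cpoly p).[(x -i* y)%C]) *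
  (((x +i* y)%C - (x -i* y)%C) *
   ((1 + ((x - a) ^+ 2 + y ^+ 2)) * (gauss2 x * gauss2 y))%:C%C).
Proof.
set z := (x +i* y)%C; have -> : (x -i* y)%C = z^*%C by [].
pose u := ((cpoly p).[z] * (cpoly q).[z^*%C] - (cpoly q).[z] * (cpoly p).[z^*%C]) *
  (z - z^*%C).
have ui : u^*%C = u.
  have cM (c d : C) : (c * d)^*%C = c^*%C * d^*%C by exact: rmorphM.
  have cB (c d : C) : (c - d)^*%C = c^*%C - d^*%C by exact: rmorphB.
  rewrite /u !(cM, cB) !conj_cpoly conjcK.
  move: ((cpoly p).[z]) ((cpoly q).[z]) ((cpoly p).[z^*%C]) ((cpoly q).[z^*%C]) (z^*%C) (z).
  by move=> p1 q1 p2 q2 z1 z2; ring.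
have uE : (complex.Re u)%:C%C = u.
  move: ui; case: (u) => u1 u2 /= -[/eqP]; rewrite -subr_eq0 -opprD oppr_eq0 -mulr2n.
  by rewrite mulrn_eq0/= => /eqP ->.
transitivity (u * ((1 + ((x - a) ^+ 2 + y ^+ 2)) * (gauss2 x * gauss2 y))%:C%C).
  by rewrite -uE -rmorphM.
by rewrite /u -mulrA.
Qed.

Section FixedSize.
Variable n : nat.
Notation T := 'I_(1 + (n + n)).
Variables (a : R) (q : nat -> {poly R}).
Hypothesis q_monic : forall i, size (q i) = i.+1 /\ q i \is monic.
Let P (x : T) := q (degree_of x).

Let pair_factor (xj yj xk yk : R) :
  ((xk +i* yk)%C - (xj +i* yj)%C) * ((xk -i* yk)%C - (xj -i* yj)%C) *
  (((xk -i* yk)%C - (xj +i* yj)%C) * ((xj -i* yj)%C - (xk +i* yk)%C)) =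
  (-1) * (((xj - xk) ^+ 2 + (yj - yk) ^+ 2) * ((xj - xk) ^+ 2 + (yj + yk) ^+ 2))%:C%C.
Proof.
have -> : ((xk +i* yk)%C - (xj +i* yj)%C) * ((xk -i* yk)%C - (xj -i* yj)%C) =
    ((xj - xk) ^+ 2 + (yj - yk) ^+ 2)%:C%C.
  by apply/eqP; rewrite eq_complex /=; apply/andP; split; apply/eqP; ring.
have -> : ((xk -i* yk)%C - (xj +i* yj)%C) * ((xj -i* yj)%C - (xk +i* yk)%C) =
    - ((xj - xk) ^+ 2 + (yj + yk) ^+ 2)%:C%C.
  by apply/eqP; rewrite eq_complex /=; apply/andP; split; apply/eqP; ring.
by rewrite rmorphM mulN1r mulrN.
Qed.

Let point_factor x y :
  ((x +i* y)%C - a%:C%C) * ((x -i* y)%C - a%:C%C) * ((x -i* y)%C - (x +i* y)%C)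
  * (((x +i* y)%C - (x -i* y)%C) *
   ((1 + ((x - a) ^+ 2 + y ^+ 2)) * (gauss2 x * gauss2 y))%:C%C) =
  (4 * y ^+ 2 * omega_over a x y)%:C%C.
Proof.
have -> : ((x +i* y)%C - a%:C%C) * ((x -i* y)%C - a%:C%C) = ((x - a) ^+ 2 + y ^+ 2)%:C%C.
  by apply/eqP; rewrite eq_complex /=; apply/andP; split; apply/eqP; ring.
rewrite -mulrA [((x -i* y)%C - _) * _]mulrA.
have -> : ((x -i* y)%C - (x +i* y)%C) * ((x +i* y)%C - (x -i* y)%C) = (4 * y ^+ 2)%:C%C.
  by apply/eqP; rewrite eq_complex /=; apply/andP; split; apply/eqP; ring.
rewrite -!rmorphM/= /omega_over; congr (_ %:C)%C.
have -> : gauss2 x * gauss2 y = expR (- (2 * (x ^+ 2 + y ^+ 2))).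
  by rewrite /gauss2 -expRD; congr expR; ring.
by move: (expR _) => e; ring.
Qed.

(* The sign is not computed: positivity of the integral settles it later. *)
Lemma over_integrand_altsum : exists b : bool, forall s : seq (R * R), size s = n ->
  2 ^+ n * over_integrand a s = (-1) ^+ b *
  altsum (fun t => (P t).[a])
    (fun j t u => skew_density a (P t) (P u) (nth (0, 0) s j).1 (nth (0, 0) s j).2).
Proof.
(* Each pair j < k contributes one factor -1, because (conj w_k - w_j)(conj w_j - w_k) = -|w_j -
   conj w_k|^2; only e^2 = 1 is used. *)
pose e : C := \prod_(j < n) \prod_(k < n | (j < k)%N) (-1).
have [b1 b1E] : exists b : bool, e = (-1) ^+ b.
  have /eqP : e ^+ 2 = 1.
    rewrite /e -prodrXl big1// => j _; rewrite -prodrXl big1// => k _.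
    by rewrite sqrrN expr1n.
  by rewrite sqrf_eq1 => /orP[] /eqP ->; [exists false|exists true].
pose b2 : bool := perm (@degree_of_inj n).
exists (b2 (+) b1) => s sn; apply: (@complexI R).
pose X j := (nth (0, 0) s j).1; pose Y j := (nth (0, 0) s j).2.
pose w (j : 'I_n) : C := (X j +i* Y j)%C; pose wb (j : 'I_n) : C := (X j -i* Y j)%C.
pose rho (j : 'I_n) : C := (w j - wb j) *
   ((1 + ((X j - a) ^+ 2 + Y j ^+ 2)) * (gauss2 (X j) * gauss2 (Y j)))%:C%C.
pose v := pair_vec a%:C%C w wb.
pose A : 'M[C]_(1 + (n + n)) := \matrix_(t, u) (cpoly (P t)).[v u].
pose V := \prod_j ((w j - a%:C%C) * (wb j - a%:C%C)) * \prod_j (wb j - w j) *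
  \prod_(j < n) \prod_(k < n | (j < k)%N)
    ((w k - w j) * (wb k - wb j) * ((wb k - w j) * (wb j - w k))).
have detA : \det A = (-1) ^+ b2 * V.
  rewrite /V -vandermonde_pairs -(det_degree (q := fun i => cpoly (q i))).
    by congr (\det _); apply/matrixP => t u; rewrite !mxE.
  by move=> i; have [si mi] := q_monic i; rewrite size_map_poly si map_monic.
have altA : 2 ^+ n * \det A = altsum (fun t => ((P t).[a])%:C%C)
   (fun j t u => (cpoly (P t)).[w j] * (cpoly (P u)).[wb j]
      - (cpoly (P u)).[w j] * (cpoly (P t)).[wb j]).
  rewrite (altsum_antisym _ (fun j t u => (cpoly (P t)).[w j] * (cpoly (P u)).[wb j])).
  congr (_ * _); rewrite det_altsum; apply: eq_altsum => [t|j t u].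
    have -> : (ord0 : T) = lshift (n + n) ord0 by apply: val_inj.
    by rewrite mxE /v pair_vec0 -(horner_map (real_complex R)).
  by rewrite !mxE /v pair_vecl pair_vecr.
(* The one-point factors combine with the densities: conj w_j - w_j from the Vandermonde product
   times w_j - conj w_j from the density is |w_j - conj w_j|^2, and |w_j - a|^2 completes the
   weight. *)
have VE : V * \prod_j rho j = e * (over_integrand a s)%:C%C.
  rewrite /over_integrand sn -/X -/Y rmorphM !rmorph_prod/=.
  rewrite /V mulrAC mulrA [RHS]mulrC; congr (_ * _).
    transitivity (\prod_(j < n) ((w j - a%:C%C) * (wb j - a%:C%C) * (wb j - w j) * rho j)).
      by rewrite !big_split.
    by apply: eq_bigr => j _; rewrite -point_factor.
  transitivity (\prod_(j < n) ((\prod_(k < n | (j < k)%N) (-1)) *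
     (\prod_(k < n | (j < k)%N) ((((X j - X k) ^+ 2 + (Y j - Y k) ^+ 2) *
        ((X j - X k) ^+ 2 + (Y j + Y k) ^+ 2))))%:C%C) : C).
    apply: eq_bigr => j _; rewrite rmorph_prod.
    transitivity (\prod_(k < n | (j < k)%N) ((-1) * (((X j - X k) ^+ 2 + (Y j - Y k) ^+ 2) *
        ((X j - X k) ^+ 2 + (Y j + Y k) ^+ 2))%:C%C) : C).
      by apply: eq_bigr => k _; rewrite -pair_factor.
    by rewrite big_split.
  by rewrite big_split.
rewrite [RHS]rmorphM/=.
have -> : (altsum (fun t => (P t).[a])
    (fun j t u => skew_density a (P t) (P u) (X j) (Y j)))%:C%C =
    2 ^+ n * \det A * \prod_j rho j :> C.
  rewrite altA rmorph_sum mulr_suml; apply: eq_bigr => s' _.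
  rewrite !rmorphM rmorphXn rmorphN1 -!mulrA; congr (_ * (_ * _)).
  rewrite rmorph_prod -big_split/=; apply: eq_bigr => j _.
  exact: skew_density_complex.
rewrite detA; move: (\prod_j rho j) V VE {detA} => r V VE.
have -> : 2 ^+ n * ((-1) ^+ b2 * V) * r = 2 ^+ n * ((-1) ^+ b2 * (V * r)).
  by rewrite -!mulrA.
rewrite VE b1E [LHS]rmorphM/= !rmorphXn/= rmorphN1 rmorph_nat signr_addb.
move: (over_integrand a s)%:C%C => o.
have sq (c : bool) : (-1) ^+ c * (-1) ^+ c = 1 :> C by rewrite -expr2 sqrr_sign.
transitivity ((-1) ^+ b2 * (-1) ^+ b2 * ((-1) ^+ b1 * (-1) ^+ b1) * (2 ^+ n * o)).
  by rewrite !sq !mul1r.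
by move: ((-1) ^+ b1) ((-1) ^+ b2) (2 ^+ n) => x1 x2 x3; ring.
Qed.

Let iint_over : exists b : bool, iint n (fun s => (over_integrand a s)%:E) =
  ((-1) ^+ b / 2 ^+ n * altsum (fun t => (P t).[a])
    (fun _ t u => pi * skew_form (1 + (n + n)) a (P t) (P u)))%:E.
Proof.
have [b bE] := over_integrand_altsum; exists b.
have n2 : 2 ^+ n != 0 :> R by rewrite expf_neq0// pnatr_eq0.
(* [iint_sum_prod] indexes its factors by natural numbers, hence these total versions of [lpoint]
   and [rpoint]. *)
pose lp (j : nat) : T := inord (1 + j); pose rp (j : nat) : T := inord (1 + (n + j)).
have lpE (j : 'I_n) : lp j = lpoint j.
  by apply: val_inj; rewrite /= inordK//; have := ltn_ord j; lia.
have rpE (j : 'I_n) : rp j = rpoint j.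
  by apply: val_inj; rewrite /= inordK//; have := ltn_ord j; lia.
pose c (s : {perm T}) : R := (-1) ^+ b / 2 ^+ n * ((-1) ^+ s * (P (s ord0)).[a]).
have sizeP t : (size (P t) <= 1 + (n + n))%N by rewrite /P (q_monic _).1 ltn_ord.
have := iint_sum_prod (index_enum {perm T}) n c
  (fun (s : {perm T}) j => skew_form_integral a (sizeP (s (lp j))) (sizeP (s (rp j)))).
rewrite -/(skew_density _ _ _) => H.
transitivity (\sum_(s : {perm T}) c s *
    \prod_(j < n) (pi * skew_form (1 + (n + n)) a (P (s (lp j))) (P (s (rp j)))))%:E.
  rewrite -H; apply: eq_iint => s sn; congr EFin.
  apply: (mulfI n2); rewrite bE// /altsum !mulr_sumr; apply: eq_bigr => s' _.
  rewrite /c; under [in RHS]eq_bigr do rewrite lpE rpE.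
  by rewrite -!mulrA [RHS]mulrCA (mulrA (2 ^+ n)) divff// mul1r.
congr EFin; rewrite /altsum mulr_sumr; apply: eq_bigr => s _.
by under [in LHS]eq_bigr do rewrite lpE rpE; rewrite /c -!mulrA.
Qed.

Let iint_ge0 m (f : seq (R * R) -> \bar R) : (forall s, 0 <= f s)%E -> (0 <= iint m f)%E.
Proof.
elim: m f => [|m ih] f f0 //=.
by apply: integral_ge0 => x _; apply: integral_ge0 => y _; apply: ih.
Qed.

(** In a skew-orthogonal basis the integrated sum is in normal form, so only the top even polynomial
    at a and the skew norms remain. Their positivity, against a nonnegative integrand, rules out the
    wrong sign. *)
Lemma Z_over_skew_orthogonal (r : 'I_n -> R) :
  (forall t u, skew_form (1 + (n + n)) a (P t) (P u) =
    \sum_k r k * ((t == lpoint k)%:R * (u == rpoint k)%:R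
      - (u == lpoint k)%:R * (t == rpoint k)%:R)) ->
  0 < (q (n + n)).[a] -> (forall k, 0 < r k) ->
  Z_over n a = n`!%:R * ((q (n + n)).[a] * \prod_k r k).
Proof.
move=> orth qa r0; have [b bE] := iint_over.
have p0 := pi_gt0 R; have n2 : 2 ^+ n != 0 :> R by rewrite expf_neq0// pnatr_eq0.
set X := _ * (_ * _); have X0 : 0 < X.
  by rewrite !mulr_gt0// ?ltr0n ?fact_gt0// prodr_gt0.
have E : iint n (fun s => (over_integrand a s)%:E) = ((-1) ^+ b * (pi ^+ n * X))%:E.
  rewrite bE; congr EFin.
  rewrite (@altsum_block _ _ _ (fun t u => pi * skew_form (1 + (n + n)) a (P t) (P u))
    (fun k => pi * r k)); last first.
    by move=> t u; rewrite orth mulr_sumr; apply: eq_bigr => k _; rewrite mulrA.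
  rewrite big_split/= prodr_const card_ord /P.
  have -> : (ord0 : T) = lshift (n + n) ord0 by apply: val_inj.
  rewrite degree_of0 -mulrA (mulrA (_^-1)) mulVf// mul1r /X.
  by congr (_ * _); rewrite [RHS]mulrCA; congr (_ * _); rewrite mulrCA.
have pos : 0 <= (-1) ^+ b * (pi ^+ n * X).
  rewrite -lee_fin -E; apply: iint_ge0 => s; rewrite lee_fin /over_integrand.
  apply: mulr_ge0; apply: prodr_ge0 => j _; last first.
    rewrite /omega_over; set d := _ + _ ^+ 2.
    have d0 : 0 <= d by apply: addr_ge0; exact: sqr_ge0.
    have d1 : 0 <= 1 + d by rewrite addr_ge0.
    have y0 := sqr_ge0 (nth (0, 0) s j).2.
    apply: mulr_ge0; last by apply: mulr_ge0; [exact: mulr_ge0|exact: expR_ge0].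
    by apply: mulr_ge0.
  by apply: prodr_ge0 => k _; rewrite mulr_ge0 ?addr_ge0 ?sqr_ge0.
have pn0 : 0 < pi ^+ n :> R by rewrite exprn_gt0.
case: b E pos {bE} => E pos.
  by move: pos; rewrite expr1 mulN1r oppr_ge0 leNgt (mulr_gt0 pn0 X0).
rewrite /Z_over E expr0 mul1r /= mulrA mulVf ?mul1r// gt_eqF//.
Qed.

End FixedSize.
End OverlapPartitionFunction.

(** * The closed form for finite N *)

Section ClosedForm.
Variable R : realType.
Implicit Types (s x : R) (n k : nat).

Definition pexp n x : R := \sum_(k < n) x ^+ k / k`!%:R.
(** At s = x^2, [eterm] is the even monomial of the kernel and [oterm] the odd one without its
    factor sqrt2 x. *)
Definition eterm s n : R := s ^+ n / n`!%:R.
Definition oterm s n : R := (2 * s) ^+ n / (dfact (2 * n + 1))%:R.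

Lemma pexpS n x : pexp n.+1 x = pexp n x + eterm x n.
Proof. by rewrite /pexp big_ord_recr. Qed.

Lemma eterm0 s : eterm s 0 = 1.
Proof. by rewrite /eterm expr0 fact0 divr1. Qed.

Lemma pexp1 x : pexp 1 x = 1.
Proof. by rewrite pexpS /pexp big_ord0 add0r eterm0. Qed.

Lemma dfactSS n : dfact n.+2 = (n.+2 * dfact n)%N. Proof. by []. Qed.

Lemma dfact_gt0 n : (0 < dfact n)%N.
Proof.
have [m] := ubnP n; elim: m n => // m ih [|[|n]] // nm.
by rewrite dfactSS muln_gt0 ih//; lia.
Qed.

Lemma fact_dfact n : ((2 * n + 1)`! = dfact (2 * n + 1) * (2 ^ n * n`!))%N.
Proof.
elim: n => [//|n ih].
have -> : (2 * n.+1 + 1 = (2 * n + 1).+2)%N by lia.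
rewrite 2!factS dfactSS ih expnS factS (_ : (2 * n + 1).+1 = 2 * n.+1)%N; last by lia.
by move: (dfact _) (2 ^ n)%N n`! (2 * n.+1).+1 n.+1 => d t f a b; ring.
Qed.

Lemma etermS s n : eterm s n.+1 = eterm s n * s / (n%:R + 1).
Proof.
rewrite /eterm exprS factS natrM -natr1.
have := fact_gt0 n; rewrite -(ltr0n R) => f0.
have n0 : n%:R + 1 != 0 :> R by rewrite natr1 pnatr_eq0.
by field; rewrite n0 gt_eqF.
Qed.

Lemma otermS s n : oterm s n.+1 = oterm s n * (2 * s) / (2 * n%:R + 3).
Proof.
rewrite /oterm (_ : 2 * n.+1 + 1 = (2 * n + 1).+2)%N; last by lia.
rewrite dfactSS natrM exprS (_ : (2 * n + 1).+2%:R = 2 * n%:R + 3 :> R); last first.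
  by rewrite -addn2 -addnA natrD natrM.
have := dfact_gt0 (2 * n + 1); rewrite -(ltr0n R) => f0.
have n0 : 0 < 2 * n%:R + 3 :> R by have := ler0n R n; lra.
by field; rewrite !gt_eqF.
Qed.

(** Since (2n + 1)! = (2n + 1)!! 2^n n!, the product is a multiple of a term of the exponential at
    2s; this ties the truncated exponential at 2s to the other two families. *)
Lemma oterm_eterm s n : oterm s n * eterm s n = (2 * s) ^+ (2 * n) / ((2 * n + 1)`!)%:R.
Proof.
rewrite /oterm /eterm fact_dfact !natrM natrX.
have -> : (2 * s) ^+ (2 * n) = (2 * s) ^+ n * (2 * s) ^+ n by rewrite mul2n -addnn exprD.
rewrite !exprMn.
have := dfact_gt0 (2 * n + 1); rewrite -(ltr0n R) => f0.
have := fact_gt0 n; rewrite -(ltr0n R) => f1.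
have : 0 < 2 ^+ n :> R by rewrite exprn_gt0.
by move: (2 ^+ n) => t t0; field; rewrite !gt_eqF.
Qed.

Lemma pexp_double_S s n : pexp (2 * n.+1 + 2) (2 * s) = pexp (2 * n + 2) (2 * s)
  + oterm s n * eterm s n * (2 * s ^+ 2) / (n%:R + 1) + oterm s n.+1 * eterm s n.+1 * (2 * s).
Proof.
rewrite (_ : 2 * n.+1 + 2 = (2 * n + 2).+2)%N; last by lia.
rewrite !pexpS; congr (_ + _ + _).
- rewrite oterm_eterm /eterm (_ : 2 * n + 2 = (2 * n + 1).+1)%N; last by lia.
  rewrite factS natrM (_ : (2 * n + 1).+1%:R = 2 * (n%:R + 1) :> R); last first.
    by rewrite -addn1 -addnA natrD natrM mulrDr mulr1.
  rewrite (_ : (2 * n + 1).+1 = (2 * n).+2)%N; last by lia.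
  rewrite 2!exprS; have := fact_gt0 (2 * n + 1); rewrite -(ltr0n R) => f0.
  have n0 : 0 < n%:R + 1 :> R by have := ler0n R n; lra.
  by field; rewrite !gt_eqF.
- rewrite oterm_eterm /eterm mulrAC -exprSr; congr (_ ^+ _ / _`!%:R); lia.
Qed.

(* [presum n s] is [\sum_(j <= n) (n + 1 - j) * s^j / j!], summed by parts. *)
Definition presum n s : R := (n%:R + 1 - s) * pexp n.+1 s + eterm s n * s.

Lemma presum0 s : presum 0 s = 1.
Proof. by rewrite /presum pexp1 eterm0; ring. Qed.

Lemma presumS n s : presum n.+1 s = presum n s + pexp n.+2 s.
Proof.
rewrite /presum !pexpS etermS -natr1.
have n0 : 0 < n%:R + 1 :> R by have := ler0n R n; lra.
by field; rewrite gt_eqF.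
Qed.

Lemma pexp_ge1 n s : 0 <= s -> 1 <= pexp n.+1 s.
Proof.
move=> s0; elim: n => [|n ih]; first by rewrite pexp1.
by rewrite pexpS (le_trans ih)// lerDl divr_ge0// exprn_ge0.
Qed.

Lemma presum_gt0 n s : 0 <= s -> 0 < presum n s.
Proof.
move=> s0; elim: n => [|n ih]; first by rewrite presum0.
by rewrite presumS addr_gt0// (lt_le_trans ltr01) ?pexp_ge1.
Qed.

(** The linear form of the skew norm recursion: with norms proportional to
    [presum k.+1 s / presum k s], clearing denominators in the continued fraction leaves this. *)
Lemma presum_rec n s :
  (n%:R + 2) * presum n.+2 s = (n%:R + 3 + s) * presum n.+1 s - s * presum n s.
Proof.
rewrite !presumS /presum !pexpS !etermS -!natr1.
have n0 := ler0n R n.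
by field; rewrite !gt_eqF//; lra.
Qed.

(** With N = n + 1 and s = a^2 this is N Z_(N-1)^over(a) / Z_N^(g); the shifts 3/2 and 2 are those
    of N + 1/2 and N + 1. *)
Definition overlap_num n s : R := 4 / 3 * ((n%:R + 3 / 2 - s) * pexp (2 * n + 2) (2 * s)
  - s * (n%:R + 2 - s) * oterm s n * pexp n.+1 s + s ^+ 2 * oterm s n * eterm s n).

(** The x-derivative of the kernel at x = a, as a function of s = a^2. *)
Definition overlap_den n s : R :=
  2 * pexp (2 * n + 2) (2 * s) - 4 * s * oterm s n * pexp n.+1 s.

(** Eliminating the odd polynomials from the skew-orthogonal recursion at a leads to this
    second-order recursion, with the leading monomials as source term. The check reduces everything
    to quantities at index n. *)
Lemma overlap_num_rec n s :
  (n%:R + 5 / 2) * overlap_num n.+2 s = 2 * s * oterm s n.+1 * (presum n.+2 s + presum n.+1 s)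
    - s * overlap_num n s + (s + n%:R + 7 / 2) * overlap_num n.+1 s.
Proof.
rewrite /overlap_num !presumS /presum !pexp_double_S !pexpS !otermS !etermS -!natr1.
have n0 := ler0n R n.
move: (pexp n s) (pexp _ _) (oterm s n) (eterm s n) (n%:R) n0 => E e A B k n0.
by field; rewrite !gt_eqF//; lra.
Qed.

Lemma oterm0 s : oterm s 0 = 1.
Proof. by rewrite /oterm expr0 divr1. Qed.

Lemma pexp2 x : pexp 2 x = 1 + x.
Proof. by rewrite pexpS pexp1 /eterm expr1 divr1. Qed.

Lemma overlap_num0 s : overlap_num 0 s = 2.
Proof.
by rewrite /overlap_num oterm0 eterm0 pexp1 (_ : 2 * 0 + 2 = 2)%N// pexp2; field.
Qed.

Lemma overlap_num1 s : overlap_num 1 s = 10 / 3 + 16 / 3 * s + 4 / 3 * s ^+ 2.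
Proof.
rewrite /overlap_num pexp_double_S !otermS !etermS oterm0 eterm0 pexp2.
by rewrite (_ : 2 * 0 + 2 = 2)%N// pexp2; field.
Qed.

Lemma oterm_ge0 s n : 0 <= s -> 0 <= oterm s n.
Proof. by move=> s0; apply: divr_ge0 => //; rewrite exprn_ge0// mulr_ge0. Qed.

(** One term of the recursion is negative, so positivity alone is not inductive. Monotonicity in n
    is: the recursion for the increments has only nonnegative terms. *)
Lemma overlap_num_gt0 n s : 0 <= s -> 0 < overlap_num n s.
Proof.
move=> s0; suff : 0 < overlap_num n s /\ overlap_num n s <= overlap_num n.+1 s by case.
elim: n => [|n [p0 p1]].
  by rewrite overlap_num0 overlap_num1; split=> //; have := sqr_ge0 s; lra.
have p2 := lt_le_trans p0 p1; split=> //.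
have n0 := ler0n R n; have := overlap_num_rec n s.
have : 0 <= 2 * s * oterm s n.+1 * (presum n.+2 s + presum n.+1 s).
  apply: mulr_ge0; last by rewrite addr_ge0// ltW// presum_gt0.
  by apply: mulr_ge0; [exact: mulr_ge0|exact: oterm_ge0].
move: (2 * s * _ * _) => t t0 E.
have sp : 0 <= s * (overlap_num n.+1 s - overlap_num n s) by rewrite mulr_ge0// subr_ge0.
have : 0 <= (n%:R + 5 / 2) * (overlap_num n.+2 s - overlap_num n.+1 s) by nra.
by rewrite pmulr_rge0 ?subr_ge0//; lra.
Qed.

End ClosedForm.

(** * Skew-orthogonal polynomials of a two-band form *)

Section SkewOrthogonal.
Variables (R : realType) (a : R).
Notation s := (a ^+ 2).
Implicit Types (p q : {poly R}) (j k l n : nat).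

(** Entries of the skew form at degrees (j, j + 1), and for [band2] at degrees (j, j + 2). *)
Definition band1 j : R := 2 * ((1 + s) * disk_moment R j.+1 + disk_moment R j.+2).
Definition band2 j : R := - (2 * a * disk_moment R j.+2).

Fixpoint skew_norm k : R :=
  if k is k'.+1 then band1 (2 * k'.+1) - band2 (2 * k') * band2 (2 * k').+1 / skew_norm k'
  else band1 0.

(** Gram-Schmidt in pairs: with two bands, a new monomial meets only the last pair. An odd
    polynomial is determined up to a multiple of its even partner; the choice made here keeps its
    coefficient in degree 2k equal to zero. *)
Fixpoint skew_pair k : {poly R} * {poly R} :=
  if k is k'.+1 then
    let: (e, o) := skew_pair k' in
    ('X^((2 * k').+2) - (band2 (2 * k') / skew_norm k') *: o
       + (band1 (2 * k').+1 / skew_norm k') *: e,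
     'X^((2 * k').+3) + (band2 (2 * k').+1 / skew_norm k') *: e)
  else (1, 'X).

Definition skew_even k := (skew_pair k).1.
Definition skew_odd k := (skew_pair k).2.

Lemma skew_evenS k : skew_even k.+1 =
  'X^((2 * k).+2) - (band2 (2 * k) / skew_norm k) *: skew_odd k
    + (band1 (2 * k).+1 / skew_norm k) *: skew_even k.
Proof. by rewrite /skew_even /skew_odd /=; case: (skew_pair k). Qed.

Lemma skew_oddS k : skew_odd k.+1 =
  'X^((2 * k).+3) + (band2 (2 * k).+1 / skew_norm k) *: skew_even k.
Proof. by rewrite /skew_even /skew_odd /=; case: (skew_pair k). Qed.

Definition skew_poly i := if odd i then skew_odd i./2 else skew_even i./2.

Lemma monic_perturb m p : (size p <= m)%N ->
  size ('X^m + p) = m.+1 /\ 'X^m + p \is monic.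
Proof.
move=> pm; have sX : (size p < size ('X^m : {poly R}))%N by rewrite size_polyXn.
by rewrite size_polyDl ?size_polyXn// monicE lead_coefDl// lead_coefXn.
Qed.

Lemma size_skew_pair k :
  (size (skew_even k) = (2 * k).+1 /\ skew_even k \is monic) /\
  (size (skew_odd k) = (2 * k).+2 /\ skew_odd k \is monic).
Proof.
elim: k => [|k [[se _] [so _]]].
  by rewrite /skew_even /skew_odd /= size_poly1 size_polyX monic1 monicX.
have sZ c p m : (size p <= m)%N -> (size (c *: p) <= m)%N.
  by apply: leq_trans; exact: size_scale_leq.
rewrite skew_evenS skew_oddS -addrA mulnSr !addn2; split; apply: monic_perturb.
  rewrite (leq_trans (size_polyD _ _))// geq_max -scaleNr !sZ//; last by rewrite so.
  by rewrite se; lia.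
by rewrite sZ// se; lia.
Qed.

Lemma skew_poly_monic i : size (skew_poly i) = i.+1 /\ skew_poly i \is monic.
Proof.
rewrite /skew_poly; have [[se me] [so mo]] := size_skew_pair i./2.
have := odd_double_half i; case: (odd i) => /= E.
  by rewrite so mo; split => //; rewrite -[in RHS]E -mul2n; lia.
by rewrite se me; split => //; rewrite -[in RHS]E -mul2n; lia.
Qed.

Lemma coef_skew_odd k : (skew_odd k)`_(2 * k) = 0.
Proof.
case: k => [|k]; first by rewrite /skew_odd /= coefX.
rewrite skew_oddS coefD coefXn coefZ (_ : (2 * k.+1 == (2 * k).+3)%N = false); last by lia.
rewrite nth_default ?mulr0 ?addr0//.
by rewrite (size_skew_pair k).1.1; lia.
Qed.

Lemma coef_skew_even k : (skew_even k.+1)`_(2 * k).+1 = - (band2 (2 * k) / skew_norm k).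
Proof.
rewrite skew_evenS !coefD coefXn coefN !coefZ eqn_leq ltnn andbF add0r.
have [[se _] [so /monicP]] := size_skew_pair k; rewrite lead_coefE so => -> /=.
by rewrite [(skew_even k)`__]nth_default ?se// mulr1 mulr0 addr0.
Qed.

Section Form.
Variable M : nat.
Notation F := (skew_form M a).

Lemma skew_formC p q : F p q = - F q p.
Proof.
rewrite /skew_form -sumrN exchange_big; apply: eq_bigr => j _ /=.
rewrite -sumrN; apply: eq_bigr => k _ /=.
by rewrite /skew_entry; ring.
Qed.

Lemma skew_formDr p q q' : F p (q + q') = F p q + F p q'.
Proof.
rewrite /skew_form -big_split; apply: eq_bigr => j _ /=.
rewrite -big_split; apply: eq_bigr => k _ /=.
by rewrite coefD; ring.
Qed.

Lemma skew_formZr c p q : F p (c *: q) = c * F p q.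
Proof.
rewrite /skew_form mulr_sumr; apply: eq_bigr => j _ /=.
rewrite mulr_sumr; apply: eq_bigr => k _ /=.
by rewrite coefZ; ring.
Qed.

Lemma skew_formNr p q : F p (- q) = - F p q.
Proof. by rewrite -scaleN1r skew_formZr mulN1r. Qed.

Lemma skew_form_alt p : F p p = 0.
Proof.
have /eqP := skew_formC p p; rewrite -subr_eq0 opprK -mulr2n mulrn_eq0/=.
by move/eqP.
Qed.

(** A polynomial of degree at most j + 1 meets X^(j+2) only through its coefficients in degrees j +
    1 and j. *)
Lemma skew_formXn p j : (size p <= j.+2)%N -> (j.+2 < M)%N ->
  F p 'X^(j.+2) = p`_j.+1 * band1 j.+1 + p`_j * band2 j.
Proof.
move=> pj jM; rewrite /skew_form.
have E (i : 'I_M) : \sum_(k < M) p`_i * ('X^(j.+2) : {poly R})`_k * skew_entry a i k =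
    p`_i * skew_entry a i j.+2.
  rewrite (bigD1 (Ordinal jM))//= coefXn eqxx mulr1 big1 ?addr0// => k /negbTE kj.
  by rewrite coefXn -(inj_eq val_inj)/= in kj *; rewrite kj mulr0 mul0r.
rewrite (eq_bigr _ (fun i _ => E i)).
have j1M : (j.+1 < M)%N by exact: ltnW.
have j0M : (j < M)%N by exact: ltnW.
rewrite (bigD1 (Ordinal j1M))//= (bigD1 (Ordinal j0M))/=; last first.
  by rewrite -(inj_eq val_inj)/= ltn_eqF.
rewrite big1 ?addr0 => [|i /andP[]]; last first.
  rewrite -!(inj_eq val_inj)/= => /negbTE i1 /negbTE i0.
  have [ji|ij] := leqP j.+2 i; first by rewrite nth_default ?mul0r// (leq_trans pj).
  rewrite /skew_entry /half_skew !eqSS i1 i0 !mul0r.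
  have -> : (j.+3 == i) = false by apply/eqP; lia.
  have -> : (j.+4 == i) = false by apply/eqP; lia.
  by rewrite !mul0r !subr0 mulr0.
rewrite /skew_entry /half_skew /band1 /band2 !eqSS !eqxx.
have -> : (j.+1 == j) = false by apply/eqP; lia.
have -> : (j == j.+1) = false by apply/eqP; lia.
have -> : (j.+2 == j) = false by apply/eqP; lia.
have -> : (j.+3 == j) = false by apply/eqP; lia.
have -> : (j.+4 == j) = false by apply/eqP; lia.
by rewrite /=; ring.
Qed.

Lemma skew_form1X : (1 < M)%N -> F 1 'X = band1 0.
Proof.
move=> M1; have M0 : (0 < M)%N by exact: ltnW.
rewrite /skew_form (bigD1 (Ordinal M0))//= (bigD1 (Ordinal M1))//=.
rewrite coefX coef1 /= !mul1r !big1 ?addr0 => [|i i0|k k1].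
- by rewrite /skew_entry /half_skew /band1/=; ring.
- rewrite big1// => k _; rewrite coef1; rewrite -(inj_eq val_inj)/= in i0.
  by rewrite (negbTE i0) !mul0r.
- by rewrite -(inj_eq val_inj)/= in k1; rewrite coefX (negbTE k1) mulr0 mul0r.
Qed.

Hypothesis norm_neq0 : forall k, skew_norm k != 0.

(** Even and odd statements go together, since a new even polynomial is corrected against both
    members of the last pair; earlier pairs have degree too small to meet the new monomial. Each
    half assumes its degree below [M], where truncation is invisible. *)
Lemma skew_orthogonal k :
  ((2 * k < M)%N -> forall l, (l < k)%N ->
    F (skew_even l) (skew_even k) = 0 /\ F (skew_odd l) (skew_even k) = 0) /\
  (((2 * k).+1 < M)%N ->
    (forall l, (l < k)%N -> F (skew_even l) (skew_odd k) = 0 /\ F (skew_odd l) (skew_odd k) = 0) /\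
    F (skew_even k) (skew_odd k) = skew_norm k).
Proof.
have se l := (size_skew_pair l).1.1; have so l := (size_skew_pair l).2.1.
have me l : (skew_even l)`_(2 * l) = 1.
  by have := (size_skew_pair l).1.2; rewrite monicE lead_coefE se => /eqP.
have mo l : (skew_odd l)`_(2 * l).+1 = 1.
  by have := (size_skew_pair l).2.2; rewrite monicE lead_coefE so => /eqP.
elim: k => [|k [ihe iho]].
  by split=> // M1; split=> //; exact: skew_form1X.
have rk := norm_neq0 k.
have orth_even : (2 * k.+1 < M)%N -> forall l, (l < k.+1)%N ->
    F (skew_even l) (skew_even k.+1) = 0 /\ F (skew_odd l) (skew_even k.+1) = 0.
  move=> kM l lk1; have [{}ihe [{}iho hr]] : _ /\ _ := conj (ihe ltac:(lia)) (iho ltac:(lia)).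
  rewrite skew_evenS !(skew_formDr, skew_formNr, skew_formZr).
  rewrite !skew_formXn ?se ?so; [|lia..].
  move: lk1; rewrite ltnS leq_eqVlt => /orP[/eqP ->|lk].
    rewrite hr !skew_form_alt (skew_formC (skew_odd k)) hr coef_skew_odd me mo.
    rewrite [(skew_even k)`__.+1]nth_default ?se//.
    by split; field.
  have [e1 o1] := ihe l lk; have [e2 o2] := iho l lk.
  rewrite e1 o1 e2 o2 !(@nth_default _ 0 _ (2 * k)) ?(@nth_default _ 0 _ (2 * k).+1) ?se ?so; [|lia..].
  by split; ring.
split=> // kM; have kM' : (2 * k.+1 < M)%N by lia.
have {}orth_even := orth_even kM'.
have [{}ihe [{}iho hr]] : _ /\ _ := conj (ihe ltac:(lia)) (iho ltac:(lia)).
split=> [l lk1|].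
  rewrite skew_oddS !skew_formDr !skew_formZr.
  rewrite !skew_formXn ?se ?so; [|lia..].
  move: lk1; rewrite ltnS leq_eqVlt => /orP[/eqP ->|lk].
    rewrite !skew_form_alt (skew_formC (skew_odd k)) hr mo.
    rewrite !(@nth_default _ 0 _ (2 * k).+2) ?se ?so// [(skew_even k)`__.+1]nth_default ?se//.
    by split; field.
  have [e1 o1] := ihe l lk.
  rewrite e1 o1 !(@nth_default _ 0 _ (2 * k).+2) ?(@nth_default _ 0 _ (2 * k).+1) ?se ?so; [|lia..].
  by split; ring.
rewrite [in F _ (skew_odd _)]skew_oddS skew_formDr skew_formZr skew_formXn ?se; [|lia..].
rewrite (skew_formC (skew_even k.+1)) (orth_even k _).1// coef_skew_even.
rewrite (_ : (2 * k).+2 = 2 * k.+1)%N; last by lia.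
by rewrite me [skew_norm k.+1]/=; field.
Qed.

End Form.
End SkewOrthogonal.

(** * Explicit skew norms and polynomial values *)

Section FiniteN.
Variables (R : realType) (a : R).
Notation s := (a ^+ 2).
Let s0 : 0 <= s. Proof. exact: sqr_ge0. Qed.

(** The k-th factor of [Zg]; these cancel in the ratio of partition functions. *)
Definition odd_moment k : R := (2 * k + 1)`!%:R / 2 ^+ (2 * k + 1).

Lemma odd_moment_gt0 k : 0 < odd_moment k.
Proof. by rewrite divr_gt0 ?exprn_gt0// ltr0n fact_gt0. Qed.

Lemma odd_momentS k :
  odd_moment k.+1 = odd_moment k * (k%:R + 1) * (2 * k%:R + 3) / 2.
Proof.
rewrite /odd_moment (_ : 2 * k.+1 + 1 = (2 * k + 1).+2)%N; last by lia.
rewrite 2!factS !natrM 2!exprS.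
have -> : (2 * k + 1).+2%:R = 2 * k%:R + 3 :> R by rewrite -addn2 -addnA natrD natrM.
have -> : (2 * k + 1).+1%:R = 2 * (k%:R + 1) :> R.
  by rewrite -addn1 -addnA natrD natrM mulrDr mulr1.
have : 0 < 2 ^+ (2 * k + 1) :> R by rewrite exprn_gt0.
by move: (2 ^+ _) => t t0; field; rewrite gt_eqF.
Qed.

Lemma disk_moment_odd k : disk_moment R (2 * k).+1 = odd_moment k / 2.
Proof.
rewrite /disk_moment /odd_moment addn1 (exprS 2 (2 * k).+1).
have : 0 < 2 ^+ (2 * k).+1 :> R by rewrite exprn_gt0.
by move: (2 ^+ _) => t t0; field; rewrite gt_eqF.
Qed.

Lemma disk_moment_even k : disk_moment R (2 * k).+2 = odd_moment k * (k%:R + 1) / 2.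
Proof.
rewrite /disk_moment /odd_moment addn1 factS natrM 2!(exprS 2 _.+1).
have -> : (2 * k).+2%:R = 2 * (k%:R + 1) :> R.
  by rewrite -addn2 natrD natrM mulrDr mulr1.
have : 0 < 2 ^+ (2 * k).+1 :> R by rewrite exprn_gt0.
by move: (2 ^+ _) => t t0; field; rewrite gt_eqF.
Qed.

Let doubleS k : (2 * k.+1 = (2 * k).+2)%N. Proof. by lia. Qed.

Lemma band1_even k : band1 a (2 * k) = odd_moment k * (s + k%:R + 2).
Proof. by rewrite /band1 disk_moment_odd disk_moment_even; field. Qed.

Lemma band1_odd k :
  band1 a (2 * k).+1 = odd_moment k * (k%:R + 1) * (s + k%:R + 5 / 2).
Proof. by rewrite /band1 disk_moment_even -doubleS disk_moment_odd odd_momentS; field. Qed.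

Lemma band2_even k : band2 a (2 * k) = - (a * odd_moment k * (k%:R + 1)).
Proof. by rewrite /band2 disk_moment_even; field. Qed.

Lemma band2_odd k : band2 a (2 * k).+1 = - (a * odd_moment k.+1).
Proof. by rewrite /band2 -doubleS disk_moment_odd; field. Qed.

Lemma skew_normE k :
  skew_norm a k = odd_moment k * (k%:R + 1) * (presum k.+1 s / presum k s).
Proof.
have S0 l : presum l s != 0 by rewrite gt_eqF// presum_gt0.
elim: k => [|k ih].
  by rewrite /= (band1_even 0) presumS presum0 pexp2; field.
rewrite [LHS]/= band1_even band2_even band2_odd ih -natr1.
have := presum_rec k s; have := odd_moment_gt0 k; have := odd_moment_gt0 k.+1.
have := S0 k; have := S0 k.+1; have := S0 k.+2; have := ler0n R k.
move: (presum k.+2 s) (presum k.+1 s) (presum k s) (odd_moment k.+1) (odd_moment k) (k%:R).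
move=> x y z g f c c0 x0 y0 z0 g0 f0 E.
have -> : x = ((c + 3 + s) * y - s * z) / (c + 2).
  have c2 : c + 2 != 0 by rewrite gt_eqF// ltr_wpDl.
  by rewrite -E; field.
by field; rewrite y0 z0 !gt_eqF//; lra.
Qed.

Lemma skew_norm_gt0 k : 0 < skew_norm a k.
Proof.
rewrite skew_normE; apply: mulr_gt0; last by rewrite divr_gt0 ?presum_gt0.
by rewrite mulr_gt0 ?odd_moment_gt0//; have := ler0n R k; lra.
Qed.

Lemma prod_skew_norm n : \prod_(k < n) skew_norm a k =
  (\prod_(k < n) odd_moment k) * n`!%:R * presum n s.
Proof.
elim: n => [|n ih]; first by rewrite !big_ord0 presum0 !mulr1.
rewrite !big_ord_recr/= ih skew_normE factS natrM -natr1.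
have : presum n s != 0 by rewrite gt_eqF// presum_gt0.
by move: (presum _ _) => x x0; field.
Qed.

(** Equal to Gamma(k + 3/2) / sqrt pi; it normalises the values of the even polynomials to
    [overlap_num]. *)
Definition half_dfact k : R := (dfact (2 * k + 1))%:R / 2 ^+ k.+1.

Lemma half_dfactS k : half_dfact k.+1 = half_dfact k * (k%:R + 3 / 2).
Proof.
rewrite /half_dfact (_ : 2 * k.+1 + 1 = (2 * k + 1).+2)%N; last by lia.
rewrite dfactSS natrM (exprS 2 k.+1).
have -> : (2 * k + 1).+2%:R = 2 * k%:R + 3 :> R by rewrite -addn2 -addnA natrD natrM.
have : 0 < 2 ^+ k.+1 :> R by rewrite exprn_gt0.
by move: (2 ^+ _) => t t0; field; rewrite gt_eqF.
Qed.

Lemma half_dfact_oterm k : half_dfact k * (2 * s * oterm s k) = s ^+ k.+1.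
Proof.
rewrite /half_dfact /oterm exprMn !exprS.
have := dfact_gt0 (2 * k + 1); rewrite -(ltr0n R) => f0.
have : 0 < 2 ^+ k :> R by rewrite exprn_gt0.
by move: (2 ^+ _) => t t0; field; rewrite !gt_eqF.
Qed.

Lemma half_dfact_fact k : half_dfact k * k`!%:R = odd_moment k.
Proof.
rewrite /half_dfact /odd_moment fact_dfact !natrM natrX (exprS 2 k).
have -> : 2 ^+ (2 * k + 1) = 2 * (2 ^+ k * 2 ^+ k) :> R by rewrite addn1 exprS mul2n -addnn exprD.
have : 0 < 2 ^+ k :> R by rewrite exprn_gt0.
by move: (2 ^+ _) => t t0; field; rewrite gt_eqF.
Qed.

Lemma horner_skew_evenS k : presum k.+1 s * (skew_even a k.+1).[a] =
  s ^+ k.+1 * presum k.+1 s + presum k s * (a * (skew_odd a k).[a])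
  + (s + k%:R + 5 / 2) * (presum k s * (skew_even a k).[a]).
Proof.
rewrite skew_evenS !(hornerD, hornerN, hornerZ, hornerXn) skew_normE band2_even band1_odd.
have -> : a ^+ (2 * k).+2 = s ^+ k.+1 by rewrite -doubleS exprM.
have [S0 S1] : presum k s != 0 /\ presum k.+1 s != 0 by rewrite !gt_eqF// presum_gt0.
have := odd_moment_gt0 k; have := ler0n R k.
move: (presum k s) (presum k.+1 s) S0 S1 (odd_moment k) (k%:R) => x y x0 y0 f c c0 f0.
by field; rewrite x0 y0 !gt_eqF//; lra.
Qed.

Lemma horner_skew_oddS k : presum k.+1 s * (a * (skew_odd a k.+1).[a]) =
  s ^+ k.+2 * presum k.+1 s - s * (k%:R + 3 / 2) * (presum k s * (skew_even a k).[a]).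
Proof.
rewrite skew_oddS !(hornerD, hornerN, hornerZ, hornerXn) skew_normE band2_odd odd_momentS.
have -> : a ^+ (2 * k).+3 = a * s ^+ k.+1 by rewrite exprS -doubleS exprM.
rewrite (exprS s k.+1).
have [S0 S1] : presum k s != 0 /\ presum k.+1 s != 0 by rewrite !gt_eqF// presum_gt0.
have := odd_moment_gt0 k; have := ler0n R k.
move: (presum k s) (presum k.+1 s) S0 S1 (odd_moment k) (k%:R) => x y x0 y0 f c c0 f0.
by field; rewrite x0 y0 !gt_eqF//; lra.
Qed.

(** Multiplying by [presum] clears the denominators of the skew norms, and odd values enter
    multiplied by a so that only s = a^2 occurs. Two consecutive indices are carried because the
    recursion has second order. *)
Lemma horner_skew_even k :
  presum k s * (skew_even a k).[a] = half_dfact k * overlap_num k s.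
Proof.
suff : presum k s * (skew_even a k).[a] = half_dfact k * overlap_num k s /\
  presum k.+1 s * (skew_even a k.+1).[a] = half_dfact k.+1 * overlap_num k.+1 s by case.
have h0 : half_dfact 0 = 1 / 2 by rewrite /half_dfact expr1.
elim: k => [|k [ih1 ih2]].
  split; first by rewrite /skew_even /= presum0 hornerC overlap_num0 h0; field.
  rewrite horner_skew_evenS /skew_even /skew_odd /= hornerX hornerC.
  by rewrite presumS presum0 pexp2 half_dfactS h0 overlap_num1; field.
split=> //; rewrite horner_skew_evenS horner_skew_oddS ih1 ih2 -half_dfact_oterm.
rewrite (half_dfactS k.+1).
have := overlap_num_rec k s.
have -> : k%:R + 5 / 2 = k.+1%:R + 3 / 2 :> R by rewrite -natr1; field.
by move=> E; rewrite -[RHS]mulrA E half_dfactS -!natr1; field.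
Qed.

Lemma skew_even_gt0 k : 0 < (skew_even a k).[a].
Proof.
have : 0 < presum k s * (skew_even a k).[a].
  rewrite horner_skew_even mulr_gt0 ?overlap_num_gt0//.
  by rewrite divr_gt0 ?exprn_gt0// ltr0n dfact_gt0.
by rewrite pmulr_rgt0// presum_gt0.
Qed.

Lemma skew_form_points n (t u : 'I_(1 + (n + n))) :
  skew_form (1 + (n + n)) a (skew_poly a (degree_of t)) (skew_poly a (degree_of u)) =
    \sum_(k < n) skew_norm a k * ((t == lpoint k)%:R * (u == rpoint k)%:R
      - (u == lpoint k)%:R * (t == rpoint k)%:R).
Proof.
have nz k : skew_norm a k != 0 by rewrite gt_eqF// skew_norm_gt0.
pose M := (1 + (n + n))%N.
have so k := skew_orthogonal M nz k.
have E0 : skew_poly a (n + n) = skew_even a n.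
  by rewrite /skew_poly addnn odd_double doubleK.
have El (k : 'I_n) : skew_poly a (2 * k) = skew_even a k.
  by rewrite /skew_poly mul2n odd_double doubleK.
have Er (k : 'I_n) : skew_poly a (2 * k).+1 = skew_odd a k.
  by rewrite /skew_poly mul2n /= odd_double /= uphalf_double.
have rlF (j k : 'I_n) : (rpoint j == lpoint k) = false by rewrite eq_sym lrpoint_eqF.
have F0l (i : 'I_1) (k : 'I_n) : (lshift (n + n) i == lpoint k) = false by exact: eq_lrshift.
have F0r (i : 'I_1) (k : 'I_n) : (lshift (n + n) i == rpoint k) = false by exact: eq_lrshift.
have zero (f : 'I_n -> R) : (forall k, f k = 0) -> 0 = \sum_k f k.
  by move=> f0; rewrite big1.
have ee j k : (2 * j < M)%N -> (2 * k < M)%N ->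
    skew_form M a (skew_even a j) (skew_even a k) = 0.
  move=> jM kM; case: (ltngtP j k) => [jk|kj|->]; last exact: skew_form_alt.
    by have [e _] := so k; have [] := e kM j jk.
  by rewrite skew_formC; have [e _] := so j; have [-> _] := e jM k kj; rewrite oppr0.
have oo j k : ((2 * j).+1 < M)%N -> ((2 * k).+1 < M)%N ->
    skew_form M a (skew_odd a j) (skew_odd a k) = 0.
  move=> jM kM; case: (ltngtP j k) => [jk|kj|->]; last exact: skew_form_alt.
    by have [_ o] := so k; have [/(_ j jk) []] := o kM.
  by rewrite skew_formC; have [_ o] := so j; have [/(_ k kj) [_ ->]] := o jM; rewrite oppr0.
have eo j k : (2 * j < M)%N -> ((2 * k).+1 < M)%N ->
    skew_form M a (skew_even a j) (skew_odd a k) = (j == k)%:R * skew_norm a k.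
  move=> jM kM; case: (ltngtP j k) => [jk|kj|->]; rewrite ?mul0r.
  - by have [_ o] := so k; have [/(_ j jk) []] := o kM.
  - by rewrite skew_formC; have [e _] := so j; have [_ ->] := e jM k kj; rewrite oppr0.
  - by rewrite mul1r; have [_ o] := so k; have [] := o kM.
have lt2 (i : 'I_n) : ((2 * i).+1 < M)%N by have := ltn_ord i; rewrite /M; lia.
have lt2' (i : 'I_n) : (2 * i < M)%N by rewrite ltnW.
have n2 : (2 * n < M)%N by rewrite /M; lia.
case: (pointP t) => i; case: (pointP u) => j;
  rewrite ?degree_of0 ?degree_ofl ?degree_ofr ?E0 ?El ?Er.
- by rewrite ee//; apply: zero => k; rewrite !F0l !mul0r subrr mulr0.
- rewrite ee//; apply: zero => k.
  by rewrite F0l F0r mul0r mulr0 subrr mulr0.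
- rewrite eo// (gtn_eqF (ltn_ord j)) mul0r; apply: zero => k.
  by rewrite F0l F0r mul0r mulr0 subrr mulr0.
- rewrite ee//; apply: zero => k.
  by rewrite F0l F0r mul0r mulr0 subrr mulr0.
- rewrite ee//; apply: zero => k.
  by rewrite !lrpoint_eqF !mulr0 subrr mulr0.
- rewrite eo// (bigD1 j)//= big1 ?addr0 => [|k /negbTE kj].
    rewrite (inj_eq (@lpoint_inj _)) (inj_eq (@rpoint_inj _)) eqxx rlF mul0r subr0 mulr1 mulrC.
    by rewrite -val_eqE.
  by rewrite (inj_eq (@rpoint_inj _)) (eq_sym j) kj rlF mul0r mulr0 subrr mulr0.
- rewrite skew_formC eo// (gtn_eqF (ltn_ord i)) mul0r oppr0; apply: zero => k.
  by rewrite F0l F0r mul0r mulr0 subrr mulr0.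
- rewrite skew_formC eo// (bigD1 i)//= big1 ?addr0 => [|k /negbTE ki].
    rewrite (inj_eq (@lpoint_inj _)) (inj_eq (@rpoint_inj _)) eqxx rlF mul0r sub0r mulr1 mulrN mulrC.
    by rewrite -val_eqE.
  by rewrite (inj_eq (@rpoint_inj _)) (eq_sym i) ki rlF mul0r mulr0 subrr mulr0.
- rewrite oo//; apply: zero => k.
  by rewrite !rlF !mul0r subrr mulr0.
Qed.

Lemma Z_over_overlap_num n :
  Z_over n a = n`!%:R * ((\prod_(k < n.+1) odd_moment k) * overlap_num n s).
Proof.
have E0 : skew_poly a (n + n) = skew_even a n.
  by rewrite /skew_poly addnn odd_double doubleK.
rewrite (@Z_over_skew_orthogonal R n a _ (skew_poly_monic a) (fun k => skew_norm a k)).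
- rewrite E0 prod_skew_norm big_ord_recr/= -half_dfact_fact.
  have := horner_skew_even n.
  move: (presum n s) (skew_even a n).[a] (\prod_(k < n) _) => x y z E.
  have -> : y * (z * n`!%:R * x) = z * n`!%:R * (x * y) by ring.
  by rewrite E; ring.
- exact: skew_form_points.
- by rewrite E0 skew_even_gt0.
- by move=> k; exact: skew_norm_gt0.
Qed.

Lemma overlap_ratio n : n.+1%:R * Z_over n a / Zg R n.+1 = overlap_num n s.
Proof.
rewrite Z_over_overlap_num /Zg factS natrM -/(odd_moment _).
have p0 : 0 < \prod_(k < n.+1) odd_moment k by apply: prodr_gt0 => k _; exact: odd_moment_gt0.
have f0 : 0 < n`!%:R :> R by rewrite ltr0n fact_gt0.
have n0 : 0 < n.+1%:R :> R by rewrite ltr0n.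
rewrite -/odd_moment.
move: (\prod_(k < n.+1) _) p0 (n`!%:R) f0 (n.+1%:R) n0 => p p0 f f0 c c0.
by field; rewrite !gt_eqF.
Qed.

End FiniteN.

(** * Derivative of the kernel on the diagonal *)

Section KernelDerivative.
Variable R : realType.
Implicit Types (a x y : R) (n k l : nat).

Lemma is_derive_sumfun n (f : 'I_n -> R -> R) (df : 'I_n -> R) x :
  (forall i, is_derive x 1 (f i) (df i)) ->
  is_derive x 1 (fun y => \sum_(i < n) f i y) (\sum_(i < n) df i).
Proof.
move=> fE; have -> : (fun y => \sum_(i < n) f i y) = \sum_(i < n) f i.
  by apply/funext => y; rewrite fct_sumE.
exact: is_derive_sum.
Qed.

Definition odd_mono k x : R := (sqrt2 R * x) ^+ (2 * k + 1) / (dfact (2 * k + 1))%:R.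
Definition even_mono l x : R := (sqrt2 R * x) ^+ (2 * l) / (dfact (2 * l))%:R.

Let sqrt2K : sqrt2 R ^+ 2 = 2. Proof. by rewrite sqr_sqrtr. Qed.

Let mono_even x m : (sqrt2 R * x) ^+ (2 * m) = (2 * x ^+ 2) ^+ m.
Proof. by rewrite exprM (exprMn 2) sqrt2K. Qed.

Lemma dfact_double l : dfact (2 * l) = (2 ^ l * l`!)%N.
Proof.
elim: l => [//|l ih]; rewrite (_ : 2 * l.+1 = (2 * l).+2)%N; last by lia.
by rewrite dfactSS ih expnS factS; nia.
Qed.

Lemma even_monoE l x : even_mono l x = eterm (x ^+ 2) l.
Proof.
rewrite /even_mono /eterm mono_even exprMn dfact_double natrM natrX.
have := fact_gt0 l; rewrite -(ltr0n R) => f0.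
have : 0 < 2 ^+ l :> R by rewrite exprn_gt0.
by move: (2 ^+ _) => t t0; field; rewrite !gt_eqF.
Qed.

Lemma odd_monoE k x : odd_mono k x = sqrt2 R * x * oterm (x ^+ 2) k.
Proof. by rewrite /odd_mono /oterm addn1 exprS mono_even mulrA. Qed.

Lemma is_derive_odd_mono k x :
  is_derive x 1 (odd_mono k) (sqrt2 R * ((2 * k%:R + 1) * oterm (x ^+ 2) k)).
Proof.
have dl : is_derive x 1 (fun y => sqrt2 R * y) (sqrt2 R).
  by apply: trigger_derive; rewrite /GRing.scale/=; ring.
apply: is_derive_eqfun (is_derive_mulfun (is_derive_powfun (2 * k + 1) dl)
  (is_derive_cstfun (dfact (2 * k + 1))%:R^-1 x)) => //.
rewrite /oterm addn1 /= mono_even -addn1 natrD natrM mulr0 addr0; ring.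
Qed.

Lemma is_derive_even_mono l x :
  is_derive x 1 (even_mono l) (2 * x * (if l is l'.+1 then eterm (x ^+ 2) l' else 0)).
Proof.
case: l => [|l].
  apply: is_derive_eqfun (is_derive_cstfun 1 x) => [y|].
    by rewrite even_monoE eterm0.
  by rewrite mulr0.
have dl : is_derive x 1 (fun y => y ^+ 2) (2 * x).
  by apply: trigger_derive; rewrite /GRing.scale/=; ring.
apply: is_derive_eqfun (is_derive_mulfun (is_derive_powfun l.+1 dl)
  (is_derive_cstfun l.+1`!%:R^-1 x)) => [y|].
  by rewrite even_monoE.
rewrite mulr0 addr0 /eterm factS natrM/=.
have := fact_gt0 l; rewrite -(ltr0n R) => f0.
have n0 : l.+1%:R != 0 :> R by rewrite pnatr_eq0.
by move: (l.+1%:R) n0 => c c0; field; rewrite c0 gt_eqF.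
Qed.

Lemma overlap_den_S n (s : R) : overlap_den n.+1 s = overlap_den n s +
  2 * oterm s n.+1 * ((2 * n%:R + 3) * pexp n.+2 s - 2 * s * pexp n.+1 s).
Proof.
rewrite /overlap_den pexp_double_S !pexpS !otermS !etermS.
have n0 := ler0n R n.
move: (pexp n s) (pexp _ _) (oterm s n) (eterm s n) (n%:R) n0 => E e A B k n0.
by field; rewrite !gt_eqF//; lra.
Qed.

(** Differentiating the even monomials lowers their index, so for each k the inner sum becomes a
    combination of two truncated exponentials; it is the increment in [overlap_den_S], and the outer
    sum telescopes. *)
Lemma is_derive_kappa n a :
  is_derive a 1 (fun x => kappa_g n.+1 x a) (overlap_den n (a ^+ 2)).
Proof.
pose df k l := sqrt2 R * ((2 * k%:R + 1) * oterm (a ^+ 2) k) * even_mono l a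
   - odd_mono k a * (2 * a * (if l is l'.+1 then eterm (a ^+ 2) l' else 0)).
have dk (k l : nat) : is_derive a 1 (fun x => odd_mono k x * even_mono l a
    - odd_mono k a * even_mono l x) (df k l).
  apply: is_derive_eqfun (is_deriveB
    (is_derive_mulfun (is_derive_odd_mono k a) (is_derive_cstfun (even_mono l a) a))
    (is_derive_mulfun (is_derive_cstfun (odd_mono k a) a) (is_derive_even_mono l a))) => //.
  by rewrite /df mulr0 mul0r addr0 add0r.
have dS := is_derive_mulfun (is_derive_cstfun (sqrt2 R) a)
  (is_derive_sumfun (fun k : 'I_n.+1 => is_derive_sumfun (fun l : 'I_k.+1 => dk k l))).
apply: is_derive_eqfun dS => //.
rewrite mul0r add0r.
elim: n => [|n ih].
  rewrite !big_ord_recr !big_ord0 /df/= /overlap_den pexp1 oterm0 even_monoE eterm0.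
  rewrite (_ : 2 * 0 + 2 = 2)%N// pexp2 !add0r !mulr0 subr0 add0r !mulr1.
  by rewrite -expr2 sqrt2K; ring.
rewrite big_ord_recr mulrDr ih overlap_den_S; congr (_ + _).
rewrite /df /= sumrB -mulr_sumr -mulr_sumr -mulr_sumr odd_monoE.
have -> : \sum_(i < n.+2) even_mono i a = pexp n.+2 (a ^+ 2).
  by apply: eq_bigr => i _; rewrite even_monoE.
rewrite big_ord_recl/= add0r -/(pexp n.+1 (a ^+ 2)) -[n.+1%:R]natr1.
move: (pexp n.+2 _) (pexp n.+1 _) (oterm _ _) (n%:R) => e e' o c.
transitivity (sqrt2 R ^+ 2 * (o * ((2 * c + 3) * e - 2 * a ^+ 2 * e'))); first by ring.
by rewrite sqrt2K; ring.
Qed.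

Lemma kappa_diag n a : kappa_g n a a = 0.
Proof.
rewrite /kappa_g big1 ?mulr0// => k _; rewrite big1// => l _.
by rewrite subrr.
Qed.

(** The skew kernel vanishes on the diagonal, so the derivative of the exponential prefactor does
    not contribute. *)
Lemma derive_kappa_hat n a : derive1 (fun x => kappa_hat n.+1 x a) a =
  expR (- (2 * a ^+ 2)) * overlap_den n (a ^+ 2).
Proof.
rewrite derive1E.
have de : is_derive a 1 (fun x => - (2 * x * a)) (- (2 * a)).
  by apply: trigger_derive; rewrite /GRing.scale/=; ring.
have [_ ->] := is_derive_mulfun (is_derive_expfun de) (is_derive_kappa n a).
by rewrite kappa_diag mulr0 add0r -mulrA -expr2.
Qed.

Lemma DhatE n a : Dhat n.+1 a = overlap_num n (a ^+ 2) / overlap_den n (a ^+ 2).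
Proof.
rewrite /Dhat overlap_ratio derive_kappa_hat; congr (_ * _).
rewrite invfM mulrA divff ?mul1r//.
by rewrite gt_eqF// expR_gt0.
Qed.

End KernelDerivative.

(** * Poisson tails and the error function *)

Section PoissonTail.
Variable R : realType.
Implicit Types (x y : R) (n m k : nat).

(* [P(X < n)], with a strict inequality, for [X] Poisson of mean [x]. *)
Definition poisson_cdf n x : R := expR (- x) * pexp n x.
Notation T := poisson_cdf.

Lemma pexp_series n x : pexp n x = series (exp_coeff x) n.
Proof. by rewrite /pexp /series/= big_mkord. Qed.

Lemma eterm_ge0 x n : 0 <= x -> 0 <= eterm x n.
Proof. by move=> x0; rewrite divr_ge0// exprn_ge0. Qed.

Lemma pexp_homo x n m : 0 <= x -> (n <= m)%N -> pexp n x <= pexp m x.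
Proof.
move=> x0; elim: m => [|m ih]; first by rewrite leqn0 => /eqP ->.
rewrite leq_eqVlt => /orP[/eqP ->//|/ih h]; apply: le_trans h _.
by rewrite pexpS lerDl eterm_ge0.
Qed.

Lemma pexp_le_expR x n : 0 <= x -> pexp n x <= expR x.
Proof.
move=> x0; rewrite pexp_series /expR.
apply: nondecreasing_cvgn_le; last exact: is_cvg_series_exp_coeff.
by move=> i j ij; rewrite -!pexp_series pexp_homo.
Qed.

Lemma poisson_cdf_ge0 n x : 0 <= x -> 0 <= T n x.
Proof. by move=> x0; rewrite mulr_ge0 ?expR_ge0// sumr_ge0// => k _; exact: eterm_ge0. Qed.

Lemma poisson_cdf_le1 n x : 0 <= x -> T n x <= 1.
Proof. by move=> x0; rewrite /T expRN mulrC ler_pdivrMr ?expR_gt0// mul1r pexp_le_expR. Qed.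

(** Truncated form of mean = variance: the second moment about x differs from x times the mass by a
    single boundary term, which telescopes. *)
Lemma poisson_variance n x :
  \sum_(k < n.+1) ((k%:R - x) ^+ 2 - x) * eterm x k = (x - n.+1%:R) * x * eterm x n.
Proof.
elim: n => [|n ih]; first by rewrite big_ord_recr big_ord0 /= eterm0; ring.
rewrite big_ord_recr/= ih etermS -!natr1.
have n0 : n%:R + 1 != 0 :> R by rewrite natr1 pnatr_eq0.
by move: (n%:R) n0 => c c0; field.
Qed.

(** Truncating at m >= x makes the boundary term nonpositive, so finite sums already obey the
    variance bound; splitting at n prepares the two one-sided Chebyshev inequalities. *)
Lemma poisson_variance_le n m x : 0 <= x -> (n <= m)%N -> x <= m%:R ->
  \sum_(n <= k < m) (k%:R - x) ^+ 2 * eterm x k <= x * expR x /\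
  \sum_(0 <= k < n) (k%:R - x) ^+ 2 * eterm x k <= x * expR x.
Proof.
move=> x0 nm xm.
have ge0 k : 0 <= (k%:R - x) ^+ 2 * eterm x k by rewrite mulr_ge0 ?sqr_ge0 ?eterm_ge0.
have H : \sum_(0 <= k < m) (k%:R - x) ^+ 2 * eterm x k <= x * expR x.
  case: m nm xm => [|m] nm xm; first by rewrite big_geq// mulr_ge0 ?expR_ge0.
  have := poisson_variance m x; rewrite big_mkord.
  under eq_bigr do rewrite mulrBl; rewrite sumrB -mulr_sumr.
  move/eqP; rewrite subr_eq => /eqP ->; rewrite -/(pexp m.+1 x).
  apply: (@le_trans _ _ (x * pexp m.+1 x)); last by rewrite ler_wpM2l// pexp_le_expR.
  rewrite gerDr mulr_le0_ge0 ?eterm_ge0// mulr_le0_ge0//.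
  by rewrite subr_le0.
move: H; rewrite (big_cat_nat (leq0n n) nm)//= => H.
have g1 : 0 <= \sum_(n <= k < m) (k%:R - x) ^+ 2 * eterm x k by apply: sumr_ge0.
have g2 : 0 <= \sum_(0 <= k < n) (k%:R - x) ^+ 2 * eterm x k by apply: sumr_ge0.
by split; apply: le_trans H; rewrite ?lerDr ?lerDl.
Qed.

Lemma poisson_upper_tail n x : n%:R <= x -> (x - n%:R) ^+ 2 * T n x <= x.
Proof.
move=> nx; have x0 : 0 <= x by apply: le_trans nx.
rewrite /T expRN mulrCA mulrC ler_pdivrMr ?expR_gt0//.
have [m xm] : exists m : nat, x <= m%:R.
  by exists (Num.bound x); apply/ltW/archi_boundP.
have nm : (n <= m)%N by rewrite -(ler_nat R) (le_trans nx).
have [_] := poisson_variance_le x0 nm xm; apply: le_trans.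
rewrite big_mkord /pexp mulr_sumr; apply: ler_sum => k _.
apply: ler_wpM2r; first exact: eterm_ge0.
have : (k%:R : R) <= n%:R by rewrite ler_nat ltnW.
by move: (k%:R) (n%:R) nx => c d nx cd; nra.
Qed.

(** The mass from n on is an infinite series, so the finite bound is passed to the limit in m. *)
Lemma poisson_lower_tail n x : 0 <= x -> x <= n%:R -> (n%:R - x) ^+ 2 * (1 - T n x) <= x.
Proof.
move=> x0 xn.
have H m : (n <= m)%N -> (n%:R - x) ^+ 2 * (pexp m x - pexp n x) <= x * expR x.
  move=> nm; have xm : x <= m%:R by rewrite (le_trans xn)// ler_nat.
  have [+ _] := poisson_variance_le x0 nm xm; apply: le_trans.
  rewrite /pexp -!(big_mkord predT (fun k => x ^+ k / k`!%:R)) (big_cat_nat (leq0n n) nm)//=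
    addrAC subrr add0r.
  rewrite mulr_sumr; apply: ler_sum_nat => k /andP[nk _].
  apply: ler_wpM2r; first exact: eterm_ge0.
  have : (n%:R : R) <= k%:R by rewrite ler_nat.
  by move: (k%:R) (n%:R) xn => c d xn cd; nra.
have : (n%:R - x) ^+ 2 * (expR x - pexp n x) <= x * expR x.
  have c : (n%:R - x) ^+ 2 * (pexp m x - pexp n x) @[m --> \oo] -->
      (n%:R - x) ^+ 2 * (expR x - pexp n x).
    apply: cvgM; first exact: cvg_cst.
    apply: cvgB; last exact: cvg_cst.
    by under eq_fun do rewrite pexp_series; exact: is_cvg_series_exp_coeff.
  rewrite -(cvg_lim _ c)//; apply: limr_le; first by apply/cvg_ex; eexists; exact: c.
  by near=> m; apply: H; near: m; exact: nbhs_infty_ge.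
have e0 := expR_gt0 x.
have -> : 1 - T n x = (expR x - pexp n x) / expR x.
  by rewrite /T expRN mulrBl divff ?gt_eqF// mulrC.
by rewrite mulrA ler_pdivrMr.
Unshelve. all: by end_near. Qed.

Lemma is_derive_pexp n x : is_derive x 1 (pexp n.+1) (pexp n x).
Proof.
elim: n => [|n ih].
  apply: is_derive_eqfun (is_derive_cstfun 1 x); last by rewrite /pexp big_ord0.
  by move=> y; rewrite pexp1.
have dt : is_derive x 1 (fun y => eterm y n.+1) (eterm x n).
  have := is_derive_mulfun (is_derive_powfun n.+1 (is_derive_id x (1 : R)))
    (is_derive_cstfun n.+1`!%:R^-1 x).
  apply: is_derive_eqfun => //.
  rewrite mulr0 addr0 mulr1 /eterm factS natrM/=.
  have := fact_gt0 n; rewrite -(ltr0n R) => f0.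
  have n0 : n.+1%:R != 0 :> R by rewrite pnatr_eq0.
  by move: (n.+1%:R) n0 => c c0; field; rewrite c0 gt_eqF.
apply: is_derive_eqfun (is_deriveD ih dt); last by rewrite pexpS.
by move=> y; rewrite [RHS]pexpS.
Qed.

Lemma is_derive_poisson_cdf n x : is_derive x 1 (T n.+1) (- (expR (- x) * eterm x n)).
Proof.
have de : is_derive x 1 (fun y => - y) (-1 : R) by exact: is_deriveN.
apply: is_derive_eqfun (is_derive_mulfun (is_derive_expfun de) (is_derive_pexp n x)) => //.
by rewrite pexpS; ring.
Qed.

Lemma pmf_le_tail n x : 0 <= x -> expR (- x) * eterm x n <= 1 - T n x.
Proof.
move=> x0; have := poisson_cdf_le1 n.+1 x0; rewrite /T pexpS mulrDr; lra.
Qed.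

End PoissonTail.

(** * The Gaussian tail and erfc *)

Section Erfc.
Variable R : realType.
Notation mu := (@lebesgue_measure R).
Notation G := (@gauss_fun R).
Implicit Types (x y : R).

Definition gauss_tail x : R := (\int[mu]_(t in `[x, +oo[) G t)%R.

Lemma erfcE x : erfc x = 2 / Num.sqrt pi * gauss_tail x.
Proof. by []. Qed.

Let sqrtpi_gt0 : 0 < Num.sqrt pi :> R. Proof. by rewrite sqrtr_gt0 pi_gt0. Qed.

Lemma integrable_gaussS (D : set R) : measurable D -> mu.-integrable D (EFin \o G).
Proof. by move=> mD; apply: (integrableS measurableT) => //; exact: integrableT_gauss. Qed.

Lemma gauss_tail_compl x :
  gauss_tail x = Num.sqrt pi - (\int[mu]_(t in `]-oo, x]) G t)%R.
Proof.
have TE : (\int[mu]_(t in `]-oo, +oo[) G t)%R = Num.sqrt pi.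
  by rewrite set_itvNyy /Rintegral integralT_gauss.
rewrite -TE Rintegral_itvB//; last exact: integrable_gaussS.
by rewrite /gauss_tail Rintegral_itv_obnd_cbnd//; exact: integrable_gaussS.
Qed.

Lemma is_derive_gauss_tail x : is_derive x 1 gauss_tail (- G x).
Proof.
have ig : mu.-integrable `]-oo, (x + 1)] (EFin \o G) by exact: integrable_gaussS.
have x1 : x < x + 1 by rewrite ltrDl.
have [] := @continuous_FTC1 R G -oo%O x (x + 1) x1 ig.
- by rewrite ltNyr.
- exact: continuous_gauss_fun.
move=> d1 d2.
have dPhi : is_derive x 1 (fun y => (\int[mu]_(t in `]-oo, y]) G t)%R) (G x).
  by apply: DeriveDef => //; rewrite -derive1E.
apply: is_derive_eqfun (is_deriveB (is_derive_cstfun (Num.sqrt pi) x) dPhi) => [y|].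
  by rewrite gauss_tail_compl.
by rewrite sub0r.
Qed.

Lemma gauss_tailN x : gauss_tail (- x) = Num.sqrt pi - gauss_tail x.
Proof.
rewrite gauss_tail_compl; congr (_ - _); rewrite /gauss_tail /Rintegral.
rewrite ge0_integration_by_substitutionNy.
- by congr fine; apply: eq_integral => t _; rewrite /= /gauss_fun sqrrN.
- by apply: continuous_subspaceT; exact: continuous_gauss_fun.
- by move=> t _; exact: gauss_fun_ge0.
Qed.

Lemma gauss_tail_ge0 x : 0 <= gauss_tail x.
Proof. by apply: Rintegral_ge0 => t _; exact: gauss_fun_ge0. Qed.

Lemma is_derive_gauss x : is_derive x 1 G (- (2 * x * G x)).
Proof.
have dx : is_derive x 1 (fun y : R => - y ^+ 2) (- (2 * x)).
  by apply: trigger_derive; rewrite /GRing.scale/=; ring.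
by apply: is_derive_eqfun (is_derive_expfun dx) => //; rewrite mulNr.
Qed.

(** Mills' inequality: for t >= x, 2 x e^{-t^2} is at most 2 t e^{-t^2}, which has the primitive -
    e^{-t^2}. *)
Lemma gauss_tail_le x : 0 < x -> 2 * x * gauss_tail x <= G x.
Proof.
move=> x0; pose f t := 2 * t * G t.
have dG (t : R) : is_derive t 1 (fun t => - G t) (f t).
  by apply: is_derive_eqfun (is_deriveN (is_derive_gauss t)) => //; rewrite opprK.
have cf : continuous f.
  move=> t; apply: cvgM; last exact: continuous_gauss_fun.
  by apply: cvgM; [exact: cvg_cst|exact: cvg_id].
have H : (\int[mu]_(t in `[x, +oo[) (f t)%:E = 0%:E - (- G x)%:E)%E.
  apply: (@ge0_continuous_FTC2y R f (fun t => - G t)).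
  - by move=> t xt; rewrite !mulr_ge0 ?gauss_fun_ge0// (le_trans (ltW x0)).
  - exact: continuous_subspaceT.
  - by rewrite -oppr0; apply: cvgN; exact: cvg_gauss_fun.
  - by move=> t _; have [] := dG t.
  - by apply: cvgN; apply: cvg_at_right_filter; exact: continuous_gauss_fun.
  - by move=> t _; rewrite derive1E; have [_ ->] := dG t.
rewrite -EFinB sub0r opprK in H.
rewrite -lee_fin -H /gauss_tail /Rintegral EFinM fineK; last first.
  by apply: integrable_fin_num => //; exact: integrable_gaussS.
rewrite -ge0_integralZl//.
- apply: ge0_le_integral => //.
  + by move=> t _; rewrite -EFinM lee_fin !mulr_ge0 ?gauss_fun_ge0// ltW.
  + by apply/measurable_EFinP/measurable_funTS; apply: measurable_funM => //; exact: measurable_gauss_fun.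
  + by apply/measurable_EFinP/measurable_funTS; exact: continuous_measurable_fun.
  + move=> t; rewrite /= in_itv/= andbT => xt; rewrite -EFinM lee_fin.
    by rewrite ler_wpM2r ?gauss_fun_ge0// ler_wpM2l.
- by apply/measurable_EFinP/measurable_funTS; exact: measurable_gauss_fun.
- by move=> t _; rewrite lee_fin gauss_fun_ge0.
- by rewrite lee_fin mulr_ge0// ltW.
Qed.

End Erfc.

(** * Mean value estimates and positivity of the edge denominator *)

Section MeanValue.
Variable R : realType.
Implicit Types (f df : R -> R) (x y : R).

Lemma mean_value f df x y : x <= y -> (forall z : R, x <= z <= y -> is_derive z 1 f (df z)) ->
  exists2 c, x <= c <= y & f y - f x = df c * (y - x).
Proof.
move=> xy fE.
have cf : {within `[x, y], continuous f}.
  apply/continuous_in_subspaceT => z /[!(@mem_setE R)]; rewrite in_itv/= => zi.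
  by apply/differentiable_continuous/derivable1_diffP; have [] := fE z zi.
have fE' (z : R) : z \in `]x, y[%R -> is_derive z 1 f (df z).
  by rewrite in_itv/= => /andP[/ltW xz /ltW zy]; apply: fE; rewrite xz.
have [c ci ->] := MVT_segment xy fE' cf.
by exists c => //; rewrite in_itv in ci.
Qed.

Lemma derive_lt0_decr f df x y : (forall z : R, is_derive z 1 f (df z)) ->
  (forall z, df z < 0) -> x < y -> f y < f x.
Proof.
move=> fE f0 xy; have [c _ E] := mean_value (ltW xy) (fun z _ => fE z).
by rewrite -subr_lt0 E nmulr_rlt0// subr_gt0.
Qed.

Lemma derive_bound f df x y B : x <= y -> (forall z : R, x <= z <= y -> is_derive z 1 f (df z)) ->
  (forall z, x <= z <= y -> `|df z| <= B) -> `|f y - f x| <= B * (y - x).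
Proof.
move=> xy fE fB; have [c ci ->] := mean_value xy fE.
by rewrite normrM (ger0_norm (x := y - x)) ?subr_ge0// ler_wpM2r ?subr_ge0// fB.
Qed.

Lemma gauss_tail_gt0 x : 0 < gauss_tail x.
Proof.
apply: le_lt_trans (gauss_tail_ge0 (x + 1)) _.
apply: derive_lt0_decr (is_derive_gauss_tail (R := R)) _ _ => [z|]; last by rewrite ltrDl.
by rewrite oppr_lt0 expR_gt0.
Qed.

(* [exp(-x^2) - 2 x gauss_tail x] decreases, and is nonnegative at every x > 0. *)
Lemma gauss_tail_lt x : 2 * x * gauss_tail x < gauss_fun x.
Proof.
pose m y := gauss_fun y - 2 * y * gauss_tail y.
have dm (z : R) : is_derive z 1 m (- (2 * gauss_tail z)).
  have dz : is_derive z 1 (fun y => 2 * y) (2 : R).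
    by apply: trigger_derive; rewrite /GRing.scale/=; ring.
  apply: is_derive_eqfun (is_deriveB (is_derive_gauss z)
    (is_derive_mulfun dz (is_derive_gauss_tail z))) => //; ring.
pose y := `|x| + 1; have xy : x < y by rewrite (le_lt_trans (ler_norm x))// ltrDl.
have y0 : 0 < y by rewrite ltr_wpDl.
have : m y < m x.
  apply: derive_lt0_decr dm _ xy => z.
  by rewrite oppr_lt0 mulr_gt0// gauss_tail_gt0.
by have := gauss_tail_le y0; rewrite /m; lra.
Qed.

Lemma is_derive_scale (f : R -> R) (c d x : R) :
  is_derive (c * x) 1 f d -> is_derive x 1 (fun y => f (c * y)) (c * d).
Proof.
move=> fd; have dz : is_derive x 1 (fun y => c * y) c.
  by apply: trigger_derive; rewrite /GRing.scale/=; ring.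
by apply: is_derive_eqfun (is_derive1_comp fd dz) => //; rewrite mulrC.
Qed.

Definition edge_den x : R :=
  sqrt2 R * erfc (2 * x) - expR (- (2 * x ^+ 2)) * erfc (sqrt2 R * x).

Lemma sqrt2_gt0 : 0 < sqrt2 R. Proof. by rewrite sqrtr_gt0. Qed.

Lemma sqrt2K : sqrt2 R ^+ 2 = 2. Proof. by rewrite sqr_sqrtr. Qed.

Lemma sqrtpi_ge1 : 1 <= Num.sqrt pi :> R.
Proof.
rewrite -{1}sqrtr1 ler_sqrt ?ltW ?pi_gt0//.
by have := @pi_ge2 R; lra.
Qed.

Let p := 2 / Num.sqrt pi : R.
Let p0 : 0 < p. Proof. by rewrite divr_gt0// (lt_le_trans ltr01) ?sqrtpi_ge1. Qed.

(** The last factor is the strict Mills difference of [gauss_tail_lt], so the derivative is negative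
    everywhere. *)
Lemma is_derive_edge_den x : is_derive x 1 edge_den
  (- (2 * p * expR (- (2 * x ^+ 2)) *
      (sqrt2 R / 2 * (gauss_fun (sqrt2 R * x) - 2 * (sqrt2 R * x) * gauss_tail (sqrt2 R * x))))).
Proof.
have e1 : gauss_fun (sqrt2 R * x) = expR (- (2 * x ^+ 2)).
  by rewrite /gauss_fun exprMn sqrt2K.
have e2 : gauss_fun (2 * x) = expR (- (2 * x ^+ 2)) ^+ 2.
  by rewrite /gauss_fun (expr2 (expR _)) -expRD; congr expR; ring.
have d0 : is_derive x 1 (fun y => - (2 * y ^+ 2)) (- (4 * x)).
  by apply: trigger_derive; rewrite /GRing.scale/=; ring.
have d1 := is_derive_scale (is_derive_gauss_tail (2 * x)).
have d2 := is_derive_scale (is_derive_gauss_tail (sqrt2 R * x)).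
have dd := is_deriveB
  (is_derive_mulfun (is_derive_cstfun (sqrt2 R * p) x) d1)
  (is_derive_mulfun (is_derive_cstfun p x) (is_derive_mulfun (is_derive_expfun d0) d2)).
apply: is_derive_eqfun dd => [y|].
  transitivity (sqrt2 R * p * gauss_tail (2 * y)
    - p * (expR (- (2 * y ^+ 2)) * gauss_tail (sqrt2 R * y))) => //.
  by rewrite /edge_den !erfcE -/p; move: (p) => q; ring.
rewrite e1 e2 !mul0r !add0r; have := sqrt2K.
move: (sqrt2 R) (expR _) (gauss_tail _) (p) => t E g q t2.
have -> : 2 * q * E * (t / 2 * (E - 2 * (t * x) * g)) = q * E * (t * E - 2 * t ^+ 2 * x * g) by field.
by rewrite t2; ring.
Qed.

Lemma erfc_le x : 0 < x -> erfc x <= 1 / x.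
Proof.
move=> x0; rewrite erfcE ler_pdivlMr//.
have := gauss_tail_le x0; have := @gauss_fun_le1 R x => g1 gt.
have gx : gauss_tail x * x <= 1 / 2 by nra.
have := sqrtpi_ge1; move: (Num.sqrt pi) => s s1.
have s0 : 0 < s by lra.
have -> : 2 / s * gauss_tail x * x = 2 * (gauss_tail x * x) / s by ring.
by rewrite ler_pdivrMr// mul1r; lra.
Qed.

Lemma edge_den_decr x y : x < y -> edge_den y < edge_den x.
Proof.
apply: derive_lt0_decr is_derive_edge_den _ => z.
rewrite oppr_lt0; apply: mulr_gt0.
  by apply: mulr_gt0; [exact: mulr_gt0|exact: expR_gt0].
apply: mulr_gt0; first by rewrite divr_gt0// sqrt2_gt0.
by rewrite subr_gt0 gauss_tail_lt.
Qed.

Lemma erfc_ge0 x : 0 <= erfc x.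
Proof. by rewrite erfcE mulr_ge0 ?gauss_tail_ge0// divr_ge0 ?sqrtr_ge0. Qed.

(** The function decreases strictly, and far out it is at least - erfc(sqrt2 y), which tends to 0; a
    negative value anywhere would contradict this. *)
Lemma edge_den_gt0 x : 0 < edge_den x.
Proof.
apply: le_lt_trans (edge_den_decr (_ : x < x + 1)); last by rewrite ltrDl.
rewrite leNgt; apply/negP => neg; set e := - edge_den (x + 1).
have e0 : 0 < e by rewrite oppr_gt0.
(* Beyond 1/e the bound erfc(t) <= 1/t falls below e; the other summands put y beyond x + 1. *)
pose y := `|x| + 2 + 1 / e.
have ie : 0 < 1 / e by rewrite divr_gt0.
have y0 : 0 < y by rewrite /y; have := normr_ge0 x; lra.
have xy : x + 1 < y by rewrite /y; have := ler_norm x; lra.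
have := edge_den_decr xy; rewrite {1}/edge_den.
have h1 : 0 <= sqrt2 R * erfc (2 * y) by rewrite mulr_ge0 ?erfc_ge0// ltW// sqrt2_gt0.
have sy : 0 < sqrt2 R * y by rewrite mulr_gt0// sqrt2_gt0.
have s1 : 1 <= sqrt2 R by rewrite -{1}sqrtr1 ler_sqrt//; lra.
have h2 : erfc (sqrt2 R * y) <= e.
  apply: le_trans (erfc_le sy) _.
  rewrite ler_pdivrMr//; have h : 1 = e * (1 / e) by field; rewrite gt_eqF.
  rewrite {1}h ler_pM2l//; apply: (@le_trans _ _ y); last by rewrite ler_peMl// ltW.
  by rewrite /y; have := normr_ge0 x; lra.
have h3 : expR (- (2 * y ^+ 2)) * erfc (sqrt2 R * y) <= erfc (sqrt2 R * y).
  rewrite ler_piMl ?erfc_ge0// -expR0 ler_expR oppr_le0 mulr_ge0 ?sqr_ge0//.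
by rewrite /e in h2; lra.
Qed.

Lemma erfcN x : erfc (- x) = 2 - erfc x.
Proof.
rewrite !erfcE gauss_tailN mulrBr; congr (_ - _).
have : 0 < Num.sqrt pi :> R by rewrite (lt_le_trans ltr01) ?sqrtpi_ge1.
by move: (Num.sqrt pi) => s s0; field; rewrite gt_eqF.
Qed.

Lemma erfc_le2 x : erfc x <= 2.
Proof. by have := erfc_ge0 (- x); rewrite erfcN subr_ge0. Qed.

End MeanValue.

(** * The local limit theorem *)

Section UniformConvergence.
Variable R : realType.
Implicit Types (f g : nat -> R -> R) (u v : R -> R) (M e x : R) (N : nat).

Definition unif M f u := forall e, 0 < e -> exists N0, forall N, (N0 <= N)%N ->
  forall x, `|x| <= M -> `|f N x - u x| < e.

(** The threshold [N1] lets the identity fail for small N, in particular at N = 0, where [N.-1] and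
    division by sqrt N degenerate. *)
Lemma unif_ext N1 M f g u : (forall N x, (N1 <= N)%N -> `|x| <= M -> f N x = g N x) ->
  unif M f u -> unif M g u.
Proof.
move=> fg fu e e0; have [N0 H] := fu e e0; exists (maxn N0 N1) => N.
by rewrite geq_max => /andP[N0N N1N] x xM; rewrite -fg// H.
Qed.

Lemma unif_lim M f u v : (forall x, `|x| <= M -> u x = v x) -> unif M f u -> unif M f v.
Proof.
move=> uv fu e e0; have [N0 H] := fu e e0; exists N0 => N NN x xM.
by rewrite -uv// H.
Qed.

Lemma unif_cst M u : unif M (fun _ => u) u.
Proof. by move=> e e0; exists 0%N => N _ x _; rewrite subrr normr0. Qed.

Lemma unifD M f g u v : unif M f u -> unif M g v ->
  unif M (fun N x => f N x + g N x) (fun x => u x + v x).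
Proof.
move=> fu gv e e0; have e2 : 0 < e / 2 by rewrite divr_gt0.
have [N0 H0] := fu _ e2; have [N1 H1] := gv _ e2; exists (maxn N0 N1) => N.
rewrite geq_max => /andP[N0N N1N] x xM.
rewrite opprD addrACA (le_lt_trans (ler_normD _ _))//.
by have := H0 N N0N x xM; have := H1 N N1N x xM; lra.
Qed.

Lemma unifM M f g u v (A B : R) : (forall x, `|x| <= M -> `|u x| <= A) ->
  (forall x, `|x| <= M -> `|v x| <= B) -> unif M f u -> unif M g v ->
  unif M (fun N x => f N x * g N x) (fun x => u x * v x).
Proof.
move=> uA vB fu gv e e0.
pose C := `|A| + `|B| + 1; have C1 : 1 <= C by rewrite /C; have := normr_ge0 A; have := normr_ge0 B; lra.
(* The error splits as ab - ck = (a - c)(b - k) + (a - c)k + c(b - k); d <= 1 tames the quadratic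
   term, and d <= e / (3C) then controls the sum. *)
pose d := Num.min 1 (e / (3 * C)).
have d0 : 0 < d by rewrite lt_min ltr01 divr_gt0//; lra.
have d1 : d <= 1 by rewrite ge_min lexx.
have dC : d * (3 * C) <= e by rewrite -ler_pdivlMr ?ge_min ?lexx ?orbT//; lra.
have [N0 H0] := fu _ d0; have [N1 H1] := gv _ d0; exists (maxn N0 N1) => N.
rewrite geq_max => /andP[N0N N1N] x xM.
have := H0 N N0N x xM; have := H1 N N1N x xM; have := uA x xM; have := vB x xM.
have := ler_norm A; have := ler_norm B.
move: (f N x) (g N x) (u x) (v x) => a b c k BB AA vk uc gb fa.
have -> : a * b - c * k = (a - c) * (b - k) + (a - c) * k + c * (b - k) by ring.
rewrite (le_lt_trans (ler_normD _ _))// (le_lt_trans (lerD (ler_normD _ _) (lexx _)))//.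
rewrite !normrM; move: (`|a - c|) (`|b - k|) (normr_ge0 (a - c)) (normr_ge0 (b - k)) fa gb => p q p0 q0 pd qd.
have kC : `|k| <= C - 1 - `|A| by rewrite /C; lra.
have cC : `|c| <= C - 1 - `|B| by rewrite /C; lra.
have nA := normr_ge0 A; have nB := normr_ge0 B; have nk := normr_ge0 k; have nc := normr_ge0 c.
have s1 : p * q <= d * 1 by apply: ler_pM => //; lra.
have s2 : p * `|k| <= d * (C - 1) by apply: ler_pM => //; lra.
have s3 : `|c| * q <= d * (C - 1) by rewrite mulrC; apply: ler_pM => //; lra.
have : 0 < d * C by rewrite mulr_gt0//; lra.
by nra.
Qed.

Lemma unifZ M f u (c B : R) : (forall x, `|x| <= M -> `|u x| <= B) ->
  unif M f u -> unif M (fun N x => c * f N x) (fun x => c * u x).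
Proof. by move=> uB; apply: unifM uB (unif_cst M (fun=> c)) => x _; exact: lexx. Qed.

Lemma unifV M f u d : 0 < d -> (forall x, `|x| <= M -> d <= u x) ->
  unif M f u -> unif M (fun N x => (f N x)^-1) (fun x => (u x)^-1).
Proof.
move=> d0 ud fu e e0.
(* The first bound keeps f above d / 2; the second pays for the denominator, which then exceeds d *
   d / 2. *)
pose c := Num.min (d / 2) (e * (d * d / 2)).
have dd : 0 < d * d / 2 by rewrite divr_gt0// mulr_gt0.
have c0 : 0 < c by rewrite lt_min divr_gt0//= mulr_gt0.
have [N0 H0] := fu _ c0; exists N0 => N NN x xM.
have := H0 N NN x xM; have := ud x xM; rewrite lt_min.
move: (f N x) (u x) => a b db /andP[ab1 ab2].
have ha : d / 2 < a by move: ab1; rewrite ltr_distl => /andP[]; lra.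
have [a0 b0] : 0 < a /\ 0 < b by split; lra.
have -> : a^-1 - b^-1 = (b - a) / (a * b) by field; rewrite !gt_eqF.
rewrite normrM normfV (ger0_norm (x := a * b)) ?mulr_ge0 ?ltW// ltr_pdivrMr ?mulr_gt0//.
rewrite distrC (lt_le_trans ab2)// ler_pM2l//; nra.
Qed.

Lemma sqrt_nat_ge (c : R) : exists N0, forall N, (N0 <= N)%N -> c <= Num.sqrt N%:R.
Proof.
exists (Num.bound (c ^+ 2)) => N NN.
have h : c ^+ 2 <= N%:R.
  by apply/ltW/(lt_le_trans (archi_boundP (sqr_ge0 _))); rewrite ler_nat.
by rewrite (le_trans (ler_norm c))// -sqrtr_sqr ler_wsqrtr.
Qed.

Lemma unif0_le N1 (c : R) M f : (forall N x, (N1 <= N)%N -> `|x| <= M ->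
  `|f N x| <= c / Num.sqrt N%:R) -> unif M f (fun=> 0).
Proof.
move=> fc e e0; have [N0 H] := sqrt_nat_ge ((`|c| + 1) / e).
exists (maxn N0 N1) => N; rewrite geq_max => /andP[N0N N1N] x xM.
rewrite subr0 (le_lt_trans (fc N x N1N xM))//.
have := H N N0N; rewrite ler_pdivrMr// => h.
have r0 : 0 < Num.sqrt N%:R :> R.
  by rewrite -(pmulr_lgt0 _ e0) (lt_le_trans _ h)// ltr_wpDl.
by rewrite ltr_pdivrMr// mulrC (lt_le_trans _ h)// (le_lt_trans (ler_norm c))// ltrDl.
Qed.

Lemma expR_dist1 x : `|x| <= 1 / 2 -> `|expR x - 1| <= 2 * `|x|.
Proof.
move=> x2; have h1 := expR_ge1Dx x; have h2 := expR_ge1Dx (- x).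
have e0 := expR_gt0 x; rewrite expRN in h2.
have h3 : (1 - x) * expR x <= 1 by rewrite -ler_pdivlMr// mul1r.
have a0 := normr_ge0 x; have l1 := ler_norm x; have := ler_norm (- x); rewrite normrN => l2.
rewrite ler_norml; move: (`|x|) (expR x) h1 h3 e0 x2 a0 l1 l2 => a E h1 h3 e0 x2 a0 l1 l2.
apply/andP; split; first lra.
rewrite leNgt; apply/negP => H.
have s1 : 0 < (1 - x) * (E - 1 - 2 * a) by rewrite mulr_gt0//; lra.
have s2 : 0 <= a * (1 / 2 - x) by rewrite mulr_ge0//; lra.
by nra.
Qed.

Lemma unif_expR M f : unif M f (fun=> 0) -> unif M (fun N x => expR (f N x)) (fun=> 1).
Proof.
move=> f0 e e0; pose d := Num.min (1 / 2) (e / 2).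
have d0 : 0 < d by rewrite lt_min !divr_gt0.
have [N0 H] := f0 _ d0; exists N0 => N NN x xM.
have := H N NN x xM; rewrite subr0 lt_min => /andP[l1 l2].
by rewrite (le_lt_trans (expR_dist1 (ltW l1)))//; lra.
Qed.

(** For passing from mean s and index N to mean 2s and index 2N: the square-root coordinate scales
    by sqrt 2, and radius 2M covers it. *)
Lemma unif_double M f u : unif (2 * M) f u ->
  unif M (fun N x => f (2 * N)%N (sqrt2 R * x)) (fun x => u (sqrt2 R * x)).
Proof.
move=> fu e e0; have [N0 H] := fu e e0; exists N0 => N NN x xM; apply: H; first lia.
have s2 : sqrt2 R <= 2.
  by have := sqrt2K R; have := sqrt2_gt0 R; move: (sqrt2 R) => t; nra.
by rewrite normrM (ger0_norm (ltW (sqrt2_gt0 R))) ler_pM// ltW// sqrt2_gt0.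
Qed.

End UniformConvergence.

(** * Gaussian shape of the Poisson density *)

Section LocalLimit.
Variable R : realType.
Implicit Types (M e x B : R) (N n : nat).
Notation rt N := (Num.sqrt N%:R : R).
Notation T := (@poisson_cdf R).

Let rt_sq N : rt N ^+ 2 = N%:R. Proof. by rewrite sqr_sqrtr. Qed.

Let rt_gt0 N : (0 < N)%N -> 0 < rt N. Proof. by rewrite sqrtr_gt0 ltr0n. Qed.

(** The value of s^N e^{-s} at s = (sqrt N + x)^2, relative to its value at s = N. *)
Definition local_gauss N x : R :=
  (1 + x / rt N) ^+ (2 * N) * expR (- (2 * rt N * x + x ^+ 2)).

(** A cubic remainder is needed, as it gets multiplied by 2N with t of order 1 / sqrt N. The
    expression has derivative t^2 / (1 + t), and 1 + t >= 1/2. *)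
Lemma ln_taylor2 (t : R) : `|t| <= 1 / 2 ->
  `|ln (1 + t) - t + t ^+ 2 / 2| <= 2 * `|t| ^+ 3.
Proof.
move=> t2; pose h (y : R) := ln (1 + y) - y + y ^+ 2 / 2.
pose dh (y : R) := y ^+ 2 / (1 + y).
have dhE (y : R) : - (1 / 2) <= y -> is_derive y 1 h (dh y).
  move=> y2; have y0 : 0 < 1 + y by lra.
  have d1 : is_derive y 1 (fun z => 1 + z) (1 : R).
    have := is_deriveD (is_derive_cstfun 1 y) (is_derive_id y (1 : R)).
    by apply: is_derive_eqfun => //; rewrite add0r.
  have d2 : is_derive y 1 (fun z => - z + z ^+ 2 / 2) (- 1 + y).
    by apply: trigger_derive; rewrite /GRing.scale/=; field.
  have d3 := is_derive1_comp (is_derive1_ln y0) d1.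
  apply: is_derive_eqfun (is_deriveD d3 d2) => [z|]; first by rewrite /h /= addrA.
  by rewrite /dh; field; rewrite gt_eqF.
have dhB (y : R) : `|y| <= `|t| -> `|dh y| <= 2 * `|t| ^+ 2.
  move=> yt; have := yt; rewrite -ler_sqr ?nnegrE// !real_normK ?num_real// => yt2.
  have : - (1 / 2) <= y by have := ler_norm (- y); rewrite normrN; lra.
  move=> y2; rewrite /dh ger0_norm; last by rewrite divr_ge0 ?sqr_ge0//; lra.
  rewrite ler_pdivrMr; last by lra.
  by have := sqr_ge0 t; nra.
have h0 : h 0 = 0 by rewrite /h addr0 ln1 expr0n /= mul0r subrr addr0.
have t0 := normr_ge0 t; have lt1 := ler_norm t; have := ler_norm (- t); rewrite normrN => lt2.
have -> : ln (1 + t) - t + t ^+ 2 / 2 = h t - h 0 by rewrite h0 subr0.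
have key (y z : R) : y <= z -> `|y| <= `|t| -> `|z| <= `|t| -> `|h z - h y| <= 2 * `|t| ^+ 2 * (z - y).
  move=> yz yt zt.
  have ny := ler_norm (- y); have nz := ler_norm z; rewrite normrN in ny.
  apply: (derive_bound (df := dh)) => // c /andP[yc cz].
    by apply: dhE; lra.
  by apply: dhB; rewrite ler_norml; apply/andP; split; lra.
have [tp|tn] := leP 0 t.
  have := key 0 t tp; rewrite normr0 subr0 (ger0_norm tp) => /(_ tp (lexx _)).
  by have -> : 2 * t ^+ 3 = 2 * t ^+ 2 * t by ring.
have := key t 0 (ltW tn); rewrite normr0 sub0r distrC (ltr0_norm tn) => /(_ (lexx _)).
by rewrite oppr_ge0 (ltW tn) => /(_ isT); have -> : 2 * (- t) ^+ 3 = 2 * (- t) ^+ 2 * - t by ring.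
Qed.

Lemma unif_local_gauss M : unif M local_gauss (fun x => expR (- (2 * x ^+ 2))).
Proof.
(* The error in the exponent: the terms of order sqrt N cancel, and - x^2 arises twice, once from
   the logarithm and once from the exponential. *)
pose del N x := (2 * N%:R) * (ln (1 + x / rt N) - x / rt N + (x / rt N) ^+ 2 / 2).
have [N0 H0] := sqrt_nat_ge (2 * `|M| + 1).
have small N x : (N0 <= N)%N -> `|x| <= M -> 0 < rt N /\ `|x / rt N| <= 1 / 2.
  move=> NN xM; have := H0 N NN; have := normr_ge0 M => M0 h.
  have r0 : 0 < rt N by lra.
  split=> //; rewrite normrM normfV (ger0_norm (ltW r0)) ler_pdivrMr//.
  by have := ler_norm M; lra.
have del0 : unif M del (fun=> 0).
  apply: (@unif0_le _ N0 (4 * `|M| ^+ 3)) => N x NN xM.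
  have [r0 t2] := small N x NN xM; have := ln_taylor2 t2; rewrite /del.
  move=> h; rewrite normrM ger0_norm ?mulr_ge0//.
  apply: (@le_trans _ _ (2 * N%:R * (2 * `|x / rt N| ^+ 3))).
    by rewrite ler_wpM2l// mulr_ge0.
  rewrite normrM normfV (ger0_norm (ltW r0)).
  have -> : 2 * N%:R * (2 * (`|x| / rt N) ^+ 3) = 4 * `|x| ^+ 3 / rt N.
    have := rt_sq N; move: (rt N) r0 => r r0 <-.
    by field; rewrite gt_eqF.
  have x3 : `|x| ^+ 3 <= `|M| ^+ 3 by rewrite lerXn2r ?nnegrE// (le_trans xM)// ler_norm.
  by apply: ler_wpM2r; [rewrite invr_ge0 ltW | rewrite ler_wpM2l].
have E1 : unif M (fun N x => expR (- (2 * x ^+ 2)) * expR (del N x)) (fun x => expR (- (2 * x ^+ 2)) * 1).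
  apply: (@unifM _ _ _ _ _ _ 1 1) (unif_cst M _) (unif_expR del0) => x _; last by rewrite normr1.
  by rewrite ger0_norm ?expR_ge0// -expR0 ler_expR oppr_le0 mulr_ge0 ?sqr_ge0.
apply: unif_lim (fun x _ => mulr1 _) _; apply: (@unif_ext _ N0) E1 => N x NN xM.
have [r0 t2] := small N x NN xM.
have t0 : 0 < 1 + x / rt N.
  by have := ler_norm (- (x / rt N)); rewrite normrN; lra.
rewrite /local_gauss -[in RHS](lnK (x := 1 + x / rt N)) ?posrE// -expRM_natl -!expRD.
congr expR; rewrite /del natrM; move: (ln _) => l.
have := rt_sq N; move: (rt N) r0 => r r0 <-.
by field; rewrite gt_eqF.
Qed.

(** Minus the slope of [shifted_cdf N] at 0, where the mean is N; its limit is what Stirling's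
    formula would give. *)
Definition peak N : R := 2 * rt N ^+ (2 * N) / rt N * expR (- N%:R) / (N.-1)`!%:R.

Lemma peak_gt0 N : (0 < N)%N -> 0 < peak N.
Proof.
move=> N0; have r0 := rt_gt0 N0.
rewrite /peak divr_gt0 ?ltr0n ?fact_gt0// mulr_gt0 ?expR_gt0// divr_gt0//.
by rewrite mulr_gt0// exprn_gt0.
Qed.

(** The square root stabilises the variance of a Poisson variable, so in this coordinate the limit
    profile is a Gaussian of fixed variance 1/4. *)
Definition shifted_cdf N x : R := T N ((rt N + x) ^+ 2).

Lemma is_derive_shifted_cdf N x : (0 < N)%N -> 0 < rt N + x ->
  is_derive x 1 (shifted_cdf N) (- (peak N * (local_gauss N x / (1 + x / rt N)))).
Proof.
case: N => // n N0 rx; have r0 := rt_gt0 N0.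
pose g (y : R) := (rt n.+1 + y) ^+ 2.
have dl : is_derive x 1 g (2 * (rt n.+1 + x)).
  have d1 : is_derive x 1 (fun y => rt n.+1 + y) (1 : R).
    have := is_deriveD (is_derive_cstfun (rt n.+1) x) (is_derive_id x (1 : R)).
    by apply: is_derive_eqfun => //; rewrite add0r.
  by apply: is_derive_eqfun (is_derive_powfun 2 d1) => //; rewrite expr1 mulr1.
have dc := is_derive1_comp (is_derive_poisson_cdf n (g x)) dl.
apply: (is_derive_eqfun (g := shifted_cdf n.+1) _ _ dc) => //.
rewrite mulNr; congr (- _); rewrite /peak /local_gauss /eterm /g /=.
have -> : expR (- (rt n.+1 + x) ^+ 2) = expR (- n.+1%:R) * expR (- (2 * rt n.+1 * x + x ^+ 2)).
  rewrite -expRD; congr expR; have := rt_sq n.+1.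
  by move: (rt n.+1) => r <-; ring.
have -> : 1 + x / rt n.+1 = (rt n.+1 + x) / rt n.+1 by field; rewrite gt_eqF.
have e2 (z : R) : z ^+ (2 * n.+1) = z ^+ 2 * (z ^+ 2) ^+ n by rewrite mulnS exprD exprM.
rewrite expr_div_n !e2.
have f0 : 0 < n`!%:R :> R by rewrite ltr0n fact_gt0.
have p0 : 0 < (rt n.+1 ^+ 2) ^+ n by rewrite !exprn_gt0.
move: f0 p0 r0 rx; rewrite {g dl dc}.
move: (n`!%:R) (((rt n.+1 + x) ^+ 2) ^+ n) ((rt n.+1 ^+ 2) ^+ n) (rt n.+1) => f q p r f0 p0 r0 rx.
move: (expR _) (expR _) => E1 E2.
by field; rewrite !gt_eqF.
Qed.
End LocalLimit.

(** * Limit of the Poisson distribution function *)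

Section PoissonLimit.
Variable R : realType.
Implicit Types (M e x y B : R) (N n : nat).
Notation rt N := (Num.sqrt N%:R : R).
Notation T := (@poisson_cdf R).
Notation H := (@shifted_cdf R).

Let rt_sq N : rt N ^+ 2 = N%:R. Proof. by rewrite sqr_sqrtr. Qed.

(** The constant that gives e^{-2x^2} total mass one. *)
Definition peak_lim : R := sqrt2 R / Num.sqrt pi.

Let sqrtpi_gt0 : 0 < Num.sqrt pi :> R. Proof. by rewrite sqrtr_gt0 pi_gt0. Qed.

Lemma peak_lim_gt0 : 0 < peak_lim.
Proof. by rewrite divr_gt0// sqrt2_gt0. Qed.

Definition half_erfc x : R := erfc (sqrt2 R * x) / 2.

Lemma is_derive_half_erfc x :
  is_derive x 1 half_erfc (- (peak_lim * expR (- (2 * x ^+ 2)))).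
Proof.
have d1 := is_derive_scale (is_derive_gauss_tail (sqrt2 R * x)).
apply: (is_derive_eqfun (g := half_erfc) _ _
  (is_derive_mulfun (is_derive_cstfun (Num.sqrt pi)^-1 x) d1)) => [y|].
  by rewrite /half_erfc erfcE; move: sqrtpi_gt0; move: (Num.sqrt pi) => p p0; field; rewrite gt_eqF.
rewrite /gauss_fun exprMn sqrt2K /peak_lim; ring.
Qed.

Lemma unif_density M :
  unif M (fun N x => @local_gauss R N x / (1 + x / rt N)) (fun x => expR (- (2 * x ^+ 2))).
Proof.
have [N0 H0] := sqrt_nat_ge (1 : R).
have u0 : unif M (fun N x => x / rt N) (fun=> 0).
  apply: (@unif0_le _ N0 M) => N x NN xM; rewrite normrM normfV.
  have r0 : 0 < rt N by rewrite (lt_le_trans ltr01) ?H0.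
  by rewrite (gtr0_norm r0) ler_pM2r// invr_gt0.
have u1 : unif M (fun N x => (1 + x / rt N)^-1) (fun=> 1^-1).
  apply: (@unifV _ M _ _ 1) => //.
  by apply: (unif_lim _ (unifD (unif_cst M (fun=> 1)) u0)) => x _; exact: addr0.
apply: (unif_lim _ (unifM (A := 1) (B := 1) _ _ (@unif_local_gauss R M) u1)) => x _.
- by rewrite invr1 mulr1.
- by rewrite ger0_norm ?expR_ge0// -expR0 ler_expR oppr_le0 mulr_ge0 ?sqr_ge0.
- by rewrite invr1 normr1.
Qed.

Lemma shifted_cdf_ge0 N x : 0 <= H N x.
Proof. by rewrite poisson_cdf_ge0 ?sqr_ge0. Qed.

Lemma shifted_cdf_le1 N x : H N x <= 1.
Proof. by rewrite poisson_cdf_le1 ?sqr_ge0. Qed.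

(** Chebyshev with r = sqrt N and (r + B)^2 - r^2 >= B (r + B): the variance (r + B)^2 cancels,
    which makes the bound uniform in N. *)
Lemma shifted_cdf_right N B : 0 < B -> H N B <= 1 / B ^+ 2.
Proof.
move=> B0; have r0 : 0 <= rt N by rewrite sqrtr_ge0.
have s : N%:R <= (rt N + B) ^+ 2 by have := rt_sq N; move: (rt N) r0 => r r0 <-; nra.
have := poisson_upper_tail s; rewrite -/(H N B); have := rt_sq N.
have h0 := shifted_cdf_ge0 N B.
move: (rt N) r0 (H N B) h0 {s} => r r0 h h0 <- tail.
rewrite ler_pdivlMr ?exprn_gt0//.
have p0 : 0 < (r + B) ^+ 2 by rewrite exprn_gt0// ltr_wpDl.
rewrite -(ler_pM2r p0) mul1r (le_trans _ tail)//.
have -> : h * B ^+ 2 * (r + B) ^+ 2 = (B * (r + B)) ^+ 2 * h by ring.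
apply: ler_wpM2r => //; rewrite lerXn2r ?nnegrE//; nra.
Qed.

Lemma shifted_cdf_left N B : 0 < B -> B <= rt N -> 1 - H N (- B) <= 1 / B ^+ 2.
Proof.
move=> B0 Br.
have s : (rt N - B) ^+ 2 <= N%:R by have := rt_sq N; move: (rt N) Br => r Br <-; nra.
have := poisson_lower_tail (sqr_ge0 _) s; rewrite -/(H N (- B)); have := rt_sq N.
have h0 : 0 <= 1 - H N (- B) by rewrite subr_ge0 shifted_cdf_le1.
move: (rt N) Br (1 - H N (- B)) h0 {s} => r Br h h0 <- tail.
rewrite ler_pdivlMr ?exprn_gt0//.
have p0 : 0 < r ^+ 2 by rewrite exprn_gt0// (lt_le_trans B0).
rewrite -(ler_pM2r p0) mul1r (@le_trans _ _ ((r - B) ^+ 2))//; last by nra.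
apply: le_trans tail.
have -> : h * B ^+ 2 * r ^+ 2 = (B * r) ^+ 2 * h by ring.
apply: ler_wpM2r => //; rewrite lerXn2r ?nnegrE//; nra.
Qed.

Lemma half_erfc_right B : 1 <= B -> half_erfc B <= 1 / B.
Proof.
move=> B1; have s1 : 1 <= sqrt2 R by have := sqrt2K R; have := sqrt2_gt0 R; move: (sqrt2 R) => s; nra.
have sB : B <= sqrt2 R * B by rewrite ler_peMl//; lra.
have /erfc_le h : 0 < sqrt2 R * B by lra.
have : 1 / (sqrt2 R * B) <= 1 / B by rewrite !mul1r lef_pV2 ?posrE//; lra.
have := erfc_ge0 (sqrt2 R * B); rewrite /half_erfc; lra.
Qed.

Lemma half_erfcN x : half_erfc (- x) = 1 - half_erfc x.
Proof. by rewrite /half_erfc mulrN erfcN; field. Qed.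

Lemma half_erfc_ge0 x : 0 <= half_erfc x.
Proof. by rewrite divr_ge0 ?erfc_ge0. Qed.

Lemma half_erfc_le1 x : half_erfc x <= 1.
Proof. by have := erfc_le2 (sqrt2 R * x); rewrite /half_erfc; lra. Qed.

Lemma shifted_cdf_increment B e : 0 < e -> 0 <= B ->
  exists N0, forall N, (N0 <= N)%N -> forall x y, - B <= x -> x <= y -> y <= B ->
  `|(H N y - H N x) - peak R N / peak_lim * (half_erfc y - half_erfc x)|
     <= peak R N / peak_lim * e.
Proof.
move=> e0 B0; have k0 := peak_lim_gt0.
(* Chosen so that the uniform error of the densities, accumulated over an interval of length at most
   2B, stays below e in units of peak / [peak_lim]. *)
pose d := e / (peak_lim * (2 * B + 1)).
have d0 : 0 < d by rewrite divr_gt0// mulr_gt0//; lra.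
have [N1 H1] := @unif_density B _ d0; have [N2 H2] := sqrt_nat_ge (B + 1).
exists (maxn N1 N2) => N; rewrite geq_max => /andP[N1N N2N] x y Bx xy yB.
have rB : B < rt N by have := H2 N N2N; lra.
have N0 : (0 < N)%N by rewrite -(ltr0n R) -sqrtr_gt0 (le_lt_trans B0).
have p0 : 0 < peak R N by exact: peak_gt0.
set k := peak R N / peak_lim.
pose D z := H N z - k * half_erfc z.
pose dD z := - (peak R N * (local_gauss N z / (1 + z / rt N) - expR (- (2 * z ^+ 2)))).
have -> : H N y - H N x - k * (half_erfc y - half_erfc x) = D y - D x by rewrite /D; ring.
have DE (z : R) : x <= z <= y -> is_derive z 1 D (dD z).
  move=> /andP[xz zy].
  have dH : is_derive z 1 (H N) (- (peak R N * (local_gauss N z / (1 + z / rt N)))).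
    by apply: is_derive_shifted_cdf => //; lra.
  have dh := is_derive_mulfun (is_derive_cstfun k z) (is_derive_half_erfc z).
  apply: (is_derive_eqfun (g := D) _ _ (is_deriveB dH dh)) => //.
  rewrite /dD /k mul0r add0r; move: (_ / (1 + _)) (expR _) (peak R N) => a b p.
  by move: peak_lim k0 => q q0; field; rewrite gt_eqF.
have DB z : x <= z <= y -> `|dD z| <= peak R N * d.
  move=> /andP[xz zy]; rewrite normrN normrM (gtr0_norm p0) ler_pM2l//.
  by apply/ltW/H1 => //; rewrite ler_norml; apply/andP; split; lra.
apply: le_trans (derive_bound xy DE DB) _.
have y2 : (y - x) / (2 * B + 1) <= 1 by rewrite ler_pdivrMr; lra.
have -> : peak R N * d * (y - x) = k * e * ((y - x) / (2 * B + 1)).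
  by rewrite /k /d; move: peak_lim k0 => q q0; field; rewrite !gt_eqF//; lra.
by rewrite ler_piMr// ltW// mulr_gt0// divr_gt0.
Qed.

(* The tails beyond [B] have mass at most [2 / B], which pins the normalisation to that of the
   Gaussian density; no Stirling formula is needed. *)
Lemma poisson_local_limit M e : 0 < e -> e <= 1 / 8 ->
  exists N0, forall N, (N0 <= N)%N ->
  `|peak R N / peak_lim - 1| <= 4 * e /\
  (forall x, `|x| <= M -> `|H N x - half_erfc x| <= 8 * e).
Proof.
(* The term |M| places x inside [-B, B]; 2 / e makes each tail beyond B at most e / 2. *)
move=> e0 e8; pose B := `|M| + 2 / e; have M0 := normr_ge0 M.
have ei : 1 <= e^-1 by rewrite invr_ge1 ?unitfE ?gt_eqF//; lra.
have B1 : 1 <= B by rewrite /B; lra.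
have Be : 1 / B <= e / 2.
  rewrite ler_pdivrMr /B; last by lra.
  rewrite mulrDr; have -> : e / 2 * (2 / e) = 1 by field; rewrite gt_eqF.
  by rewrite lerDr mulr_ge0//; lra.
have B2 : 1 / B ^+ 2 <= e / 2.
  apply: le_trans Be; rewrite !mul1r lef_pV2 ?posrE ?exprn_gt0//; nra.
have [N1 H1] := @shifted_cdf_increment B e e0 (le_trans ler01 B1).
have [N2 H2] := sqrt_nat_ge B.
exists (maxn N1 N2) => N; rewrite geq_max => /andP[N1N N2N].
have rB := H2 N N2N; have inc := H1 N N1N.
have B0 : 0 < B by lra.
have r1 := le_trans (shifted_cdf_right N B0) B2.
have l1 := le_trans (shifted_cdf_left B0 rB) B2.
have r2 := le_trans (half_erfc_right B1) Be; have := half_erfcN B => l2.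
have r10 := shifted_cdf_ge0 N B; have r20 := half_erfc_ge0 B.
have l10 := shifted_cdf_le1 N (- B).
have N0 : (0 < N)%N by rewrite -(ltr0n R) -sqrtr_gt0 (lt_le_trans B0).
have k0 : 0 < peak R N / peak_lim by rewrite divr_gt0 ?peak_gt0 ?peak_lim_gt0.
move: (peak R N / peak_lim) k0 inc => k k0 inc {H1 H2}.
(* Over [-B, B] both functions fall by 1 up to e, so comparing increments forces k towards 1; e <=
   1/8 first gives k <= 2. *)
have k1 : `|k - 1| <= 4 * e.
  have := inc (- B) B (lexx _) (_ : - B <= B) (lexx _); rewrite l2.
  move=> /(_ ltac:(lra)); rewrite ler_norml => /andP[i1 i2].
  have kh : 0 <= k * half_erfc B by rewrite mulr_ge0// ltW.
  have kb : k * half_erfc B <= k * (e / 2) by apply: ler_wpM2l => //; exact: ltW.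
  have kk : k * (1 - 2 * e) <= 1 by lra.
  have k2 : k <= 2.
    have : 0 <= k * (1 / 8 - e) by rewrite mulr_ge0 ?subr_ge0// ltW.
    by lra.
  have ke : k * e <= 2 * e by rewrite ler_pM2r.
  have ke0 : 0 <= k * e by rewrite mulr_ge0 ?ltW.
  by rewrite ler_norml; apply/andP; split; nra.
split=> // x xM.
have := inc x B; move: xM; rewrite ler_norml => /andP[xM1 xM2].
have := ler_norm M; have e20 : 0 < 2 / e by rewrite divr_gt0.
move=> nM /(_ ltac:(rewrite /B; lra) ltac:(rewrite /B; lra) (lexx _)).
have h0 := half_erfc_ge0 x; have h1 := half_erfc_le1 x.
move: (H N x) (half_erfc x) (half_erfc B) (H N B) r1 r2 r10 r20 h0 h1 => a u v c r1 r2 r10 r20 h0 h1.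
have -> : c - a - k * (v - u) = - ((a - u) - (c - v) + (k - 1) * (v - u)) by ring.
rewrite normrN => i.
have p1 : `|(k - 1) * (v - u)| <= 4 * e.
  rewrite normrM -[leRHS]mulr1 ler_pM//.
  by rewrite ler_norml; apply/andP; split; lra.
have k2 : k <= 2 by move: k1; rewrite ler_norml => /andP[_]; lra.
have ke : k * e <= 2 * e by rewrite ler_pM2r.
move: i p1; rewrite !ler_norml => /andP[i1 i2] /andP[j1 j2].
by apply/andP; split; lra.
Qed.
End PoissonLimit.

(** * Edge and bulk scaling *)

Section EdgeScaling.
Variable R : realType.
Implicit Types (M e x s : R) (N n : nat).
Notation rt N := (Num.sqrt N%:R : R).
Notation T := (@poisson_cdf R).
Notation H := (@shifted_cdf R).

(** Numerator and denominator are multiplied by e^{-2s}: one e^{-s} completes the truncated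
    exponential at s to a distribution function and the other goes into [oweight]; [pweight] takes
    both. *)
Definition oweight n s : R := s * oterm s n * expR (- s).
Definition pweight n s : R := s ^+ 2 * oterm s n * eterm s n * expR (- (2 * s)).

Definition scaled_num n s : R :=
  4 / 3 * ((n.+1%:R + 1 / 2 - s) * T (2 * n.+1) (2 * s)
           - (n.+1%:R + 1 - s) * oweight n s * T n.+1 s + pweight n s).
Definition scaled_den n s : R := 2 * T (2 * n.+1) (2 * s) - 4 * oweight n s * T n.+1 s.

Lemma Dhat_scaled n (a : R) : Dhat n.+1 a = scaled_num n (a ^+ 2) / scaled_den n (a ^+ 2).
Proof.
rewrite DhatE; move: (a ^+ 2) => s.
have e2 : expR (- (2 * s)) = expR (- s) * expR (- s) by rewrite -expRD; congr expR; ring.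
have -> : scaled_num n s = expR (- (2 * s)) * overlap_num n s.
  rewrite /scaled_num /oweight /pweight /overlap_num /poisson_cdf -[n.+1%:R]natr1.
  have -> : (2 * n.+1 = 2 * n + 2)%N by lia.
  by rewrite e2; field.
have -> : scaled_den n s = expR (- (2 * s)) * overlap_den n s.
  rewrite /scaled_den /oweight /overlap_den /poisson_cdf.
  have -> : (2 * n.+1 = 2 * n + 2)%N by lia.
  by rewrite e2; ring.
by rewrite -mulf_div divff ?mul1r// gt_eqF ?expR_gt0.
Qed.

Lemma sqrt_double N : rt (2 * N) = sqrt2 R * rt N.
Proof. by rewrite natrM sqrtrM. Qed.

Lemma shifted_cdf_double N x :
  H (2 * N) (sqrt2 R * x) = T (2 * N) (2 * (rt N + x) ^+ 2).
Proof.
by rewrite /shifted_cdf sqrt_double -mulrDr exprMn sqrt2K.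
Qed.

Lemma pow_local_gauss n x : let s := (rt n.+1 + x) ^+ 2 in
  s ^+ n.+1 * expR (- s) = n.+1%:R ^+ n.+1 * expR (- n.+1%:R) * local_gauss n.+1 x.
Proof.
have r0 : 0 < rt n.+1 by rewrite sqrtr_gt0 ltr0n.
have rs : rt n.+1 ^+ 2 = n.+1%:R by rewrite sqr_sqrtr.
rewrite /= /local_gauss.
have -> : (rt n.+1 + x) ^+ 2 = n.+1%:R * (1 + x / rt n.+1) ^+ 2.
  by move: rs; move: (rt n.+1) r0 => r r0 <-; field; rewrite gt_eqF.
have -> : expR (- (n.+1%:R * (1 + x / rt n.+1) ^+ 2)) =
    expR (- n.+1%:R) * expR (- (2 * rt n.+1 * x + x ^+ 2)).
  rewrite -expRD; congr expR.
  by move: rs; move: (rt n.+1) r0 => r r0 <-; field; rewrite gt_eqF.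
rewrite (exprM _ 2 n.+1) exprMn.
by move: (_ ^+ n.+1) (_ ^+ n.+1) (expR _) (expR _) => p q E1 E2; ring.
Qed.

Lemma peak_double n : peak R (2 * n.+1) =
  2 * (4 * (2 ^+ n) ^+ 2 * (n.+1%:R ^+ n.+1) ^+ 2) / (sqrt2 R * rt n.+1)
  * expR (- n.+1%:R) ^+ 2 / ((2 * n + 1)`!)%:R.
Proof.
rewrite /peak sqrt_double (_ : (2 * n.+1).-1 = 2 * n + 1)%N; last by lia.
have -> : (sqrt2 R * rt n.+1) ^+ (2 * (2 * n.+1)) = 4 * (2 ^+ n) ^+ 2 * (n.+1%:R ^+ n.+1) ^+ 2.
  rewrite exprM -sqrt_double sqr_sqrtr// natrM exprMn mulnC !(exprM _ n.+1).
  by congr (_ * _); rewrite (exprS _ n); ring.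
have -> // : expR (- (2 * n.+1)%:R) = expR (- n.+1%:R) ^+ 2 :> R.
by rewrite natrM expr2 -expRD; congr expR; ring.
Qed.

(** The double factorial is (2n + 1)! / (2^n n!), hence a ratio of the peaks at 2N and N. Both have
    the limit [peak_lim], so no separate asymptotics is needed. *)
Lemma oweight_local n x : oweight n ((rt n.+1 + x) ^+ 2) =
  sqrt2 R / 4 * (peak R (2 * n.+1) / peak R n.+1) * local_gauss n.+1 x.
Proof.
have r0 : 0 < rt n.+1 by rewrite sqrtr_gt0 ltr0n.
have -> : oweight n ((rt n.+1 + x) ^+ 2) = 2 ^+ n / (dfact (2 * n + 1))%:R *
    (((rt n.+1 + x) ^+ 2) ^+ n.+1 * expR (- (rt n.+1 + x) ^+ 2)).
  by rewrite /oweight /oterm; move: (_ ^+ 2) => s; rewrite exprMn exprS; ring.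
rewrite pow_local_gauss [LHS]mulrA; congr (_ * _).
have f0 : 0 < n`!%:R :> R by rewrite ltr0n fact_gt0.
have d0 : 0 < (dfact (2 * n + 1))%:R :> R by rewrite ltr0n dfact_gt0.
rewrite (peak_double n) /peak [n.+1.-1]/=.
have -> : rt n.+1 ^+ (2 * n.+1) = n.+1%:R ^+ n.+1 by rewrite exprM sqr_sqrtr.
rewrite fact_dfact !natrM natrX.
have E0 := expR_gt0 (- n.+1%:R : R); have p0 : 0 < n.+1%:R ^+ n.+1 :> R by rewrite exprn_gt0.
have q0 : 0 < 2 ^+ n :> R by rewrite exprn_gt0.
have s0 := sqrt2_gt0 R.
move: (expR _) (n.+1%:R ^+ _) (2 ^+ n) (sqrt2 R) (dfact _)%:R n`!%:R (rt _) E0 p0 q0 s0 d0 f0 r0.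
move=> E p q s d f r E0 p0 q0 s0 d0 f0 r0.
by field; rewrite !gt_eqF.
Qed.

(** The explicit factor sqrt N shows that this term has the same order as the other two at the
    edge. *)
Lemma pweight_local n x : pweight n ((rt n.+1 + x) ^+ 2) =
  sqrt2 R / 8 * rt n.+1 * peak R (2 * n.+1) * local_gauss n.+1 x ^+ 2.
Proof.
have r0 : 0 < rt n.+1 by rewrite sqrtr_gt0 ltr0n.
have -> : pweight n ((rt n.+1 + x) ^+ 2) = (2 ^+ n) ^+ 2 / ((2 * n + 1)`!)%:R *
    (((rt n.+1 + x) ^+ 2) ^+ n.+1 * expR (- (rt n.+1 + x) ^+ 2)) ^+ 2.
  rewrite /pweight; move: ((rt n.+1 + x) ^+ 2) => s; rewrite -[_ * _ * eterm _ _]mulrA oterm_eterm.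
  have -> : expR (- (2 * s)) = expR (- s) ^+ 2 by rewrite expr2 -expRD; congr expR; ring.
  by rewrite [(2 * n)%N]mulnC exprM !exprMn (exprS s n); ring.
rewrite pow_local_gauss exprMn [LHS]mulrA; congr (_ * _).
have f0 : 0 < ((2 * n + 1)`!)%:R :> R by rewrite ltr0n fact_gt0.
rewrite (peak_double n).
have s0 := sqrt2_gt0 R.
move: (expR _) (n.+1%:R ^+ _) (2 ^+ n) (sqrt2 R) (_`!)%:R (rt _) s0 f0 r0.
move=> E p q s f r s0 f0 r0.
by field; rewrite !gt_eqF.
Qed.

Lemma norm_gauss_le1 M x : `|x| <= M -> `|expR (- (2 * x ^+ 2))| <= 1.
Proof. by move=> _; rewrite ger0_norm ?expR_ge0// -expR0 ler_expR oppr_le0 mulr_ge0 ?sqr_ge0. Qed.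

Lemma unif_shifted_cdf M : unif M H (@half_erfc R).
Proof.
move=> e e0; pose d := Num.min (1 / 8) (e / 16).
have d0 : 0 < d by rewrite lt_min !divr_gt0.
have d8 : d <= 1 / 8 by rewrite ge_min lexx.
have d16 : d <= e / 16 by rewrite ge_min lexx orbT.
have [N0 H0] := poisson_local_limit M d0 d8; exists N0 => N NN x xM.
by have [_ h] := H0 N NN; apply: le_lt_trans (h x xM) _; lra.
Qed.

Lemma unif_peak M : unif M (fun N _ => peak R N / peak_lim R) (fun=> 1).
Proof.
move=> e e0; pose d := Num.min (1 / 8) (e / 8).
have d0 : 0 < d by rewrite lt_min !divr_gt0.
have d8 : d <= 1 / 8 by rewrite ge_min lexx.
have d16 : d <= e / 8 by rewrite ge_min lexx orbT.
have [N0 H0] := poisson_local_limit M d0 d8; exists N0 => N NN x xM.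
by have [h _] := H0 N NN; apply: le_lt_trans h _; lra.
Qed.

Lemma unif_oweight M : unif M (fun N x => oweight N.-1 ((rt N + x) ^+ 2))
  (fun x => sqrt2 R / 4 * expR (- (2 * x ^+ 2))).
Proof.
have k0 := peak_lim_gt0 R.
have p2 := unif_double (@unif_peak (2 * M)).
have p1 : unif M (fun N _ => (peak R N / peak_lim R)^-1) (fun=> 1^-1).
  by apply: (@unifV _ M _ _ 1) => //; exact: unif_peak.
have b1 (x : R) : `|x| <= M -> `|1| <= 1 :> R by rewrite normr1.
have b2 (x : R) : `|x| <= M -> `|1^-1| <= 1 :> R by rewrite invr1 normr1.
have b3 (x : R) : `|x| <= M -> `|1 / 1| <= 1 :> R by rewrite invr1 mulr1 normr1.
have b4 x : `|x| <= M -> `|1 / 1 * expR (- (2 * x ^+ 2))| <= 1.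
  by rewrite invr1 !mul1r; exact: norm_gauss_le1.
have := unifZ (sqrt2 R / 4) b4 (unifM b3 (@norm_gauss_le1 M) (unifM b1 b2 p2 p1) (@unif_local_gauss R M)).
move=> h; apply: (unif_lim _ (unif_ext (N1 := 1) _ h)) => [x _|[//|n] x _ _].
  by rewrite invr1 !mul1r.
rewrite oweight_local [n.+1.-1]/=.
have := peak_gt0 R (isT : 0 < n.+1)%N.
move: (local_gauss _ _) (peak R n.+1) (peak R _) => l q p q0.
by move: (peak_lim R) k0 => k k0; field; rewrite !gt_eqF.
Qed.

Lemma unif_pweight M : unif M (fun N x => pweight N.-1 ((rt N + x) ^+ 2) / rt N)
  (fun x => sqrt2 R / 8 * peak_lim R * (expR (- (2 * x ^+ 2)) ^+ 2)).
Proof.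
have k0 := peak_lim_gt0 R.
have p2 := unif_double (@unif_peak (2 * M)).
have b1 (x : R) : `|x| <= M -> `|1| <= 1 :> R by rewrite normr1.
have b2 x : `|x| <= M -> `|expR (- (2 * x ^+ 2)) * expR (- (2 * x ^+ 2))| <= 1.
  by move=> xM; rewrite normrM -[leRHS]mulr1 ler_pM ?(norm_gauss_le1 xM).
have b3 x : `|x| <= M -> `|1 * (expR (- (2 * x ^+ 2)) * expR (- (2 * x ^+ 2)))| <= 1.
  by rewrite mul1r; exact: b2.
have g := @unif_local_gauss R M.
have := unifZ (sqrt2 R / 8 * peak_lim R) b3 (unifM b1 b2 p2 (unifM (@norm_gauss_le1 M) (@norm_gauss_le1 M) g g)).
move=> h; apply: (unif_lim _ (unif_ext (N1 := 1) _ h)) => [x _|[//|n] x _ _].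
  by rewrite mul1r expr2.
rewrite pweight_local [n.+1.-1]/=.
have : 0 < rt n.+1 by rewrite sqrtr_gt0 ltr0n.
move: (rt _) (local_gauss _ _) (peak R _) (peak_lim R) k0 => r l p k k0 r0.
by field; rewrite !gt_eqF.
Qed.

(** N - (sqrt N + x)^2 = - 2 x sqrt N - x^2: the cancellation of the order N is the source of the
    exponent 1/2. *)
Lemma unif_center M (c : R) : unif M (fun N x => (N%:R + c - (rt N + x) ^+ 2) / rt N)
  (fun x => - 2 * x).
Proof.
have u0 : unif M (fun N x => (c - x ^+ 2) / rt N) (fun=> 0).
  apply: (@unif0_le _ 1 (`|c| + `|M| ^+ 2)) => N x N1 xM.
  have r0 : 0 < rt N by rewrite sqrtr_gt0 ltr0n.
  rewrite normrM normfV (gtr0_norm r0) ler_pM2r ?invr_gt0//.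
  rewrite (le_trans (ler_normB _ _))// lerD2l normrX lerXn2r ?nnegrE//.
  by rewrite (le_trans xM)// ler_norm.
apply: (unif_lim _ (unif_ext (N1 := 1) _ (unifD (unif_cst M (fun x => - 2 * x)) u0))) => [x _|N x N1 _].
  by rewrite addr0.
have r0 : 0 < rt N by rewrite sqrtr_gt0 ltr0n.
have : rt N ^+ 2 = N%:R by rewrite sqr_sqrtr.
by move: (rt N) r0 => r r0 <-; field; rewrite gt_eqF.
Qed.
End EdgeScaling.

(** * The edge limit *)

Section EdgeLimit.
Variable R : realType.
Implicit Types (M e x s : R) (N n : nat).
Notation rt N := (Num.sqrt N%:R : R).
Notation T := (@poisson_cdf R).
Notation H := (@shifted_cdf R).

Let g x : R := expR (- (2 * x ^+ 2)).

Let bg M x : `|x| <= M -> `|g x| <= 1. Proof. exact: norm_gauss_le1. Qed.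

Let bh M (x : R) : `|x| <= M -> `|half_erfc x| <= 1.
Proof. by move=> _; rewrite ger0_norm ?half_erfc_ge0 ?half_erfc_le1. Qed.

(** [unifM] asks for bounds on its limit functions; these combine them along the shape of the
    expression. *)
Let bound_mul M (A B : R) (u v : R -> R) : (forall x, `|x| <= M -> `|u x| <= A) ->
  (forall x, `|x| <= M -> `|v x| <= B) -> forall x, `|x| <= M -> `|u x * v x| <= A * B.
Proof. by move=> uA vB x xM; rewrite normrM ler_pM ?uA ?vB. Qed.

Let bound_add M (A B : R) (u v : R -> R) : (forall x, `|x| <= M -> `|u x| <= A) ->
  (forall x, `|x| <= M -> `|v x| <= B) -> forall x, `|x| <= M -> `|u x + v x| <= A + B.
Proof. by move=> uA vB x xM; rewrite (le_trans (ler_normD _ _))// lerD ?uA ?vB. Qed.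

Let bound_cst M (c x : R) : `|x| <= M -> `|c| <= `|c|.
Proof. by []. Qed.

Let bound_center M x : `|x| <= M -> `|- 2 * x| <= 2 * M.
Proof. by move=> xM; rewrite normrM normrN normr_nat ler_pM2l. Qed.

Definition edge_num x : R := 4 / 3 * (- 2 * x * half_erfc (sqrt2 R * x)
  + - 1 * (- 2 * x * (sqrt2 R / 4 * g x * half_erfc x))
  + sqrt2 R / 8 * peak_lim R * g x ^+ 2).

Definition half_edge_den x : R :=
  2 * half_erfc (sqrt2 R * x) + - 4 * (sqrt2 R / 4 * g x * half_erfc x).

Lemma half_edge_denE x : half_edge_den x = edge_den x / sqrt2 R.
Proof.
rewrite /half_edge_den /edge_den /half_erfc /g.
have -> : sqrt2 R * (sqrt2 R * x) = 2 * x by rewrite -[in RHS](sqrt2K R); ring.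
have := sqrt2_gt0 R; have := sqrt2K R; move: (sqrt2 R) (erfc _) (erfc _) (expR _) => s b a G s2 s0.
have -> : s^-1 = s / 2 by apply: (mulfI (lt0r_neq0 s0)); rewrite divff ?gt_eqF// mulrA -expr2 s2 divff.
have -> : (s * a - G * b) * (s / 2) = s ^+ 2 * (a / 2) - s * (G * b / 2) by ring.
by rewrite s2; field.
Qed.

Lemma edge_ratio x : edge_num x / half_edge_den x = rho_e x.
Proof.
have s0 := sqrt2_gt0 R; have s2 := sqrt2K R; have D0 := edge_den_gt0 x.
have sp0 : 0 < Num.sqrt pi :> R by rewrite sqrtr_gt0 pi_gt0.
rewrite half_edge_denE /rho_e -/(edge_den x) invf_div [LHS]mulrA [RHS]mulrA; congr (_ / _).
rewrite /edge_num /half_erfc /g /peak_lim sqrtrM// -/(sqrt2 R).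
have -> : sqrt2 R * (sqrt2 R * x) = 2 * x by rewrite -[in RHS]s2; ring.
have -> : expR (- (4 * x ^+ 2)) = expR (- (2 * x ^+ 2)) ^+ 2.
  by rewrite [RHS]expr2 -expRD; congr expR; ring.
move: (sqrt2 R) (Num.sqrt pi) s0 s2 sp0 (erfc _) (erfc _) (expR _) => s p s0 s2 p0 a b G.
have -> : s / 8 * (s / p) = s ^+ 2 / (8 * p) by field; rewrite gt_eqF.
by rewrite s2; field; rewrite gt_eqF.
Qed.

Lemma edge_num_bounded M : exists A, forall x, `|x| <= M -> `|edge_num x| <= A.
Proof.
have b2 (x : R) : `|x| <= M -> `|half_erfc (sqrt2 R * x)| <= 1.
  by move=> _; rewrite ger0_norm ?half_erfc_ge0 ?half_erfc_le1.
have c1 := @bound_center M.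
have bo := bound_mul (bound_mul (@bound_cst M (sqrt2 R / 4)) (@bg M)) (@bh M).
have bgg : forall x, `|x| <= M -> `|g x ^+ 2| <= 1 by move=> x xM; rewrite normrX expr_le1 ?(bg xM).
have bs := bound_mul (@bound_cst M (4 / 3)) (bound_add (bound_add (bound_mul c1 b2)
  (bound_mul (@bound_cst M (- 1)) (bound_mul c1 bo)))
  (bound_mul (@bound_cst M (sqrt2 R / 8 * peak_lim R)) bgg)).
by exists (`|4 / 3| * (2 * M * 1 + `|- 1| * (2 * M * (`|sqrt2 R / 4| * 1 * 1))
  + `|sqrt2 R / 8 * peak_lim R| * 1)).
Qed.

Lemma unif_edge_num M :
  unif M (fun N x => scaled_num N.-1 ((rt N + x) ^+ 2) / rt N) edge_num.
Proof.
have h2 := unif_double (@unif_shifted_cdf R (2 * M)).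
have b2 (x : R) : `|x| <= M -> `|half_erfc (sqrt2 R * x)| <= 1.
  by move=> _; rewrite ger0_norm ?half_erfc_ge0 ?half_erfc_le1.
have bo := bound_mul (@bound_cst M (sqrt2 R / 4)) (@bg M).
have boh := bound_mul bo (@bh M).
have c1 := @bound_center M.
have t1 := unifM c1 b2 (@unif_center R M (1 / 2)) h2.
have t2a := unifM bo (@bh M) (@unif_oweight R M) (@unif_shifted_cdf R M).
have t2 := unifZ (- 1) (bound_mul c1 boh) (unifM c1 boh (@unif_center R M 1) t2a).
have t3 := @unif_pweight R M.
have bgg : forall x, `|x| <= M -> `|g x ^+ 2| <= 1 by move=> x xM; rewrite normrX expr_le1 ?(bg xM).
have b3 := bound_mul (@bound_cst M (sqrt2 R / 8 * peak_lim R)) bgg.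
have bs := bound_add (bound_add (bound_mul c1 b2)
  (bound_mul (@bound_cst M (- 1)) (bound_mul c1 boh))) b3.
have t := unifZ (4 / 3) bs (unifD (unifD t1 t2) t3).
apply: (unif_ext (N1 := 1) _ t) => -[//|n] x _ _.
rewrite /scaled_num shifted_cdf_double /shifted_cdf [n.+1.-1]/=.
have : 0 < rt n.+1 by rewrite sqrtr_gt0 ltr0n.
move: (T _ _) (T _ _) (oweight _ _) (pweight _ _) => a b c d.
move: ((rt n.+1 + x) ^+ 2) (rt n.+1) => s r r0.
by field; rewrite gt_eqF.
Qed.

Lemma unif_edge_den M :
  unif M (fun N x => scaled_den N.-1 ((rt N + x) ^+ 2)) half_edge_den.
Proof.
have h2 := unif_double (@unif_shifted_cdf R (2 * M)).
have b2 (x : R) : `|x| <= M -> `|half_erfc (sqrt2 R * x)| <= 1.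
  by move=> _; rewrite ger0_norm ?half_erfc_ge0 ?half_erfc_le1.
have bo := bound_mul (@bound_cst M (sqrt2 R / 4)) (@bg M).
have t2 := unifM bo (@bh M) (@unif_oweight R M) (@unif_shifted_cdf R M).
have t := unifD (unifZ 2 b2 h2) (unifZ (- 4) (bound_mul bo (@bh M)) t2).
apply: (unif_ext (N1 := 1) _ t) => -[//|n] x _ _.
rewrite /scaled_den shifted_cdf_double /shifted_cdf [n.+1.-1]/=.
by move: (T _ _) (T _ _) (oweight _ _) => a b c; ring.
Qed.

Lemma unif_edge M : unif M (fun N x => (rt N)^-1 * Dhat N (rt N * 1 + x)) (@rho_e R).
Proof.
(* The limit denominator decreases, so its value at |M| is a positive lower bound on [-M, M]. *)
pose d := half_edge_den `|M|.
have s0 := sqrt2_gt0 R.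
have d0 : 0 < d by rewrite /d half_edge_denE divr_gt0 ?edge_den_gt0.
have dM x : `|x| <= M -> d <= half_edge_den x.
  move=> xM; rewrite /d !half_edge_denE ler_pM2r ?invr_gt0//.
  have : x <= `|M| by rewrite (le_trans (ler_norm x))// (le_trans xM)// ler_norm.
  by rewrite le_eqVlt => /orP[/eqP ->//|/edge_den_decr/ltW].
have [A b1] := edge_num_bounded M.
have b2 x : `|x| <= M -> `|(half_edge_den x)^-1| <= d^-1.
  move=> xM; have := dM x xM => h; have h0 : 0 < half_edge_den x by exact: lt_le_trans h.
  by rewrite gtr0_norm ?invr_gt0// lef_pV2.
have t := unifM b1 b2 (@unif_edge_num M) (unifV d0 dM (@unif_edge_den M)).
apply: (unif_lim (fun x _ => edge_ratio x) (unif_ext (N1 := 1) _ t)) => -[//|n] x _ _.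
by rewrite mulr1 Dhat_scaled [n.+1.-1]/= mulrCA mulrA.
Qed.
End EdgeLimit.

(** * The bulk limit *)

Section BulkLimit.
Variable R : realType.
Implicit Types (M e x s c : R) (N n : nat).
Notation rt N := (Num.sqrt N%:R : R).
Notation T := (@poisson_cdf R).

(** At a mean of at most c m with c < 1 the gap to m is of order m, so Chebyshev gives a tail of
    order 1/m. *)
Lemma poisson_bulk_tail m s c : (0 < m)%N -> 0 <= s -> s <= c * m%:R -> c < 1 ->
  1 - T m s <= ((1 - c) ^+ 2)^-1 / m%:R.
Proof.
move=> m0 s0 sc c1; have m0' : 0 < m%:R :> R by rewrite ltr0n.
have sm : s <= m%:R by apply: le_trans sc _; rewrite ler_piMl// ltW.
have := poisson_lower_tail s0 sm; have t0 : 0 <= 1 - T m s by rewrite subr_ge0 poisson_cdf_le1.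
move: (1 - T m s) t0 => t t0 tail.
have d1 : 0 < 1 - c by rewrite subr_gt0.
rewrite -invfM -[leRHS]mul1r ler_pdivlMr ?mulr_gt0 ?exprn_gt0//.
rewrite -(ler_pM2r m0') mul1r; apply: le_trans sm; apply: le_trans tail.
have -> : t * ((1 - c) ^+ 2 * m%:R) * m%:R = ((1 - c) * m%:R) ^+ 2 * t by ring.
have h0 : 0 <= (1 - c) * m%:R by rewrite mulr_ge0// subr_ge0 ltW.
have h : (1 - c) * m%:R <= m%:R - s by rewrite mulrBl mul1r lerB.
by apply: ler_wpM2r => //; rewrite lerXn2r ?nnegrE// (le_trans h0).
Qed.

(** A Wallis-type inequality, proved in squared form over the integers. The gain 1 / sqrt N is what
    makes [oweight] vanish in the bulk. *)
Lemma oterm_le_eterm s n : 0 <= s -> oterm s n <= eterm s n / rt n.+1.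
Proof.
move=> s0; have r0 : 0 < rt n.+1 by rewrite sqrtr_gt0 ltr0n.
have f0 : 0 < n`!%:R :> R by rewrite ltr0n fact_gt0.
have d0 : 0 < (dfact (2 * n + 1))%:R :> R by rewrite ltr0n dfact_gt0.
have nat_le : ((2 ^ n * n`!) ^ 2 * n.+1 <= dfact (2 * n + 1) ^ 2)%N.
  elim: n {r0 f0 d0} => // n ih.
  have -> : (2 * n.+1 + 1 = (2 * n + 1).+2)%N by lia.
  rewrite dfactSS factS (expnS 2 n).
  apply: (@leq_trans ((2 * n.+1) ^ 2 * n.+2 * (2 ^ n * n`!) ^ 2)).
    by apply: eq_leq; rewrite -!mulnn; move: (2 ^ n)%N n`! => a b; ring.
  rewrite (expnMn (2 * n + 1).+2);
  apply: (@leq_trans (((2 * n + 1).+2 ^ 2) * ((2 ^ n * n`!) ^ 2 * n.+1))).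
    rewrite [X in (_ <= X)%N]mulnCA [X in (X <= _)%N]mulnC leq_mul2l; apply/orP; right.
    by rewrite !expnS !expn0; nia.
  by rewrite leq_mul2l ih orbT.
have : 2 ^+ n * n`!%:R * rt n.+1 <= (dfact (2 * n + 1))%:R :> R.
  rewrite -ler_sqr ?nnegrE ?mulr_ge0// ?exprn_ge0//.
  by rewrite exprMn sqr_sqrtr// -[2 ^+ n]natrX -natrM -!natrX -natrM ler_nat.
move=> h; rewrite /oterm /eterm exprMn; have := exprn_ge0 n s0.
move: h f0 r0 d0; move: (2 ^+ n) (s ^+ n) (n`!%:R) (rt n.+1) (dfact _)%:R => a S f r d h f0 r0 d0 S0.
have -> : S / f / r = S * (f * r)^-1 by rewrite -mulrA -invfM.
have -> : a * S / d = S * (a / d) by rewrite mulrAC mulrC.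
apply: ler_wpM2l => //; rewrite ler_pdivrMr// -ler_pdivrMl ?invr_gt0 ?mulr_gt0//.
by rewrite invrK mulrC mulrA.
Qed.

(** Since s times the n-th exponential term is n + 1 times the next one, this is a point mass, below
    an O(1/N) tail, times N / sqrt N. *)
Lemma oweight_bulk n s c : 0 <= s -> s <= c * n.+1%:R -> c < 1 ->
  oweight n s <= ((1 - c) ^+ 2)^-1 / rt n.+1.
Proof.
move=> s0 sc c1; have r0 : 0 < rt n.+1 by rewrite sqrtr_gt0 ltr0n.
have N0 : 0 < n.+1%:R :> R by rewrite ltr0n.
have h : oweight n s <= n.+1%:R * (expR (- s) * eterm s n.+1) / rt n.+1.
  have -> : n.+1%:R * (expR (- s) * eterm s n.+1) / rt n.+1 = s * (eterm s n / rt n.+1) * expR (- s).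
    by rewrite etermS -natr1; field; rewrite natr1 !gt_eqF.
  by rewrite /oweight ler_wpM2r ?expR_ge0// ler_wpM2l// oterm_le_eterm.
apply: le_trans h _; apply: ler_wpM2r; first by rewrite invr_ge0 ltW.
rewrite -ler_pdivlMl// [leRHS]mulrC.
exact: le_trans (pmf_le_tail _ s0) (poisson_bulk_tail _ s0 sc c1).
Qed.

(** The term is N/2 times the mass at 2N of a Poisson variable of mean 2s, again below an O(1/N)
    tail. *)
Lemma pweight_bulk n s c : 0 <= s -> s <= c * n.+1%:R -> c < 1 ->
  pweight n s <= ((1 - c) ^+ 2)^-1.
Proof.
move=> s0 sc c1.
have N0 : 0 < n.+1%:R :> R by rewrite ltr0n.
have K0 : 0 < ((1 - c) ^+ 2)^-1 by rewrite invr_gt0 exprn_gt0// subr_gt0.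
have -> : pweight n s = n.+1%:R / 2 * (expR (- (2 * s)) * eterm (2 * s) (2 * n.+1)).
  rewrite /pweight -[_ * _ * eterm _ _]mulrA oterm_eterm /eterm.
  have -> : (2 * n.+1 = (2 * n + 1).+1)%N by lia.
  rewrite factS natrM addn1 !exprS.
  have -> : (2 * n).+2%:R = 2 * n.+1%:R :> R by rewrite -natrM; congr (_%:R); lia.
  have : 0 < ((2 * n).+1`!)%:R :> R by rewrite ltr0n fact_gt0.
  move: (_`!)%:R (_ ^+ (2 * n)) (n.+1%:R) (expR _) N0 => f q m E m0 f0.
  by field; rewrite !gt_eqF.
have s20 : 0 <= 2 * s by rewrite mulr_ge0.
have sc2 : 2 * s <= c * (2 * n.+1)%:R by rewrite natrM mulrCA ler_pM2l.
have := le_trans (pmf_le_tail (2 * n.+1) s20) (poisson_bulk_tail (isT : 0 < 2 * n.+1)%N s20 sc2 c1).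
rewrite natrM; move: (expR _ * _) => P; rewrite ler_pdivlMr ?mulr_gt0// => h.
have : 0 < (1 - c) ^-2 by [].
move: (n.+1%:R) N0 h => m m0 h K0'; rewrite mulrC; nra.
Qed.

Section Bulk.
Variables (p M : R).
Hypothesis p1 : -1 < p < 1.
(** The midpoint of p^2 and 1: eventually s <= c N, while c < 1. *)
Let c := (1 + p ^+ 2) / 2.
Let K := ((1 - c) ^+ 2)^-1.
Let q N x := (p + x / rt N) ^+ 2.

Let p2_lt1 : p ^+ 2 < 1.
Proof. by move: p1 => /andP[h1 h2]; nra. Qed.

Let K0 : 0 < K.
Proof. by rewrite invr_gt0 exprn_gt0// /c; have := p2_lt1; lra. Qed.

Let unif_ratio : unif M q (fun=> p ^+ 2).
Proof.
have u0 : unif M (fun N x => x / rt N) (fun=> 0).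
  apply: (@unif0_le _ 1 M) => N x N1 xM; rewrite normrM normfV.
  have r0 : 0 < rt N by rewrite sqrtr_gt0 ltr0n.
  by rewrite (gtr0_norm r0) ler_pM2r// invr_gt0.
have b (x : R) : `|x| <= M -> `|p + 0| <= `|p| by rewrite addr0.
have u1 := unifD (unif_cst M (fun=> p)) u0.
by apply: (unif_lim _ (unifM b b u1 u1)) => x _; rewrite addr0 expr2.
Qed.

Let bulk_point N x : (0 < N)%N -> (rt N * p + x) ^+ 2 = q N x * N%:R.
Proof.
move=> N0; have r0 : 0 < rt N by rewrite sqrtr_gt0 ltr0n.
have : rt N ^+ 2 = N%:R by rewrite sqr_sqrtr.
by rewrite /q; move: (rt N) r0 => r r0 <-; field; rewrite gt_eqF.
Qed.

Let eventually_bulk : exists N0, forall N, (N0 <= N)%N -> forall x, `|x| <= M ->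
  [/\ (0 < N)%N, 0 <= (rt N * p + x) ^+ 2 & (rt N * p + x) ^+ 2 <= c * N%:R].
Proof.
have d0 : 0 < (1 - p ^+ 2) / 2 by rewrite divr_gt0// subr_gt0.
have [N0 H0] := unif_ratio d0; exists (maxn N0 1) => N; rewrite geq_max => /andP[NN N1] x xM.
split=> //; first exact: sqr_ge0.
rewrite bulk_point// ler_pM2r ?ltr0n//.
by have := H0 N NN x xM; rewrite ltr_distl /c => /andP[_]; lra.
Qed.

Let nat_sqrt N (C : R) : (0 < N)%N -> 0 <= C -> C / N%:R <= C / rt N.
Proof.
move=> N0 C0; have r0 : 0 < rt N by rewrite sqrtr_gt0 ltr0n.
have r1 : 1 <= rt N by rewrite -[leLHS]sqrtr1 ler_wsqrtr// ler1n.
apply: ler_wpM2l => //; rewrite lef_pV2 ?posrE ?ltr0n//.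
have : rt N ^+ 2 = N%:R by rewrite sqr_sqrtr.
by move: (rt N) r0 r1 => r r0 r1 <-; rewrite expr2 ler_peMl// ltW.
Qed.

Let unif_cdf : unif M (fun N x => T (2 * N) (2 * (rt N * p + x) ^+ 2)) (fun=> 1).
Proof.
have [N0 H0] := eventually_bulk.
have u0 : unif M (fun N x => T (2 * N) (2 * (rt N * p + x) ^+ 2) - 1) (fun=> 0).
  apply: (@unif0_le _ N0 K) => N x NN xM; have [N1 s0 sc] := H0 N NN x xM.
  move: (_ ^+ 2) s0 sc => s s0 sc.
  have s20 : 0 <= 2 * s by rewrite mulr_ge0.
  have c1 : c < 1 by rewrite /c; have := p2_lt1; lra.
  have N2 : (0 < 2 * N)%N by lia.
  rewrite distrC ger0_norm ?subr_ge0 ?poisson_cdf_le1//.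
  have sc2 : 2 * s <= c * (2 * N)%:R by rewrite natrM mulrCA ler_pM2l.
  apply: le_trans (poisson_bulk_tail N2 s20 sc2 c1) _; rewrite -/K.
  apply: le_trans (nat_sqrt N1 (ltW K0)); apply: ler_wpM2l; first exact: ltW.
  by rewrite lef_pV2 ?posrE ?ltr0n// ler_nat; lia.
apply: (unif_lim _ (unif_ext (N1 := 0) _ (unifD u0 (unif_cst M (fun=> 1))))) => [x _|N x _ _].
  exact: add0r.
by rewrite subrK.
Qed.

Let unif_bulk_oweight :
  unif M (fun N x => oweight N.-1 ((rt N * p + x) ^+ 2) * T N ((rt N * p + x) ^+ 2)) (fun=> 0).
Proof.
have [N0 H0] := eventually_bulk.
apply: (@unif0_le _ N0 K) => -[|n] x NN xM; have [N1 s0 sc] := H0 _ NN x xM => //.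
rewrite [n.+1.-1]/=; move: (_ ^+ 2) s0 sc => s s0 sc.
have c1 : c < 1 by rewrite /c; have := p2_lt1; lra.
have o0 : 0 <= oweight n s by rewrite mulr_ge0 ?expR_ge0// mulr_ge0 ?oterm_ge0.
rewrite ger0_norm; last by apply: mulr_ge0 => //; exact: poisson_cdf_ge0.
apply: le_trans (oweight_bulk s0 sc c1).
by rewrite ler_piMr// poisson_cdf_le1.
Qed.

Let unif_bulk_pweight :
  unif M (fun N x => pweight N.-1 ((rt N * p + x) ^+ 2) / N%:R) (fun=> 0).
Proof.
have [N0 H0] := eventually_bulk.
apply: (@unif0_le _ N0 K) => -[|n] x NN xM; have [N1 s0 sc] := H0 _ NN x xM => //.
rewrite [n.+1.-1]/=; move: (_ ^+ 2) s0 sc => s s0 sc.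
have c1 : c < 1 by rewrite /c; have := p2_lt1; lra.
have o0 : 0 <= pweight n s.
  by rewrite mulr_ge0 ?expR_ge0// mulr_ge0 ?eterm_ge0// mulr_ge0 ?oterm_ge0// exprn_ge0.
rewrite ger0_norm ?divr_ge0//; apply: le_trans (nat_sqrt N1 (ltW K0)).
by rewrite ler_pM2r ?invr_gt0 ?ltr0n// pweight_bulk.
Qed.

Let unif_bulk_center (d : R) :
  unif M (fun N x => 1 + d / N%:R + - 1 * q N x) (fun=> 1 + - 1 * p ^+ 2).
Proof.
have u0 : unif M (fun N x => d / N%:R) (fun=> 0).
  apply: (@unif0_le _ 1 `|d|) => N x N1 xM.
  by rewrite normrM normfV normr_nat nat_sqrt.
have b (x : R) : `|x| <= M -> `|p ^+ 2| <= `|p ^+ 2| by [].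
have := unifD (unifD (unif_cst M (fun=> 1)) u0) (unifZ (- 1) b unif_ratio).
by apply: unif_lim => x _; rewrite addr0.
Qed.

(** Both weights are negligible and the distribution function at 2s tends to 1, so the denominator
    tends to 2 and the numerator divided by N to 4/3 (1 - p^2). *)
Lemma unif_bulk : unif M (fun N x => N%:R^-1 * Dhat N (rt N * p + x)) (fun=> rho_b p).
Proof.
have bc (k x : R) : `|x| <= M -> `|k| <= `|k| by [].
have un := unifZ (4 / 3) (bc _) (unifD (unifD
  (unifM (bc _) (bc _) (unif_bulk_center (1 / 2)) unif_cdf)
  (unifZ (- 1) (bc _) (unifM (bc _) (bc _) (unif_bulk_center 1) unif_bulk_oweight))) unif_bulk_pweight).
have ud := unifD (unifZ 2 (bc _) unif_cdf) (unifZ (- 4) (bc _) unif_bulk_oweight).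
have d2 (x : R) : `|x| <= M -> 1 <= 2 * 1 + - 4 * 0 :> R by rewrite mulr0 addr0 mulr1 ler1n.
have := unifM (bc _) (bc _) un (unifV ltr01 d2 ud).
move=> u; apply: (unif_lim _ (unif_ext (N1 := 1) _ u)) => [x _|[//|n] x _ _].
  by rewrite /rho_b; field.
rewrite Dhat_scaled [n.+1.-1]/= [RHS]mulrA; congr (_ * _); last congr (_^-1).
  have := bulk_point (N := n.+1) x isT => E; rewrite /scaled_num.
  move: (oweight _ _) (pweight _ _) (T _ _) (T _ _) => a b t1 t2; rewrite E.
  have : 0 < n.+1%:R :> R by rewrite ltr0n.
  by move: (q _ _) (n.+1%:R) => k m m0; field; rewrite gt_eqF.
by rewrite /scaled_den; ring.
Qed.
End Bulk.
End BulkLimit.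

Lemma compact_norm_le (R : realType) (K : set R) : compact K ->
  exists M : R, forall x, K x -> `|x| <= M.
Proof.
move=> /compact_bounded [M [_ KM]]; exists (M + 1) => x Kx.
by apply: (KM (M + 1)); rewrite // ltrDl.
Qed.

Theorem theorem2p7 (R : realType) :
  (forall p : R, -1 < p < 1 ->
     forall K : set R, compact K ->
     forall eps : R, 0 < eps ->
     exists N0 : nat, forall N : nat, (N0 <= N)%N ->
     forall chi : R, K chi ->
       `| (N%:R)^-1 * Dhat N (Num.sqrt N%:R * p + chi) - rho_b p | < eps)
  /\
  (forall K : set R, compact K ->
     forall eps : R, 0 < eps ->
     exists N0 : nat, forall N : nat, (N0 <= N)%N ->
     forall chi : R, K chi ->
       `| (Num.sqrt N%:R)^-1 * Dhat N (Num.sqrt N%:R * 1 + chi) - rho_e chi | < eps).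
Proof.
split=> [p p1|] K /compact_norm_le[M KM] eps eps0.
  have [N0 H] := @unif_bulk R p M p1 _ eps0.
  by exists N0 => N NN chi Kchi; apply: H => //; exact: KM.
have [N0 H] := @unif_edge R M _ eps0.
by exists N0 => N NN chi Kchi; apply: H => //; exact: KM.
Qed.
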